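(* Let $a,b>0$, let $R=(0,a)\times(0,b)$, and let $V\subset R$ be measurable such that its fourfold reflected extension $V^\sharp\subset\mathbb T_{a,b}^2$ has finite perimeter. Assume $0<|V|<|R|$ and set $\alpha=|V|/|R|$. Let $$\lambda_*(R,V)=\frac{\pi^2}{ab}\max\left\{1,\left[\frac{C_0\,P_{\mathrm{ref}}(V)\sqrt{ab}}{2\pi|V|\,\eta(\alpha)}\right]^{12}\right\},\qquad \eta(\alpha)=1-\frac{\sin(\pi\alpha)}{\pi\alpha},$$ and set $$N_x^*:=\left\lfloor\frac{a\sqrt{\lambda_*(R,V)}}{\pi}\right\rfloor,\qquad N_y^*:=\left\lfloor\frac{b\sqrt{\lambda_*(R,V)}}{\pi}\right\rfloor.$$ Define $$F_{\mathrm{LF}}(R,V):=\left(\frac{\alpha}{2C_{\mathrm{NT}}}\right)^{2N_x^*+2N_y^*+1},\qquad F_{\mathrm{HF}}(\alpha):=\left[\frac{\alpha}{2}\left(1-\frac{\sin(\pi\alpha)}{\pi\alpha}\right)\right]^{1/2},$$ and $$F_R(V):=\min\{F_{\mathrm{LF}}(R,V),F_{\mathrm{HF}}(\alpha)\}.$$ Then every Dirichlet Laplacian eigenfunction $u$ on $R$ satisfies $$\frac{\|u\|_{L^2(V)}}{\|u\|_{L^2(R)}}\ge F_R(V)>0.$$ Equivalently, $C_2(V;R)\ge F_R(V)>0$. The estimate is uniform in the eigenvalue, its multiplicity, and the choice of eigenfunction within the corresponding eigenspace.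
   Context: $|\cdot|$ of a set denotes Lebesgue measure. $-\Delta_R$ is the nonnegative self-adjoint Dirichlet Laplacian on $L^2(R)$ (complex-valued functions), associated with the form $\int_R\nabla u\cdot\nabla\overline v\,dx$ on $H_0^1(R)$; $E_\lambda(R):=\ker(-\Delta_R-\lambda I)$. Eigenfunctions are nonzero. Set $$C_2(V;R):=\inf_{\lambda\in\sigma(-\Delta_R)}\ \inf_{0\ne u\in E_\lambda(R)}\frac{\|u\|_{L^2(V)}}{\|u\|_{L^2(R)}}.$$ $\mathbb T_{a,b}^2:=\mathbb R^2/(2a\mathbb Z\times2b\mathbb Z)$, with fundamental domain $(-a,a)\times(-b,b)$. The fourfold reflected extension of $V$ is the subset $V^\sharp$ of $\mathbb T_{a,b}^2$ represented by $\{(x,y)\in(-a,a)\times(-b,b):(|x|,|y|)\in V\}$. For measurable $W\subset\mathbb T_{a,b}^2$, $P_{\mathbb T}(W):=|D\mathbf 1_W|(\mathbb T_{a,b}^2)$ is the total variation on the torus of the distributional gradient of the indicator function, and $W$ has finite perimeter if this is finite. The reflected perimeter is $P_{\mathrm{ref}}(V):=P_{\mathbb T}(V^\sharp)$. The numerical constant $C_0$ is $C_0:=2\pi\,2^{1/3}\left[1+4(\pi2^{1/3})^{1/4}\right]$. $C_{\mathrm{NT}}\ge1$ is a universal constant (the Turán–Nazarov constant, whose existence is a known theorem) such that for every integer $M\ge1$, every trigonometric polynomial $p(t)=\sum_{k=0}^{M-1}c_ke^{2\pi ikt}$ with $c_k\in\mathbb C$, and every measurable $E\subset\mathbb T=\mathbb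 R/\mathbb Z$ with $|E|>0$, $$\|p\|_{L^2(\mathbb T)}\le\left(\frac{C_{\mathrm{NT}}}{|E|}\right)^{M-\frac12}\|p\|_{L^2(E)}.$$ *)

(* Defs.v *)
From HB Require Import structures.
From mathcomp Require Import all_boot all_order all_algebra.
From mathcomp Require Import all_classical all_reals all_analysis.
From mathcomp Require Import complex.
Import numFieldNormedType.Exports.
Import Order.TTheory GRing.Theory Num.Theory.

Set Implicit Arguments.
Unset Strict Implicit.
Unset Printing Implicit Defensive.

Local Open Scope classical_set_scope.
Local Open Scope ring_scope.
Local Open Scope complex_scope.

Definition borel_leb2 (R : realType) :
    {measure set (measurableTypeR R * measurableTypeR R) -> \bar R} :=
  (@lebesgue_measure R \x @lebesgue_measure R)%E.

(* The completion of the Borel product measure: its measurable sets are all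
   the Lebesgue measurable subsets of the plane, not only the Borel ones. *)
Definition plane (R : realType) := caratheodory_type (borel_leb2 R)^*%mu.

Definition leb2 (R : realType) : {measure set (plane R) -> \bar R} :=
  @completed_measure_extension _ _ _ (borel_leb2 R).

(* [plane R] is [R * R] as a bare type; this states measurability of a subset
   of [R * R] for the Lebesgue sigma-algebra. *)
Definition leb2_measurable (R : realType) (V : set (R * R)) : Prop :=
  measurable (V : set (plane R)).

Definition area (R : realType) (V : set (R * R)) : R :=
  fine (leb2 R (V : set (plane R))).

Definition cabs2 (R : realType) (z : R[i]) : R := complex.Re z ^+ 2 + complex.Im z ^+ 2.

Definition cintegral (R : realType) (Q : set (R * R)) (f : R * R -> R[i])
    : R[i] :=
  (\int[leb2 R]_(z in (Q : set (plane R))) complex.Re (f z)) +i*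
  (\int[leb2 R]_(z in (Q : set (plane R))) complex.Im (f z)).

Definition inL2 (R : realType) (Q : set (R * R)) (u : R * R -> R[i]) : Prop :=
  [/\ measurable_fun (Q : set (plane R)) (fun z : plane R => complex.Re (u z)),
      measurable_fun (Q : set (plane R)) (fun z : plane R => complex.Im (u z)) &
      (\int[leb2 R]_(z in (Q : set (plane R))) (cabs2 (u z))%:E < +oo)%E].

Definition l2norm (R : realType) (Q : set (R * R)) (u : R * R -> R[i]) : R :=
  Num.sqrt (\int[leb2 R]_(z in (Q : set (plane R))) cabs2 (u z)).

Definition l2inner (R : realType) (Q : set (R * R)) (u v : R * R -> R[i])
    : R[i] :=
  cintegral Q (fun z => u z * conjc (v z)).

Definition ae_zero (R : realType) (Q : set (R * R)) (u : R * R -> R[i])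
    : Prop :=
  {ae leb2 R, forall z : plane R, Q z -> u z = 0}.

Definition pd1 (R : realType) (f : R * R -> R) (z : R * R) : R :=
  'D_((1, 0) : R * R) f z.

Definition pd2 (R : realType) (f : R * R -> R) (z : R * R) : R :=
  'D_((0, 1) : R * R) f z.

Fixpoint Cn (R : realType) (n : nat) (f : R * R -> R) : Prop :=
  if n is m.+1 then
    [/\ forall z, derivable f z ((1, 0) : R * R),
        forall z, derivable f z ((0, 1) : R * R),
        Cn m (pd1 f) & Cn m (pd2 f)]
  else continuous f.

Definition smooth (R : realType) (f : R * R -> R) : Prop :=
  forall n, Cn n f.

Definition test_function (R : realType) (Q : set (R * R))
    (phi : R * R -> R[i]) : Prop :=
  [/\ smooth (fun z => complex.Re (phi z)), smooth (fun z => complex.Im (phi z)) &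
      exists K : set (R * R),
        [/\ compact K, K `<=` Q & forall z, ~ K z -> phi z = 0]].

Definition cpd1 (R : realType) (f : R * R -> R[i]) (z : R * R) : R[i] :=
  pd1 (fun w => complex.Re (f w)) z +i* pd1 (fun w => complex.Im (f w)) z.

Definition cpd2 (R : realType) (f : R * R -> R[i]) (z : R * R) : R[i] :=
  pd2 (fun w => complex.Re (f w)) z +i* pd2 (fun w => complex.Im (f w)) z.

Definition weak_gradient (R : realType) (Q : set (R * R))
    (u g1 g2 : R * R -> R[i]) : Prop :=
  forall phi, test_function Q phi ->
    cintegral Q (fun z => u z * cpd1 phi z)
      = - cintegral Q (fun z => g1 z * phi z) /\
    cintegral Q (fun z => u z * cpd2 phi z)
      = - cintegral Q (fun z => g2 z * phi z).

(* [u] belongs to H^1_0(Q), the closure of the test functions in H^1(Q), and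
   its weak gradient is [(g1, g2)]. *)
Definition H10 (R : realType) (Q : set (R * R))
    (u g1 g2 : R * R -> R[i]) : Prop :=
  [/\ inL2 Q u, inL2 Q g1, inL2 Q g2, weak_gradient Q u g1 g2 &
      forall eps : R, 0 < eps ->
        exists2 phi, test_function Q phi &
          l2norm Q (fun z => u z - phi z) ^+ 2
          + l2norm Q (fun z => g1 z - cpd1 phi z) ^+ 2
          + l2norm Q (fun z => g2 z - cpd2 phi z) ^+ 2 < eps ^+ 2].

(* The graph of the operator -Delta_Q associated with the Dirichlet form:
   [u] is in its domain and -Delta_Q u = f (almost everywhere on Q). *)
Definition dirichlet_laplacian (R : realType) (Q : set (R * R))
    (u f : R * R -> R[i]) : Prop :=
  inL2 Q f /\
  exists g1 g2, H10 Q u g1 g2 /\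
    forall v h1 h2, H10 Q v h1 h2 ->
      l2inner Q g1 h1 + l2inner Q g2 h2 = l2inner Q f v.

(* ker (-Delta_Q - lambda I) *)
Definition eigenspace (R : realType) (Q : set (R * R)) (lambda : R[i])
    : set (R * R -> R[i]) :=
  [set u | dirichlet_laplacian Q u (fun z => lambda * u z)].

Definition eigenfunction (R : realType) (Q : set (R * R)) (lambda : R[i])
    (u : R * R -> R[i]) : Prop :=
  eigenspace Q lambda u /\ ~ ae_zero Q u.

(* -Delta_Q - lambda I is a bijection from its domain onto L^2(Q) with bounded
   inverse. *)
Definition resolvent_set (R : realType) (Q : set (R * R)) : set R[i] :=
  [set lambda | (forall w, eigenspace Q lambda w -> ae_zero Q w) /\
    exists M : R, forall f, inL2 Q f ->
      exists2 u, dirichlet_laplacian Q u (fun z => f z + lambda * u z) &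
        l2norm Q u <= M * l2norm Q f].

Definition spectrum (R : realType) (Q : set (R * R)) : set R[i] :=
  ~` resolvent_set Q.

(* Extended real valued, so that the infimum over a trivial eigenspace is
   +oo. *)
Definition C2 (R : realType) (V Q : set (R * R)) : \bar R :=
  ereal_inf [set ereal_inf
      [set (l2norm V u / l2norm Q u)%:E | u in [set u | eigenfunction Q lambda u]]
    | lambda in spectrum Q].

(* Functions on the torus are the doubly periodic functions on the plane;
   subsets of the torus are given by their representatives in [torus_cell]. *)
Definition torus_cell (R : realType) (a b : R) : set (R * R) :=
  [set z | - a < z.1 < a /\ - b < z.2 < b].

Definition torus_periodic (R : realType) (a b : R) (f : R * R -> R) : Prop :=
  forall z, f (z.1 + 2 * a, z.2) = f z /\ f (z.1, z.2 + 2 * b) = f z.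

(* |Df|(T): the total variation of the distributional gradient of [f]. *)
Definition torus_variation (R : realType) (a b : R) (f : R * R -> R)
    : \bar R :=
  ereal_sup [set x | exists phi1 phi2 : R * R -> R,
    [/\ smooth phi1 /\ smooth phi2,
        torus_periodic a b phi1 /\ torus_periodic a b phi2,
        forall z, Num.sqrt (phi1 z ^+ 2 + phi2 z ^+ 2) <= 1 &
        x = (\int[leb2 R]_(z in (torus_cell a b : set (plane R)))
               (f z * (pd1 phi1 z + pd2 phi2 z)))%:E]].

Definition torus_perimeter (R : realType) (a b : R) (W : set (R * R))
    : \bar R :=
  torus_variation a b \1_W.

Definition reflected_extension (R : realType) (a b : R) (V : set (R * R))
    : set (R * R) :=
  [set z | torus_cell a b z /\ V (`|z.1|, `|z.2|)].

Definition reflected_perimeter (R : realType) (a b : R) (V : set (R * R))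
    : \bar R :=
  torus_perimeter a b (reflected_extension a b V).

Definition trig_poly (R : realType) (M : nat) (c : 'I_M -> R[i]) (t : R)
    : R[i] :=
  \sum_(k < M) c k * (cos (2 * pi * k%:R * t) +i* sin (2 * pi * k%:R * t)).

(* The circle R/Z is represented by [0, 1[. *)
Definition circle_l2norm (R : realType) (E : set R) (p : R -> R[i]) : R :=
  Num.sqrt (\int[completed_lebesgue_measure]_(t in E) cabs2 (p t)).

Definition turan_nazarov (R : realType) (C : R) : Prop :=
  forall (M : nat) (c : 'I_M -> R[i]) (E : set R),
    (0 < M)%N ->
    (wlength idfun)^*%mu.-cara.-measurable E ->
    E `<=` `[0, 1[ ->
    (0 < completed_lebesgue_measure E)%E ->
    circle_l2norm `[0, 1[ (trig_poly c)
      <= (C / fine (completed_lebesgue_measure E)) `^ (M%:R - 2^-1)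
         * circle_l2norm E (trig_poly c).

Definition rectangle (R : realType) (a b : R) : set (R * R) :=
  [set z | 0 < z.1 < a /\ 0 < z.2 < b].

Definition C0 (R : realType) : R :=
  2 * pi * 2 `^ (3^-1) * (1 + 4 * (pi * 2 `^ (3^-1)) `^ (4^-1)).

Definition eta (R : realType) (alpha : R) : R :=
  1 - sin (pi * alpha) / (pi * alpha).

Definition density (R : realType) (a b : R) (V : set (R * R)) : R :=
  area V / area (rectangle a b).

Definition lambda_star (R : realType) (a b : R) (V : set (R * R)) : R :=
  pi ^+ 2 / (a * b) *
  Num.max 1
    ((C0 R * fine (reflected_perimeter a b V) * Num.sqrt (a * b)
      / (2 * pi * area V * eta (density a b V))) ^+ 12).

Definition Nstar (R : realType) (l a b : R) (V : set (R * R)) : int :=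
  Num.floor (l * Num.sqrt (lambda_star a b V) / pi).

Definition F_LF (R : realType) (CNT a b : R) (V : set (R * R)) : R :=
  (density a b V / (2 * CNT))
    ^ (2 * Nstar a a b V + 2 * Nstar b a b V + 1).

Definition F_HF (R : realType) (alpha : R) : R :=
  Num.sqrt (alpha / 2 * (1 - sin (pi * alpha) / (pi * alpha))).

Definition F_R (R : realType) (CNT a b : R) (V : set (R * R)) : R :=
  Num.min (F_LF CNT a b V) (F_HF (density a b V)).

(* Main.v *)
Require Import Defs.
From HB Require Import structures.
From mathcomp Require Import all_boot all_order all_algebra.
From mathcomp Require Import all_classical all_reals all_analysis.
From mathcomp Require Import measurable_realfun complex.
From mathcomp Require Import zify ring lra.
Import numFieldNormedType.Exports.
Import Order.TTheory GRing.Theory Num.Theory.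
Set Implicit Arguments.
Unset Strict Implicit.
Unset Printing Implicit Defensive.
Local Open Scope classical_set_scope.
Local Open Scope ring_scope.

(* Testing the weak eigenvalue equation against sin (m pi x / a) sin (n pi y / b), suitably
   cut off near the boundary, shows that an eigenfunction is orthogonal to all the modes with
   another eigenvalue; since the modes are complete, its real and imaginary parts v are finite
   sums of modes on the circle (m pi / a)^2 + (n pi / b)^2 = lambda.

   If lambda <= lambda_star, the degrees in x and y are bounded, and the Turan-Nazarov
   inequality is applied to horizontal and vertical slices: the set of x such that the slice
   of V over x has length at least alpha b / 2 has measure at least alpha a / 2.

   If lambda > lambda_star, extend v to the torus by odd reflection and write it as
   sum d_k cos (xi_k . z) over the points xi_k of a circle, with sum d_k sin (xi_k . z) = 0.
   Then the integral of v^2 over the reflected set W is the quadratic form of the matrix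
   A_kl, the integral over W of cos ((xi_k - xi_l) . z). Off the diagonal, |A_kl| is at most
   |T| sin (pi alpha) / pi by the bathtub principle, and at most P / |xi_k - xi_l| by the
   definition of the perimeter. By the circumradius formula three points of a lattice of
   covolume 1 on a circle of radius r have a product of mutual distances at least 2 r; hence
   within distance r^(1/3) every point has at most one neighbour, for which the bathtub bound
   is used, while the inverse distances to all the other points add up to O (r^(-1/6)). The
   rows of A are therefore dominated by the diagonal. *)

(** The constants fit together as follows. Let r = sqrt (lambda a b) / pi be the radius of the
    frequency circle after rescaling the lattice to covolume 1, and s = r^(1/6). The inverse
    distances in a row, apart from the near neighbour, add up to at most 46 / s, and [C0] is at
    least 46. The twelfth power in [lambda_star] turns lambda > [lambda_star] into a linear
    condition on s: the perimeter part of a row is then at most half of 4 a b alpha eta, which is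
    what the diagonal 4 a b alpha keeps after subtracting one bathtub bound; the other half is the
    factor alpha / 2 * eta in [F_HF]. At low frequency a sine polynomial of degree M becomes a
    trigonometric polynomial with 2 M + 1 terms, so the squared Turan-Nazarov exponent is 4 M + 1;
    the two directions give (4 Nx + 1) + (4 Ny + 1), twice the exponent of [F_LF]. A technical
    obstacle is that [V] is only Lebesgue measurable: the completed plane is not a product, so
    sections and Fubini require passing to Borel functions, or to a Borel subset of full measure. *)

(** * Measure-preserving maps and invariant integrals *)

(** Preservation is demanded only for subsets of D, which also covers maps such as [fold] that
    preserve measure over a part of the target only. *)
Lemma ge0_integral_measure_preserving d1 d2 (X : measurableType d1)
    (Y : measurableType d2) (R : realType) (phi : X -> Y)
    (m1 : {measure set X -> \bar R}) (m2 : {measure set Y -> \bar R})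
    (D : set Y) (f : Y -> \bar R) : measurable_fun setT phi ->
  (forall A, measurable A -> A `<=` D -> m1 (phi @^-1` A) = m2 A) ->
  measurable D -> measurable_fun D f -> (forall y, D y -> (0 <= f y)%E) ->
  (\int[m2]_(y in D) f y = \int[m1]_(x in phi @^-1` D) f (phi x))%E.
Proof.
move=> mphi m12 mD mf f0.
rewrite -(@ge0_integral_pushforward _ _ X Y R phi mphi m1 D f)//; last first.
  by move=> y; rewrite inE => /f0.
have mpack := isMeasurableFun.Build _ _ _ _ _ mphi.
pose phi' : {mfun X >-> Y} := HB.pack phi mpack.
by apply: (@eq_measure_integral _ _ _ _ (pushforward m1 phi')) => A mA AD; rewrite -m12.
Qed.

Section symmetrize.
Context d (T : measurableType d) (R : realType).
Variables (m : {measure set T -> \bar R}) (s : T -> T).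
Hypothesis ms : measurable_fun setT s.
Hypothesis mps : forall A, measurable A -> m (s @^-1` A) = m A.

Lemma ge0_integral_symmetric (V : set T) (g : T -> \bar R) : measurable V ->
  measurable_fun V g -> (forall z, (0 <= g z)%E) -> (forall z, g (s z) = g z) ->
  (\int[m]_(z in V) g z = \int[m]_(z in s @^-1` V) g z)%E.
Proof.
move=> mV mg g0 gs.
rewrite (@ge0_integral_measure_preserving _ _ _ _ _ s m m V g)//; last first.
  by move=> A mA _; exact: mps.
by apply: eq_integral => z _; rewrite gs.
Qed.

Lemma Rintegral_symmetrize (V : set T) (f : T -> R) :
  measurable V -> (forall z, V z -> ~ V (s z)) ->
  m.-integrable V (EFin \o f) -> (forall z, f (s z) = f z) ->
  m.-integrable (V `|` s @^-1` V) (EFin \o f) /\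
  \int[m]_(z in V `|` s @^-1` V) f z = 2 * \int[m]_(z in V) f z.
Proof.
move=> mV Vs intf fs; set W := V `|` _.
have mV' : measurable (s @^-1` V) by rewrite -[X in measurable X]setTI; exact: ms.
have mfV : measurable_fun V (EFin \o f) by exact: measurable_int intf.
have mfV' : measurable_fun (s @^-1` V) (EFin \o f).
  rewrite (_ : EFin \o f = (EFin \o f) \o s); last by apply/funext => z /=; rewrite fs.
  apply: (@measurable_comp _ _ _ _ _ _ V) => //; first by move=> _ [z Vz <-].
  exact: measurable_funTS.
have EV : (\int[m]_(z in V) (f z)%:E = \int[m]_(z in s @^-1` V) (f z)%:E)%E.
  rewrite integralE [RHS]integralE.
  congr (_ - _)%E; apply: ge0_integral_symmetric => //.
  - exact/measurable_funepos.
  - by move=> z; rewrite !funeposE fs.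
  - exact/measurable_funeneg.
  - by move=> z; rewrite !funenegE fs.
have intf' : m.-integrable (s @^-1` V) (EFin \o f).
  apply/integrableP; split; first by [].
  rewrite -(@ge0_integral_symmetric V (fun z => `|(f z)%:E|%E))//.
  - by have /integrableP[] := intf.
  - exact: measurableT_comp.
  - by move=> z; rewrite fs.
have mW : measurable_fun W (EFin \o f) by exact/measurable_funU.
have VV' : [disjoint V & s @^-1` V] by apply/disj_setPS => z [Vz /=]; exact: Vs.
have intW : m.-integrable W (EFin \o f).
  apply/integrableP; split => //.
  rewrite ge0_integral_setU//=.
  - by apply: lte_add_pinfty; [have /integrableP[] := intf|have /integrableP[] := intf'].
  - exact: (@measurableT_comp _ _ _ _ _ _ abse _ _ (@abse_measurable R setT) mW).
split => //.
by rewrite Rintegral_setU// mulrDl mul1r; congr (_ + _); rewrite /Rintegral EV.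
Qed.

End symmetrize.

(** * Lebesgue measure on the plane: Borel sets, Fubini on boxes, reflections *)

Section plane_measure.
Context {R : realType}.
Local Notation R2 := (measurableTypeR R * measurableTypeR R)%type.
Local Notation mu := (@lebesgue_measure R).

(** By density of the rationals, an open set is the countable union of the boxes with rational end
    points that it contains. *)
Lemma open_measurable2 (U : set (R * R)) : open U -> measurable (U : set R2).
Proof.
move=> oU.
pose box (p : (rat * rat) * (rat * rat)) : set (R * R) :=
  `]ratr p.1.1, ratr p.1.2[%classic `*` `]ratr p.2.1, ratr p.2.2[%classic.
pose D := [set p | box p `<=` U].
have -> : U = \bigcup_(p in D) box p.
  apply/seteqP; split=> [[x y] Uxy|z [p Dp]]; last exact: Dp.
  have : nbhs (x, y) U by exact: open_nbhs_nbhs.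
  case=> -[A B] /= [/nbhs_ballP[e /= e0 eA] /nbhs_ballP[d /= d0 dB]] AB.
  have [q1 /itvP q1P] := @rat_in_itvoo R (x - e) x ltac:(lra).
  have [q2 /itvP q2P] := @rat_in_itvoo R x (x + e) ltac:(lra).
  have [q3 /itvP q3P] := @rat_in_itvoo R (y - d) y ltac:(lra).
  have [q4 /itvP q4P] := @rat_in_itvoo R y (y + d) ltac:(lra).
  exists ((q1, q2), (q3, q4)); last first.
    by split=> /=; rewrite in_itv/= ?q1P ?q2P ?q3P ?q4P.
  move=> [s t] [/=]; rewrite !in_itv/= => /andP[s1 s2] /andP[t1 t2].
  apply: AB; split=> /=.
    apply: eA; rewrite /ball/= ltr_norml.
    have := q1P; have := q2P => H1 H2.
    have h1 : ratr q2 < x + e by rewrite q2P.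
    have h2 : x - e < ratr q1 by rewrite q1P.
    by apply/andP; split; lra.
  apply: dB; rewrite /ball/= ltr_norml.
  have h1 : ratr q4 < y + d by rewrite q4P.
  have h2 : y - d < ratr q3 by rewrite q3P.
  by apply/andP; split; lra.
rewrite bigcup_mkcond; apply: countable_bigcupT_measurable => // p.
by case: ifP => // _; apply: measurableX; exact: measurable_itv.
Qed.

Lemma continuous_measurable2 (f : R * R -> R) :
  continuous f -> measurable_fun (setT : set R2) f.
Proof.
move=> /continuousP cf.
apply: (measurability (@RGenOpens.G R)) => [|_ [_ [a [b ->] <-]]].
  exact: RGenOpens.measurableE.
by rewrite setTI; apply: open_measurable2; exact: cf.
Qed.

Lemma borel_plane_measurable (A : set R2) :
  measurable A -> measurable (A : set (plane R)).
Proof. by move=> mA; apply: sub_caratheodory; exact: sub_sigma_algebra. Qed.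

Lemma leb2_borelE (A : set R2) :
  measurable A -> leb2 R (A : set (plane R)) = borel_leb2 R A.
Proof. exact: measurable_mu_extE. Qed.

Lemma borel_plane_measurable_fun d (T : measurableType d) (D : set (R * R))
    (f : R2 -> T) : measurable D ->
  measurable_fun D f -> measurable_fun (D : set (plane R)) f.
Proof.
by move=> mD mf mD' Y mY; apply: borel_plane_measurable; exact: mf.
Qed.

Lemma measurable_id_plane : measurable_fun (setT : set (plane R)) (id : plane R -> R2).
Proof. by move=> _ Y mY; rewrite setTI; exact: borel_plane_measurable. Qed.

(** The identity from the completed plane to the Borel plane is measurable and preserves measure, so
    integrals of Borel functions can be computed for the product measure. *)
Lemma ge0_integral_plane (D : set (R * R)) (f : R * R -> \bar R) : measurable (D : set R2) ->
  measurable_fun D (f : R2 -> \bar R) -> (forall z, D z -> (0 <= f z)%E) ->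
  (\int[leb2 R]_(z in (D : set (plane R))) f z = \int[borel_leb2 R]_(z in (D : set R2)) f z)%E.
Proof.
move=> mD mf f0.
rewrite (@ge0_integral_measure_preserving _ _ _ _ _ _ (leb2 R) (borel_leb2 R) D f
  measurable_id_plane)// => A mA _.
exact: leb2_borelE.
Qed.

Lemma integral_plane (D : set (R * R)) (f : R * R -> \bar R) : measurable (D : set R2) ->
  measurable_fun D (f : R2 -> \bar R) ->
  (\int[leb2 R]_(z in (D : set (plane R))) f z = \int[borel_leb2 R]_(z in (D : set R2)) f z)%E.
Proof.
move=> mD mf; rewrite integralE [RHS]integralE.
by rewrite !ge0_integral_plane//; [exact: measurable_funeneg|exact: measurable_funepos].
Qed.

Lemma bounded_integrable d (T : measurableType d) (m : {measure set T -> \bar R})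
    (D : set T) (f : T -> R) (M : R) : measurable D -> (m D < +oo)%E ->
  measurable_fun D f -> (forall x, D x -> `|f x| <= M) ->
  m.-integrable D (EFin \o f).
Proof.
move=> mD Doo mf fM; apply: measurable_bounded_integrable => //.
exists M; split; first exact: num_real.
by move=> x Mx y /= Dy; rewrite (le_trans (fM _ Dy))// ltW.
Qed.

Section fubini_box.
Variables (I J : set (measurableTypeR R)) (f : R * R -> R) (M : R).
Hypotheses (mI : measurable I) (mJ : measurable J).
Hypotheses (Ioo : (mu I < +oo)%E) (Joo : (mu J < +oo)%E).
Hypothesis mf : measurable_fun (setT : set R2) f.
Hypothesis fM : forall z, (I `*` J) z -> `|f z| <= M.

Let IJ := (I `*` J : set R2).
Let mIJ : measurable IJ. Proof. exact: measurableX. Qed.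

Lemma borel_leb2_box : borel_leb2 R IJ = (mu I * mu J)%E.
Proof. by rewrite -[LHS]/((mu \x mu)%E _) product_measure1E. Qed.

Let IJoo : (borel_leb2 R IJ < +oo)%E.
Proof. by rewrite borel_leb2_box lte_mul_pinfty// ge0_fin_numE. Qed.

Let intf : (borel_leb2 R).-integrable IJ (EFin \o f).
Proof.
apply: (bounded_integrable (M := M)) => //.
exact: measurable_funTS.
Qed.

(** Extending by zero reduces the box to the whole plane; the sections of the extension are again
    extensions by zero. *)
Let g : R2 -> \bar R := (EFin \o f) \_ IJ.

Let intg : (borel_leb2 R).-integrable setT g.
Proof. by rewrite -integrable_mkcond. Qed.

Let gE x y : g (x, y) = if x \in I then ((EFin \o f \o pair x) \_ J) y else 0%E.
Proof.
rewrite /g /patch /IJ in_setX /=; by case: (x \in I); case: (y \in J).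
Qed.

Let gE' x y : g (x, y) = if y \in J then ((EFin \o f \o pair^~ y) \_ I) x else 0%E.
Proof.
rewrite /g /patch /IJ in_setX /=; by case: (x \in I); case: (y \in J).
Qed.

Let mfx x : measurable_fun (setT : set (measurableTypeR R)) (fun y => f (x, y)).
Proof. by apply: measurableT_comp => //; exact: pair1_measurable. Qed.

Let mfy y : measurable_fun (setT : set (measurableTypeR R)) (fun x => f (x, y)).
Proof. by apply: measurableT_comp => //; exact: pair2_measurable. Qed.

Lemma integrable_section1 x : I x -> mu.-integrable J (fun y => (f (x, y))%:E).
Proof.
move=> Ix; apply: (bounded_integrable (M := M)) => //; first exact: measurable_funTS.
by move=> y Jy; apply: fM.
Qed.

Lemma integrable_section2 y : J y -> mu.-integrable I (fun x => (f (x, y))%:E).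
Proof.
move=> Jy; apply: (bounded_integrable (M := M)) => //; first exact: measurable_funTS.
by move=> x Ix; apply: fM.
Qed.

Let fubini_FE :
  fubini_F mu g = (fun x => (\int[mu]_(y in J) f (x, y))%:E) \_ I.
Proof.
apply/funext => x; rewrite /fubini_F; under eq_integral do rewrite gE.
rewrite /patch; case: ifPn => [|_]; last by rewrite integral0.
rewrite inE => Ix; rewrite -[in LHS]integral_mkcond.
rewrite /= fineK//; apply: integrable_fin_num => //.
exact: integrable_section1.
Qed.

Let fubini_GE :
  fubini_G mu g = (fun y => (\int[mu]_(x in I) f (x, y))%:E) \_ J.
Proof.
apply/funext => y; rewrite /fubini_G; under eq_integral do rewrite gE'.
rewrite /patch; case: ifPn => [|_]; last by rewrite integral0.
rewrite inE => Jy; rewrite -[in LHS]integral_mkcond.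
rewrite /= fineK//; apply: integrable_fin_num => //.
exact: integrable_section2.
Qed.

Lemma Rintegral_fubini1 :
  \int[leb2 R]_(z in (IJ : set (plane R))) f z =
  \int[mu]_(x in I) \int[mu]_(y in J) f (x, y).
Proof.
rewrite /Rintegral integral_plane//; last exact/measurable_EFinP/measurable_funTS.
have -> : (\int[borel_leb2 R]_(z in IJ) (f z)%:E = \int[mu]_x fubini_F mu g x)%E.
  rewrite integral_mkcond; exact: (esym (@integral12_prod_meas1 _ _ _ _ _ mu mu g intg)).
by rewrite fubini_FE -integral_mkcond.
Qed.

Lemma Rintegral_fubini2 :
  \int[leb2 R]_(z in (IJ : set (plane R))) f z =
  \int[mu]_(y in J) \int[mu]_(x in I) f (x, y).
Proof.
rewrite /Rintegral integral_plane//; last exact/measurable_EFinP/measurable_funTS.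
have -> : (\int[borel_leb2 R]_(z in IJ) (f z)%:E = \int[mu]_x fubini_G mu g x)%E.
  rewrite integral_mkcond; exact: (esym (@integral21_prod_meas1 _ _ _ _ _ mu mu g intg)).
by rewrite fubini_GE -integral_mkcond.
Qed.

End fubini_box.

Local Notation lam A := (leb2 R (A : set (plane R))).

Lemma le_leb2 (A B : set (R * R)) : A `<=` B -> (lam A <= lam B)%E.
Proof. exact: (@le_mu_ext _ _ _ (borel_leb2 R)). Qed.

(** On any set [leb2] is the outer measure, an infimum over countable Borel covers; intersecting
    covers that are optimal up to 1 / (n + 1) attains it. *)
Lemma borel_hull (A : set (R * R)) : (lam A < +oo)%E ->
  exists2 G : set (R * R), measurable (G : set R2) & A `<=` G /\ lam G = lam A.
Proof.
move=> Aoo.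
have cov n : exists2 C : (set R2)^nat, measurable_cover A C &
    (\sum_(0 <= k <oo) borel_leb2 R (C k) < lam A + (n.+1%:R^-1)%:E)%E.
  have n0 : 0 < n.+1%:R^-1 :> R by rewrite invr_gt0 ltr0n.
  have fA : lam A \is a fin_num by rewrite ge0_fin_numE// outer_measure_ge0.
  by have [_ [C AC <-] CA] := lb_ereal_inf_adherent n0 fA; exists C.
pose C n := projT1 (cid2 (cov n)).
have AC n : measurable_cover A (C n) by rewrite /C; case: cid2.
have CA n : (\sum_(0 <= k <oo) borel_leb2 R (C n k) < lam A + (n.+1%:R^-1)%:E)%E.
  by rewrite /C; case: cid2.
pose F n := \bigcup_m C n m.
have mF n : measurable (F n).
  by apply: bigcupT_measurable => m; case: (AC n) => mC _; exact: mC.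
have mG : measurable (\bigcap_n F n : set R2) by exact: bigcapT_measurable.
have AG : A `<=` \bigcap_n F n by move=> z Az n _; case: (AC n) => _; exact.
exists (\bigcap_n F n) => //; split => //.
apply/eqP; rewrite eq_le (le_leb2 AG) andbT.
apply/lee_addgt0Pr => _/posnumP[e].
near \oo => n.
apply: (@le_trans _ _ (lam (F n))); first by apply: le_leb2; exact: bigcap_inf.
rewrite leb2_borelE//.
apply: (@le_trans _ _ (\sum_(0 <= k <oo) borel_leb2 R (C n k))%E).
  by apply: measure_sigma_subadditive => //; case: (AC n).
apply: (le_trans (ltW (CA n))); rewrite leeD2l// lee_fin ltW//.
by near: n; exact: near_infty_natSinv_lt.
Unshelve. all: by end_near. Qed.

(** With G a hull of V and H a hull of the null set G minus V, the set G minus H is Borel, lies in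
    V, and misses only points of H. *)
Lemma borel_kernel (V : set (R * R)) : measurable (V : set (plane R)) ->
  (lam V < +oo)%E ->
  exists2 B : set (R * R), measurable (B : set R2) & B `<=` V /\ lam (V `\` B) = 0%E.
Proof.
move=> mV Voo; have [G mG [VG GV]] := borel_hull Voo.
have mG' := borel_plane_measurable mG.
have GV0 : lam (G `\` V) = 0%E.
  rewrite measureD//=; last by rewrite -/(leb2 R) GV.
  by rewrite setIidr// -/(leb2 R) GV subee// ge0_fin_numE.
have [|H mH [GVH H0]] := @borel_hull (G `\` V); first by rewrite GV0.
have mH' := borel_plane_measurable mH.
exists (G `\` H); first exact: measurableD.
split=> [z [Gz Hz]|]; first by apply: contrapT => Vz; apply: Hz; apply: GVH.
apply/eqP; rewrite eq_le measure_ge0 andbT -GV0 -H0; apply: le_leb2 => z [Vz].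
by move=> /not_andP[|/contrapT//]; have := VG _ Vz.
Qed.

Definition flip1 (z : R * R) : R * R := (- z.1, z.2).
Definition flip2 (z : R * R) : R * R := (z.1, - z.2).

Section involution.
Variable s : R * R -> R * R.
Hypothesis sK : involutive s.
Hypothesis ms : measurable_fun setT (s : R2 -> R2).
Hypothesis ls : forall A : set R2, measurable A ->
  borel_leb2 R (s @^-1` A) = borel_leb2 R A.

Let le_lam_preimage (A : set (R * R)) : (lam (s @^-1` A) <= lam A)%E.
Proof.
apply: le_ereal_inf_tmp => _ [C [mC AC] <-].
apply: ereal_inf_lbound; exists (fun k => s @^-1` C k); first split.
- by move=> k; rewrite -[X in measurable X]setTI; exact: ms.
- by move=> z /= /AC[k _ Ck]; exists k.
by apply: eq_eseriesr => k _; rewrite ls.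
Qed.

(** Pulling back Borel covers gives one inequality between outer measures; involutivity turns it
    into the other. *)
Lemma lam_preimage (A : set (R * R)) : lam (s @^-1` A) = lam A.
Proof.
apply/eqP; rewrite eq_le le_lam_preimage/=.
have {1}-> : A = s @^-1` (s @^-1` A) by apply/seteqP; split => z /=; rewrite sK.
exact: le_lam_preimage.
Qed.

(** Borel measurability of s does not control preimages of Lebesgue sets. Instead Caratheodory's
    criterion is transported, since s preserves the outer measure of every set. *)
Lemma plane_measurable_preimage (A : set (R * R)) :
  measurable (A : set (plane R)) -> measurable (s @^-1` A : set (plane R)).
Proof.
move=> mA.
have mA' X : lam X = (lam (X `&` A) + lam (X `&` ~` A))%E by exact: mA.
suff H X : lam X = (lam (X `&` s @^-1` A) + lam (X `&` ~` (s @^-1` A)))%E by exact: H.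
rewrite -lam_preimage mA' -[X in (X + _)%E = _]lam_preimage.
rewrite -[X in (_ + X)%E = _]lam_preimage.
by congr (leb2 R _ + leb2 R _)%E; apply/seteqP; split => z /=; rewrite sK.
Qed.

End involution.

Lemma flip1K : involutive flip1.
Proof. by move=> [x y]; rewrite /flip1/= opprK. Qed.

Lemma flip2K : involutive flip2.
Proof. by move=> [x y]; rewrite /flip2/= opprK. Qed.

Lemma measurable_flip1 : measurable_fun setT (flip1 : R2 -> R2).
Proof.
apply: measurable_fun_pair => //=.
by apply: measurableT_comp => //; exact: measurable_fst.
Qed.

Lemma measurable_flip2 : measurable_fun setT (flip2 : R2 -> R2).
Proof.
apply: measurable_fun_pair => //=.
by apply: measurableT_comp => //; exact: measurable_snd.
Qed.

Lemma borel_leb2_flip1 (A : set R2) : measurable A ->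
  borel_leb2 R (flip1 @^-1` A) = borel_leb2 R A.
Proof.
move=> mA.
have mpack := isMeasurableFun.Build _ _ _ _ _ measurable_flip1.
pose f' : {mfun R2 >-> R2} := HB.pack flip1 mpack.
apply/esym/(@product_measure_unique _ _ _ _ _ mu mu (pushforward (borel_leb2 R) f')) => //.
move=> X Y mX mY.
rewrite -[LHS]/((mu \x mu)%E ((-%R @^-1` X) `*` Y)) product_measure1E//.
  by congr (_ * _)%E; exact: lebesgue_measureN.
by rewrite -[X in measurable X]setTI; exact: (@oppr_measurable R setT).
Qed.

Lemma borel_leb2_flip2 (A : set R2) : measurable A ->
  borel_leb2 R (flip2 @^-1` A) = borel_leb2 R A.
Proof.
move=> mA.
have mpack := isMeasurableFun.Build _ _ _ _ _ measurable_flip2.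
pose f' : {mfun R2 >-> R2} := HB.pack flip2 mpack.
apply/esym/(@product_measure_unique _ _ _ _ _ mu mu (pushforward (borel_leb2 R) f')) => //.
move=> X Y mX mY.
rewrite -[LHS]/((mu \x mu)%E (X `*` (-%R @^-1` Y))) product_measure1E//.
  by congr (_ * _)%E; exact: lebesgue_measureN.
by rewrite -[X in measurable X]setTI; exact: (@oppr_measurable R setT).
Qed.

Lemma measurable_plane_flip1 : measurable_fun setT (flip1 : plane R -> plane R).
Proof.
move=> _ A mA; rewrite setTI.
exact: plane_measurable_preimage flip1K measurable_flip1 borel_leb2_flip1 _ mA.
Qed.

Lemma measurable_plane_flip2 : measurable_fun setT (flip2 : plane R -> plane R).
Proof.
move=> _ A mA; rewrite setTI.
exact: plane_measurable_preimage flip2K measurable_flip2 borel_leb2_flip2 _ mA.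
Qed.

(** Written as two successive doublings, to match two uses of [Rintegral_symmetrize]; the copies are
    disjoint because [V] lies in the open quadrant. *)
Lemma reflected_extensionE (a b : R) (V : set (R * R)) : V `<=` rectangle a b ->
  reflected_extension a b V =
  (V `|` flip1 @^-1` V) `|` flip2 @^-1` (V `|` flip1 @^-1` V).
Proof.
move=> VQ; apply/seteqP; split => [[x y] /= [_]|[x y]].
  rewrite /flip1 /flip2 /=.
  case: (ger0P x) => _; case: (ger0P y) => _; tauto.
rewrite /reflected_extension /torus_cell /flip1 /flip2 /=.
have H u v : V (u, v) -> (0 < u < a) && (0 < v < b).
  by move=> /VQ[/= -> ->].
case=> -[] /[dup] /H /andP[/andP[u0 u1] /andP[v0 v1]] Vxy; split.
all: try (by split; apply/andP; split; lra).
- by rewrite !gtr0_norm.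
- by rewrite ltr0_norm ?gtr0_norm// -oppr_gt0.
- by rewrite gtr0_norm ?ltr0_norm// -oppr_gt0.
- by rewrite !ltr0_norm// -oppr_gt0.
Qed.

Lemma Rintegral_reflected (a b : R) (V : set (R * R)) (f : R * R -> R) :
  V `<=` rectangle a b -> measurable (V : set (plane R)) ->
  (leb2 R).-integrable (V : set (plane R)) (EFin \o f) ->
  (forall z, f (flip1 z) = f z) -> (forall z, f (flip2 z) = f z) ->
  let W : set (plane R) := reflected_extension a b V in
  [/\ measurable W, (leb2 R).-integrable W (EFin \o f) &
  \int[leb2 R]_(z in W) f z = 4 * \int[leb2 R]_(z in (V : set (plane R))) f z].
Proof.
move=> VQ mV intf f1 f2 W.
have l1 (A : set (plane R)) : measurable A -> leb2 R (flip1 @^-1` A) = leb2 R A.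
  by move=> _; exact: lam_preimage flip1K measurable_flip1 borel_leb2_flip1 _.
have l2 (A : set (plane R)) : measurable A -> leb2 R (flip2 @^-1` A) = leb2 R A.
  by move=> _; exact: lam_preimage flip2K measurable_flip2 borel_leb2_flip2 _.
have Vflip z : V z -> ~ V (flip1 z).
  by case: z => x y /VQ[/= x1 _] /VQ[/= x2 _]; lra.
have [int1 E1] := Rintegral_symmetrize measurable_plane_flip1 l1 mV Vflip intf f1.
set V1 := V `|` _ in int1 E1.
have mV1 : measurable (V1 : set (plane R)).
  apply: measurableU => //.
  by rewrite -[X in measurable X]setTI; exact: measurable_plane_flip1.
have Vflip' z : V1 z -> ~ V1 (flip2 z).
  by case: z => x y [] /VQ[/= _ x1] [] /VQ[/= _ x2]; lra.
have [int2 E2] := Rintegral_symmetrize measurable_plane_flip2 l2 mV1 Vflip' int1 f2.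
rewrite /W reflected_extensionE//; split => //; last by rewrite E2 E1; lra.
apply: measurableU => //.
by rewrite -[X in measurable X]setTI; exact: measurable_plane_flip2.
Qed.

End plane_measure.

(** * Smooth functions: bumps, plane waves, cutoff sines *)

Section calculus.
Context {R : realType}.
Implicit Types (f g : R -> R) (F : R * R -> R) (x y : R) (z : R * R).

Lemma is_derive_dir1 F z (d : R) :
  is_derive z.1 1 (fun t => F (t, z.2)) d <-> is_derive z ((1, 0) : R * R) F d.
Proof.
have E : (fun h : R => h^-1 *: ((F \o shift z) (h *: ((1, 0) : R * R)) - F z)) =
    (fun h : R => h^-1 *: (((fun t => F (t, z.2)) \o shift z.1) (h *: (1 : R)) - F (z.1, z.2))).
  apply/funext => h; case: z => x y /=; congr (_ *: (F _ - _)).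
  by apply/pair_equal_spec; split => //=; rewrite /GRing.scale /= mulr0 add0r.
split=> -[dF eF]; split.
- by rewrite /derivable E.
- by rewrite /derive E.
- by move: dF; rewrite /derivable E.
- by move: eF; rewrite /derive E.
Qed.

Lemma is_derive_dir2 F z (d : R) :
  is_derive z.2 1 (fun t => F (z.1, t)) d <-> is_derive z ((0, 1) : R * R) F d.
Proof.
have E : (fun h : R => h^-1 *: ((F \o shift z) (h *: ((0, 1) : R * R)) - F z)) =
    (fun h : R => h^-1 *: (((fun t => F (z.1, t)) \o shift z.2) (h *: (1 : R)) - F (z.1, z.2))).
  apply/funext => h; case: z => x y /=; congr (_ *: (F _ - _)).
  by apply/pair_equal_spec; split => //=; rewrite /GRing.scale /= mulr0 add0r.
split=> -[dF eF]; split.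
- by rewrite /derivable E.
- by rewrite /derive E.
- by move: dF; rewrite /derivable E.
- by move: eF; rewrite /derive E.
Qed.

Lemma is_deriveMf f g x (df dg : R) : is_derive x (1 : R) f df ->
  is_derive x (1 : R) g dg -> is_derive x 1 (fun t => f t * g t) (df * g x + f x * dg).
Proof.
move=> f' g'; have := is_deriveM f' g'.
by rewrite /GRing.scale /= addrC [g x * df]mulrC.
Qed.

Lemma is_deriveDf f g x (df dg : R) : is_derive x (1 : R) f df ->
  is_derive x (1 : R) g dg -> is_derive x 1 (fun t => f t + g t) (df + dg).
Proof. by move=> f' g'; exact: is_deriveD f' g'. Qed.

Lemma is_derive_compf f g x (df dg : R) : is_derive (g x) (1 : R) f df ->
  is_derive x (1 : R) g dg -> is_derive x 1 (fun t => f (g t)) (df * dg).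
Proof. exact: is_derive1_comp. Qed.

(** One-variable counterpart of [Cn]: test functions will be tensor products of smooth functions of
    one variable. *)
Fixpoint smooth1_upto (n : nat) f : Prop :=
  if n is m.+1 then (forall x, derivable f x 1) /\ smooth1_upto m (derive1 f)
  else continuous f.

Definition smooth1 f := forall n, smooth1_upto n f.

Lemma derivable_continuous f : (forall x, derivable f x 1) -> continuous f.
Proof. by move=> df x; exact/differentiable_continuous/derivable1_diffP. Qed.

Lemma smooth1_uptoW n f : smooth1_upto n.+1 f -> smooth1_upto n f.
Proof.
elim: n f => [|n IH] f; first by case=> df _; exact: derivable_continuous.
by move=> [df sf]; split => //; exact: IH.
Qed.

Lemma smooth1_derivable f x : smooth1 f -> derivable f x 1.
Proof. by move=> /(_ 1%N)[]. Qed.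

Lemma smooth1_derive f : smooth1 f -> smooth1 (derive1 f).
Proof. by move=> sf n; have [] := sf n.+1. Qed.

Lemma smooth1_continuous f : smooth1 f -> continuous f.
Proof. exact: (fun sf => sf 0%N). Qed.

Lemma smooth1_uptoD n f g : smooth1_upto n f -> smooth1_upto n g ->
  smooth1_upto n (f \+ g).
Proof.
elim: n f g => [|n IH] f g; first by move=> cf cg x; apply: cvgD; [exact: cf|exact: cg].
move=> [df sf] [dg sg]; split; first by move=> x; exact: derivableD.
rewrite (_ : derive1 (f \+ g) = (derive1 f) \+ (derive1 g)); first exact: IH.
by apply/funext => x; rewrite derive1E (deriveD (df x) (dg x)) /= !derive1E.
Qed.

Lemma smooth1_uptoM n f g : smooth1_upto n f -> smooth1_upto n g ->
  smooth1_upto n (f \* g).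
Proof.
elim: n f g => [|n IH] f g; first by move=> cf cg x; apply: cvgM; [exact: cf|exact: cg].
move=> sf' sg'; have sf0 := smooth1_uptoW sf'; have sg0 := smooth1_uptoW sg'.
case: sf' sg' => [df sf] [dg sg]; split; first by move=> x; exact: derivableM.
rewrite (_ : derive1 (f \* g) = (f \* (derive1 g)) \+ (g \* (derive1 f))).
  by apply: smooth1_uptoD; apply: IH.
by apply/funext => x; rewrite derive1E (deriveM (df x) (dg x)) /= !derive1E.
Qed.

Lemma smooth1_upto_cst n (c : R) : smooth1_upto n (cst c).
Proof.
elim: n c => [|n IH] c; first exact: cst_continuous.
split; first by move=> x; exact: derivable_cst.
rewrite (_ : derive1 (cst c) = cst 0) //.
by apply/funext => x; rewrite derive1_cst.
Qed.

Lemma is_derive_affine f (k c x d : R) : is_derive (k * x + c) 1 f d ->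
  is_derive x 1 (fun t => f (k * t + c)) (k * d).
Proof.
move=> df.
have da : is_derive x 1 (fun t => k * t + c) k.
  rewrite (_ : (fun t => k * t + c) = k *: id + cst c)//.
  by apply: is_derive_eq; rewrite addr0 /GRing.scale /= mulr1.
have := @is_derive1_comp _ f (fun t => k * t + c) x d k.
by rewrite [k * d]mulrC => H; exact: (H df da).
Qed.

Lemma smooth1_upto_affine n f (k c : R) : smooth1_upto n f ->
  smooth1_upto n (fun t => f (k * t + c)).
Proof.
elim: n f => [|n IH] f /=.
  move=> cf x; apply: continuous_comp; last exact: cf.
  by apply: cvgD; [apply: cvgMr; exact: cvg_id|exact: cvg_cst].
move=> [df sf].
have dfa x : is_derive x 1 (fun t => f (k * t + c)) (k * (derive1 f) (k * x + c)).
  by apply: is_derive_affine; rewrite derive1E; exact: derivableP.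
split; first by move=> x; case: (dfa x).
rewrite (_ : derive1 _ = (cst k) \* (fun t => (derive1 f) (k * t + c))).
  by apply: smooth1_uptoM; [exact: smooth1_upto_cst|exact: IH].
by apply/funext => x; rewrite derive1E; have [_ ->] := dfa x.
Qed.

Lemma smooth1_sin_cos n : smooth1_upto n (@sin R) /\ smooth1_upto n (@cos R).
Proof.
elim: n => [|n [IHs IHc]]; first by split; [exact: continuous_sin|exact: continuous_cos].
split; split.
- by move=> x; exact: derivable_sin.
- rewrite (_ : derive1 _ = cos) //; apply/funext => x.
  by rewrite derive1E; apply: derive_val.
- by move=> x; exact: derivable_cos.
- rewrite (_ : derive1 _ = cst (-1) \* sin).
    by apply: smooth1_uptoM => //; exact: smooth1_upto_cst.
  by apply/funext => x; rewrite derive1E derive_val /= mulN1r.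
Qed.

(** For k = 0 this is the classical flat function exp (- 1 / t). The powers of 1 / t close the
    family under differentiation, so that smoothness is an induction over all k at once. *)
Definition bump (k : nat) (t : R) : R :=
  if 0 < t then t^-1 ^+ k * expR (- t^-1) else 0.

Lemma bump_ge0 k t : 0 <= bump k t.
Proof.
by rewrite /bump; case: ifPn => // t0; rewrite mulr_ge0 ?expR_ge0// exprn_ge0// invr_ge0 ltW.
Qed.

Lemma bump_npos k t : t <= 0 -> bump k t = 0.
Proof. by rewrite /bump leNgt => /negbTE ->. Qed.

(** exp (1 / t) is at least its Taylor term (1 / t)^(n+1) / (n+1)!. *)
Lemma bump_le k n t : 0 < t ->
  bump k t <= (n.+1)`!%:R * t ^+ n.+1 * t^-1 ^+ k.
Proof.
move=> t0; rewrite /bump t0 mulrC ler_wpM2r ?exprn_ge0 ?invr_ge0 ?(ltW t0)//.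
have ti0 : 0 <= t^-1 by rewrite invr_ge0 ltW.
have := expR_ge1Dxn n ti0.
have F0 : 0 < (n.+1)`!%:R :> R by rewrite ltr0n fact_gt0.
have T0 : 0 < t ^+ n.+1 by rewrite exprn_gt0.
rewrite expRN exprVn => H.
rewrite -[leRHS]invrK lef_pV2 ?posrE ?expR_gt0 ?invr_gt0 ?mulr_gt0//.
by rewrite invfM mulrC; apply: le_trans H; rewrite lerDr.
Qed.

Lemma bump_quadratic k t : `|bump k t| <= (k.+2)`!%:R * t ^+ 2.
Proof.
rewrite ger0_norm ?bump_ge0//.
have [t0|t0] := ltP 0 t; last by rewrite bump_npos// mulr_ge0// sqr_ge0.
apply: (le_trans (bump_le k k.+1 t0)).
rewrite -mulrA ler_wpM2l// exprVn -[in leLHS]addn2 exprD mulrAC mulfV ?mul1r//.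
by rewrite expf_neq0// gt_eqF.
Qed.

Lemma is_derive0_quadratic f (C : R) : (forall t, `|f t| <= C * t ^+ 2) ->
  is_derive (0 : R) (1 : R) f 0.
Proof.
move=> fC.
have f0 : f 0 = 0.
  by apply/eqP; rewrite -normr_le0; have := fC 0; rewrite expr0n/= mulr0.
have C0 : 0 <= C by have := fC 1; rewrite expr1n mulr1; apply: le_trans.
have H : h^-1 *: ((f \o shift 0) (h *: (1 : R)) - f 0) @[h --> 0^'] --> (0 : R).
  apply/cvgrPdist_le => e e0; near=> h.
  rewrite f0 sub0r normrN subr0 /= addr0 /GRing.scale /= mulr1 normrM normfV.
  have h0 : 0 < `|h| by rewrite normr_gt0; near: h; exact: nbhs_dnbhs_neq.
  rewrite ler_pdivrMl//; apply: (le_trans (fC h)).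
  rewrite -real_normK ?num_real// expr2 mulrCA ler_wpM2l//.
  have he : `|h| <= e / (C + 1).
    near: h; apply: dnbhs0_le; rewrite divr_gt0//; lra.
  apply: (@le_trans _ _ ((C + 1) * `|h|)); first by rewrite ler_wpM2r//; lra.
  by rewrite -ler_pdivlMl; [rewrite mulrC|lra].
split; first by apply/cvg_ex; exists 0.
by apply/cvg_lim.
Unshelve. all: by end_near. Qed.

(** Away from 0 this is calculus on either branch; at 0 the formula vanishes and [bump_quadratic]
    yields a zero derivative. *)
Lemma is_derive_bump (k : nat) (t : R) : is_derive t (1 : R) (bump k) (- k%:R * bump k.+1 t + bump k.+2 t).
Proof.
have [t0|t0|->] := ltgtP t 0.
- rewrite !bump_npos ?(ltW t0)// mulr0 addr0.
  have H : \forall x \near t, cst 0 x = bump k x.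
    by near=> x; rewrite /= bump_npos// ltW//; near: x; exact: lt_nbhsl.
  by apply: (near_eq_is_derive H); exact: is_derive_cst.
- have H : \forall x \near t, x^-1 ^+ k * expR (- x^-1) = bump k x.
    by near=> x; rewrite /bump ifT//; near: x; exact: lt_nbhsr.
  apply: (near_eq_is_derive H).
  have tn0 : t != 0 by rewrite gt_eqF.
  rewrite /bump t0.
  have dV : is_derive t 1 (fun x : R => x^-1) (- t^-1 ^+ 2).
    have := @is_deriveV R id t 1 1 tn0 (is_derive_id _ _).
    by rewrite /GRing.scale /= mulr1 exprVn.
  have dX n : is_derive t (1 : R) (fun x : R => x^-1 ^+ n) (- n%:R * t^-1 ^+ n.+1).
    elim: n => [|n IH].
      by rewrite oppr0 mul0r; under eq_fun do rewrite expr0; exact: is_derive_cst.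
    under eq_fun do rewrite exprS.
    refine (is_derive_eq (is_deriveMf dV IH) _).
    by rewrite -natr1 !exprS; ring.
  have dE : is_derive t (1 : R) (fun x => expR (- x^-1)) (expR (- t^-1) * t^-1 ^+ 2).
    have dN : is_derive t (1 : R) (fun x : R => - x^-1) (t^-1 ^+ 2).
      by have := is_deriveN dV; rewrite opprK.
    exact: (is_derive_compf (is_derive_expR _) dN).
  refine (is_derive_eq (is_deriveMf (dX k) dE) _).
  by rewrite !exprS; ring.
- rewrite !bump_npos// mulr0 addr0.
  exact: (is_derive0_quadratic (bump_quadratic k)).
Unshelve. all: by end_near. Qed.

Lemma smooth1_bump k : smooth1 (bump k).
Proof.
move=> n; elim: n k => [|n IH] k.
  by apply: derivable_continuous => x; case: (is_derive_bump k x).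
split; first by move=> x; case: (is_derive_bump k x).
rewrite (_ : derive1 _ = (cst (- k%:R) \* bump k.+1) \+ bump k.+2).
  by apply: smooth1_uptoD => //; apply: smooth1_uptoM => //; exact: smooth1_upto_cst.
by apply/funext => x; rewrite derive1E; have [_ ->] := is_derive_bump k x.
Qed.

Lemma is_derive_tensor1 f g z (df : R) : is_derive z.1 (1 : R) f df ->
  is_derive z ((1, 0) : R * R) (fun z => f z.1 * g z.2) (df * g z.2).
Proof.
move=> H; apply/is_derive_dir1 => /=.
have := @is_deriveMf f (cst (g z.2)) _ _ _ H (is_derive_cst _ _ _).
by rewrite mulr0 addr0.
Qed.

Lemma is_derive_tensor2 f g z (dg : R) : is_derive z.2 (1 : R) g dg ->
  is_derive z ((0, 1) : R * R) (fun z => f z.1 * g z.2) (f z.1 * dg).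
Proof.
move=> H; apply/is_derive_dir2 => /=.
have := @is_deriveMf (cst (f z.1)) g _ _ _ (is_derive_cst _ _ _) H.
by rewrite mul0r add0r.
Qed.

Lemma continuous_tensor f g : continuous f -> continuous g ->
  continuous (fun z : R * R => f z.1 * g z.2).
Proof.
move=> cf cg z; apply: cvgM.
  by apply: continuous_comp; [exact: cvg_fst|exact: cf].
by apply: continuous_comp; [exact: cvg_snd|exact: cg].
Qed.

Lemma smooth1_is_derive f x : smooth1 f -> is_derive x (1 : R) f (derive1 f x).
Proof. by move=> sf; rewrite derive1E; apply/derivableP/smooth1_derivable. Qed.

Lemma smooth_tensor f g : smooth1 f -> smooth1 g ->
  smooth (fun z : R * R => f z.1 * g z.2).
Proof.
move=> sf sg n; elim: n f g sf sg => [|n IH] f g sf sg /=.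
  by apply: continuous_tensor; exact: smooth1_continuous.
have d1 z := is_derive_tensor1 g (smooth1_is_derive z.1 sf).
have d2 z := is_derive_tensor2 f (smooth1_is_derive z.2 sg).
split; [by move=> z; case: (d1 z)|by move=> z; case: (d2 z)| |].
- rewrite (_ : pd1 _ = fun z => derive1 f z.1 * g z.2).
    by apply: IH => //; exact: smooth1_derive.
  by apply/funext => z; have [_ <-] := d1 z.
- rewrite (_ : pd2 _ = fun z => f z.1 * derive1 g z.2).
    by apply: IH => //; exact: smooth1_derive.
  by apply/funext => z; have [_ <-] := d2 z.
Qed.

(** The derivative is written as a cosine with its phase advanced by pi / 2 instead of a sine, so
    that it stays in the same family and smoothness follows by induction over amplitude and
    phase. *)
Lemma is_derive_wave (c k t x : R) :
  is_derive x (1 : R) (fun x => c * cos (k * x + t)) (c * k * cos (k * x + t + pi / 2)).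
Proof.
by apply: is_derive_eq; rewrite cosDpihalf /GRing.scale /=; ring.
Qed.

Lemma is_derive_cos_wave1 (c k l t : R) z :
  is_derive z ((1, 0) : R * R) (fun z => c * cos (k * z.1 + l * z.2 + t))
    (c * k * cos (k * z.1 + l * z.2 + (t + pi / 2))).
Proof.
apply/is_derive_dir1 => /=; rewrite addrA.
rewrite (_ : (fun _ => _) = (fun s => c * cos (k * s + (l * z.2 + t)))); last first.
  by apply/funext => s; rewrite addrA.
by rewrite -[in X in is_derive _ _ _ X](addrA _ (l * z.2)); exact: is_derive_wave.
Qed.

Lemma is_derive_cos_wave2 (c k l t : R) z :
  is_derive z ((0, 1) : R * R) (fun z => c * cos (k * z.1 + l * z.2 + t))
    (c * l * cos (k * z.1 + l * z.2 + (t + pi / 2))).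
Proof.
apply/is_derive_dir2 => /=; rewrite addrA [k * _ + _]addrC.
rewrite (_ : (fun _ => _) = (fun s => c * cos (l * s + (k * z.1 + t)))); last first.
  by apply/funext => s; congr (_ * cos _); ring.
by rewrite -[in X in is_derive _ _ _ X](addrA _ (k * z.1)); exact: is_derive_wave.
Qed.

Lemma smooth_cos_wave (c k l t : R) : smooth (fun z => c * cos (k * z.1 + l * z.2 + t)).
Proof.
move=> n; elim: n c t => [|n IH] c t /=.
  move=> z; apply: cvgM; first exact: cvg_cst.
  apply: continuous_comp; last exact: continuous_cos.
  apply: cvgD; last exact: cvg_cst.
  by apply: cvgD; apply: cvgM; [exact: cvg_cst|exact: cvg_fst|exact: cvg_cst|exact: cvg_snd].
have d1 := is_derive_cos_wave1 c k l t; have d2 := is_derive_cos_wave2 c k l t.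
split; [by move=> z; case: (d1 z)|by move=> z; case: (d2 z)| |].
- rewrite (_ : pd1 _ = fun z => c * k * cos (k * z.1 + l * z.2 + (t + pi / 2))) //.
  by apply/funext => z; have [_ <-] := d1 z.
- rewrite (_ : pd2 _ = fun z => c * l * cos (k * z.1 + l * z.2 + (t + pi / 2))) //.
  by apply/funext => z; have [_ <-] := d2 z.
Qed.

Lemma bump0_le1 (t : R) : bump 0 t <= 1.
Proof.
rewrite /bump; case: ifPn => // t0.
by rewrite expr0 mul1r -expR0 ler_expR oppr_le0 invr_ge0 ltW.
Qed.

Lemma bump0_ge (t : R) : 0 < t -> 1 - t^-1 <= bump 0 t.
Proof. by move=> t0; rewrite /bump t0 expr0 mul1r; exact: expR_ge1Dx. Qed.

Lemma bump2_le2 (t : R) : bump 2 t <= 2.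
Proof.
have [t0|t0] := ltP 0 t; last by rewrite bump_npos.
apply: (le_trans (bump_le 2 1 t0)).
by rewrite exprVn -mulrA mulfV ?mulr1// expf_neq0// gt_eqF.
Qed.

Lemma bump2_le (t : R) : 0 < t -> bump 2 t <= t^-1 ^+ 2.
Proof.
move=> t0; rewrite /bump t0 ler_piMr ?exprn_ge0 ?invr_ge0 ?(ltW t0)//.
by rewrite -expR0 ler_expR oppr_le0 invr_ge0 ltW.
Qed.

(** [bump 2] is the derivative of [bump 0]. For t = k x - 1 the weight t + 1 is k x, so this bounds,
    uniformly in k, the distance x to the boundary times the derivative of the cutoff factor. *)
Lemma bump2_weight_le (t : R) : 0 < t -> (t + 1) * bump 2 t <= 4.
Proof.
move=> t0; have [t1|t1] := leP t 1.
  by have := bump2_le2 t; have := bump_ge0 2 t; nra.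
have ti1 : t^-1 <= 1 by rewrite invf_le1// ltW.
have ti0 : 0 < t^-1 by rewrite invr_gt0.
have := bump2_le t0; rewrite expr2 => H.
apply: (@le_trans _ _ ((t + 1) * (t^-1 * t^-1))); first by rewrite ler_wpM2l//; lra.
by rewrite mulrA mulrDl mulfV ?gt_eqF//; nra.
Qed.

Lemma bump2_weight_le_inv (t : R) : 1 < t -> (t + 1) * bump 2 t <= 2 * t^-1.
Proof.
move=> t1; have t0 : 0 < t by lra.
have ti1 : t^-1 <= 1 by rewrite invf_le1// ltW.
have ti0 : 0 < t^-1 by rewrite invr_gt0.
have := bump2_le t0; rewrite expr2 => H.
apply: (@le_trans _ _ ((t + 1) * (t^-1 * t^-1))); first by rewrite ler_wpM2l//; lra.
by rewrite mulrA mulrDl mulfV ?gt_eqF//; nra.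
Qed.

Lemma norm_sin_le (t : R) : `|sin t| <= `|t|.
Proof.
wlog t0 : t / 0 <= t.
  move=> H; have [/H//|t0] := leP 0 t.
  by have := H (- t); rewrite sinN !normrN; apply; lra.
have [->|tn0] := eqVneq t 0; first by rewrite sin0.
have tp : 0 < t by rewrite lt_neqAle eq_sym tn0.
have [c _] := @MVT R sin cos 0 t tp (fun x _ => is_derive_sin x)
  (continuous_subspaceT (@continuous_sin R)).
rewrite sin0 !subr0 => ->; rewrite normrM ler_piMl//.
exact: cos_max.
Qed.

Lemma cvg_inv_affine (x : R) : 0 < x -> (k%:R * x - 1)^-1 @[k --> \oo] --> 0.
Proof.
move=> x0; apply/cvgrPdist_le => e e0; near=> k.
have k1 : x^-1 * (1 + e^-1) <= k%:R by near: k; exact: nbhs_infty_ger.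
have ei0 : 0 < e^-1 by rewrite invr_gt0.
have kx : e^-1 <= k%:R * x - 1.
  by rewrite lerBrDl mulrC -ler_pdivrMl// ; rewrite mulrC in k1; rewrite mulrC.
have kx0 : 0 < k%:R * x - 1 by lra.
by rewrite sub0r normrN gtr0_norm ?invr_gt0// -[leRHS]invrK lef_pV2 ?posrE.
Unshelve. all: by end_near. Qed.

Lemma near_affine_gt (x M : R) : 0 < x -> \forall k \near \oo, M < k%:R * x - 1.
Proof.
move=> x0; near=> k.
have k1 : x^-1 * (1 + M) < k%:R by near: k; exact: nbhs_infty_gtr.
by rewrite ltrBrDl mulrC -ltr_pdivrMl.
Unshelve. all: by end_near. Qed.

Lemma cvg_bump0 (x : R) : 0 < x -> bump 0 (k%:R * x - 1) @[k --> \oo] --> (1 : R).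
Proof.
move=> x0.
apply: (@squeeze_cvgr _ _ _ _ (fun k : nat => 1 - (k%:R * x - 1)^-1) (fun=> 1)).
- near=> k; rewrite bump0_le1 andbT; apply: bump0_ge.
  by near: k; exact: near_affine_gt.
- rewrite -[X in _ --> X]subr0; apply: cvgB; [exact: cvg_cst|exact: cvg_inv_affine].
- exact: cvg_cst.
Unshelve. all: by end_near. Qed.

Section cutoff.
Variables (a w : R).
Hypotheses (a0 : 0 < a) (w0 : 0 <= w) (swa : sin (w * a) = 0).

(* A smooth compactly supported approximation of [sin (w x)] on ]0, a[. *)
Definition cutoff (k : nat) (x : R) : R :=
  sin (w * x) * (bump 0 (k%:R * x - 1) * bump 0 (- k%:R * x + (k%:R * a - 1))).

Lemma smooth1_cutoff k : smooth1 (cutoff k).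
Proof.
move=> n; apply: smooth1_uptoM.
  rewrite (_ : (fun _ => _) = fun x => sin (w * x + 0)); last first.
    by apply/funext => x; rewrite addr0.
  by apply: smooth1_upto_affine; exact: (smooth1_sin_cos n).1.
by apply: smooth1_uptoM; apply: smooth1_upto_affine; exact: smooth1_bump.
Qed.

Lemma cutoff_supp k x : cutoff k x != 0 -> 1 < k%:R * x /\ 1 < k%:R * (a - x).
Proof.
rewrite /cutoff !mulf_eq0 !negb_or => /and3P[_ h1 h2]; split.
  by rewrite ltNge; apply/negP => H; move: h1; rewrite bump_npos ?eqxx//; lra.
by rewrite ltNge; apply/negP => H; move: h2; rewrite bump_npos ?eqxx//; lra.
Qed.

Lemma cutoff_le1 k x : `|cutoff k x| <= 1.
Proof.
rewrite /cutoff !normrM !(ger0_norm (bump_ge0 _ _)).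
rewrite mulr_ile1 ?sin_max// ?mulr_ge0 ?bump_ge0//.
by rewrite mulr_ile1 ?bump_ge0 ?bump0_le1.
Qed.

Let reflectE k x : - k%:R * x + (k%:R * a - 1) = k%:R * (a - x) - 1.
Proof. by ring. Qed.

Lemma cvg_cutoff x : 0 < x < a -> cutoff k x @[k --> \oo] --> sin (w * x).
Proof.
move=> /andP[x0 xa]; rewrite -[X in _ --> X]mulr1; apply: cvgM; first exact: cvg_cst.
rewrite -[X in _ --> X]mulr1; apply: cvgM; first exact: cvg_bump0.
under eq_fun do rewrite reflectE.
by apply: cvg_bump0; rewrite subr_gt0.
Qed.

Lemma derive1_cutoff k x : derive1 (cutoff k) x =
  w * cos (w * x) * (bump 0 (k%:R * x - 1) * bump 0 (k%:R * (a - x) - 1)) +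
  sin (w * x) * (k%:R * bump 2 (k%:R * x - 1)) * bump 0 (k%:R * (a - x) - 1) -
  sin (w * x) * bump 0 (k%:R * x - 1) * (k%:R * bump 2 (k%:R * (a - x) - 1)).
Proof.
have ds : is_derive x (1 : R) (fun x => sin (w * x)) (w * cos (w * x)).
  rewrite (_ : (fun _ => _) = fun x => sin (w * x + 0)); last first.
    by apply/funext => y; rewrite addr0.
  by apply: is_derive_affine; rewrite addr0; exact: is_derive_sin.
have db c1 c2 y : is_derive y (1 : R) (fun y => bump 0 (c1 * y + c2)) (c1 * bump 2 (c1 * y + c2)).
  apply: is_derive_affine; apply: is_derive_eq; first exact: is_derive_bump.
  by rewrite oppr0 mul0r add0r.
have := is_deriveMf ds (is_deriveMf (db k%:R (-1) x) (db (- k%:R) (k%:R * a - 1) x)).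
by move=> [_ H]; rewrite derive1E [LHS]H reflectE; ring.
Qed.

(** Since w a is a zero of the sine, the mode vanishes linearly at the right end as well. *)
Lemma norm_sin_reflect x : `|sin (w * x)| <= w * `|a - x|.
Proof.
have -> : sin (w * x) = - (cos (w * a) * sin (w * (a - x))).
  have -> : w * x = w * a - w * (a - x) by ring.
  by rewrite sinB swa mul0r sub0r.
rewrite normrN normrM -[leRHS]mul1r ler_pM//; first exact: cos_max.
by rewrite (le_trans (norm_sin_le _))// normrM (ger0_norm w0).
Qed.

(** The derivative of the cutoff factor is of order k in a layer of width of order 1 / k; the linear
    vanishing of s compensates, as w x k = w (t + 1) with t = k x - 1. *)
Let weighted k x (s : R) : 0 < x -> `|s| <= w * x ->
  `|s * (k%:R * bump 2 (k%:R * x - 1))| <=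
  w * (if 0 < k%:R * x - 1 then (k%:R * x - 1 + 1) * bump 2 (k%:R * x - 1) else 0).
Proof.
move=> x0 sx; rewrite !normrM (ger0_norm (bump_ge0 _ _)) (ger0_norm (ler0n _ _)).
case: ifPn => [_|]; last by rewrite -leNgt => H; rewrite bump_npos// !mulr0.
apply: (@le_trans _ _ (w * x * (k%:R * bump 2 (k%:R * x - 1)))).
  by rewrite ler_wpM2r// mulr_ge0// bump_ge0.
by rewrite subrK le_eqVlt; apply/orP; left; apply/eqP; ring.
Qed.

Lemma weighted_le k x (s : R) : 0 < x -> `|s| <= w * x ->
  `|s * (k%:R * bump 2 (k%:R * x - 1))| <= 4 * w.
Proof.
move=> x0 sx; apply: (le_trans (weighted k x0 sx)); rewrite mulrC ler_wpM2r//.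
by case: ifPn => // H; exact: bump2_weight_le.
Qed.

Lemma cvg_weighted x (s : R) : 0 < x -> `|s| <= w * x ->
  s * (k%:R * bump 2 (k%:R * x - 1)) @[k --> \oo] --> 0.
Proof.
move=> x0 sx; apply/norm_cvg0P.
apply: (@squeeze_cvgr _ _ _ _ (fun=> 0) (fun k : nat => w * (2 * (k%:R * x - 1)^-1))).
- near=> k; rewrite normr_ge0/=; apply: (le_trans (weighted k x0 sx)).
  have k1 : 1 < k%:R * x - 1 by near: k; exact: near_affine_gt.
  rewrite ler_wpM2l// ifT; last lra.
  exact: bump2_weight_le_inv.
- exact: cvg_cst.
- rewrite -(mulr0 w); apply: cvgM; first exact: cvg_cst.
  by rewrite -(mulr0 2); apply: cvgM; [exact: cvg_cst|exact: cvg_inv_affine].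
Unshelve. all: by end_near. Qed.

(** One w comes from the sine and 4 w from each of the two boundary layers. Independence of k is
    what dominated convergence requires. *)
Lemma derive1_cutoff_le k x : 0 < x < a -> `|derive1 (cutoff k) x| <= 9 * w.
Proof.
move=> /andP[x0 xa].
have ax0 : 0 < a - x by rewrite subr_gt0.
have s1 : `|sin (w * x)| <= w * x.
  by rewrite (le_trans (norm_sin_le _))// ger0_norm// mulr_ge0// ltW.
have s2 : `|sin (w * x)| <= w * (a - x).
  by rewrite (le_trans (norm_sin_reflect x))// gtr0_norm.
have b1 y : `|bump 0 y| <= 1 by rewrite ger0_norm ?bump_ge0 ?bump0_le1.
rewrite derive1_cutoff.
apply: (le_trans (ler_normB _ _)); have -> : 9 * w = w + 4 * w + 4 * w by ring.
apply: lerD; first apply: (le_trans (ler_normD _ _)); first apply: lerD.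
- rewrite !normrM (ger0_norm w0) -[leRHS]mulr1 ler_pM ?mulr_ge0//.
    by rewrite -[leRHS]mulr1 ler_wpM2l// cos_max.
  by rewrite mulr_ile1.
- rewrite normrM -[leRHS]mulr1 ler_pM//; exact: weighted_le.
- rewrite mulrAC normrM -[leRHS]mulr1 ler_pM//; exact: weighted_le.
Qed.

Lemma cvg_derive1_cutoff x : 0 < x < a ->
  derive1 (cutoff k) x @[k --> \oo] --> w * cos (w * x).
Proof.
move=> /andP[x0 xa].
have ax0 : 0 < a - x by rewrite subr_gt0.
have s1 : `|sin (w * x)| <= w * x.
  by rewrite (le_trans (norm_sin_le _))// ger0_norm// mulr_ge0// ltW.
have s2 : `|sin (w * x)| <= w * (a - x).
  by rewrite (le_trans (norm_sin_reflect x))// gtr0_norm.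
rewrite [X in _ --> X](_ : _ = w * cos (w * x) * (1 * 1) + 0 * 1 - 0 * 1); last by ring.
under eq_fun do rewrite derive1_cutoff.
apply: cvgB; first apply: cvgD.
- by apply: cvgM; [exact: cvg_cst|apply: cvgM; exact: cvg_bump0].
- by apply: cvgM; [exact: cvg_weighted|exact: cvg_bump0].
- under eq_fun do rewrite mulrAC.
  by apply: cvgM; [exact: cvg_weighted|exact: cvg_bump0].
Qed.

End cutoff.

End calculus.

(** * Real square-integrable functions *)

Section L2_real.
Context d (T : measurableType d) (R : realType) (m : {measure set T -> \bar R}).
Variable D : set T.
Hypotheses (mD : measurable D) (Doo : (m D < +oo)%E).
Implicit Types f g h : T -> R.

Lemma integrableRZ (c : R) f : m.-integrable D (EFin \o f) ->
  m.-integrable D (EFin \o (fun x => c * f x)).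
Proof. exact: integrableZl. Qed.

Lemma integrableRD f g : m.-integrable D (EFin \o f) -> m.-integrable D (EFin \o g) ->
  m.-integrable D (EFin \o (fun x => f x + g x)).
Proof. exact: integrableD. Qed.

Lemma integrableRB f g : m.-integrable D (EFin \o f) -> m.-integrable D (EFin \o g) ->
  m.-integrable D (EFin \o (fun x => f x - g x)).
Proof. exact: integrableB. Qed.

Lemma integrableR_cst (c : R) : m.-integrable D (EFin \o (fun=> c)).
Proof. exact: (@bounded_integrable _ _ _ m D (cst c) `|c|). Qed.

Definition L2r f := measurable_fun D f /\ (\int[m]_(x in D) (f x ^+ 2)%:E < +oo)%E.

Lemma L2r_integrable_sqr f : L2r f -> m.-integrable D (EFin \o (fun x => f x ^+ 2)).
Proof.
move=> [mf foo]; apply/integrableP; split.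
  by apply/measurable_EFinP; exact: measurable_funX.
by under eq_integral do rewrite /= ger0_norm ?sqr_ge0//.
Qed.

Lemma L2rM_integrable f g : L2r f -> L2r g -> m.-integrable D (EFin \o (f \* g)).
Proof.
move=> f2 g2; have [mf _] := f2; have [mg _] := g2.
have := integrableD mD (L2r_integrable_sqr f2) (L2r_integrable_sqr g2).
apply: le_integrable => //.
  by apply/measurable_EFinP; exact: measurable_funM.
move=> x Dx; rewrite /= lee_fin.
rewrite [leRHS]ger0_norm ?addr_ge0 ?sqr_ge0// ler_norml; apply/andP; split; nra.
Qed.

Lemma bounded_L2r f (M : R) : measurable_fun D f -> (forall x, D x -> `|f x| <= M) -> L2r f.
Proof.
move=> mf fM; split => //.
have : m.-integrable D (EFin \o (fun x => f x ^+ 2)).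
  apply: (@bounded_integrable _ _ _ m D (fun x => f x ^+ 2) (M ^+ 2)) => //.
    exact: measurable_funX.
  by move=> x Dx; rewrite normrX lerXn2r ?nnegrE//; [exact: le_trans (fM _ Dx)|exact: fM].
move=> /integrableP[_]; under eq_integral do rewrite /= ger0_norm ?sqr_ge0//.
by [].
Qed.

Lemma L2rD f g : L2r f -> L2r g -> L2r (f \+ g).
Proof.
move=> f2 g2; have [mf _] := f2; have [mg _] := g2; split; first exact: measurable_funD.
have i := integrableD mD (integrableD mD (L2r_integrable_sqr f2) (L2r_integrable_sqr g2))
  (integrableD mD (L2r_integrable_sqr f2) (L2r_integrable_sqr g2)).
have : m.-integrable D (EFin \o (fun x => (f x + g x) ^+ 2)).
  apply: le_integrable i => //.
    by apply/measurable_EFinP; apply: measurable_funX; exact: measurable_funD.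
  move=> x Dx; rewrite /= lee_fin ger0_norm ?sqr_ge0// ger0_norm.
    by have := sqr_ge0 (f x - g x); nra.
  by rewrite !addr_ge0 ?sqr_ge0.
move=> /integrableP[_]; under eq_integral do rewrite /= ger0_norm ?sqr_ge0//.
by [].
Qed.

Lemma L2rZ (c : R) f : L2r f -> L2r (fun x => c * f x).
Proof.
move=> f2; have [mf _] := f2; split; first exact: measurable_funM.
have /integrableP[_] := integrableRZ (c ^+ 2) (L2r_integrable_sqr f2).
rewrite (_ : (fun x => `|_|%E) = (fun x => ((c * f x) ^+ 2)%:E))//.
apply/funext => x /=; congr _%:E.
by rewrite -exprMn ger0_norm ?sqr_ge0.
Qed.

Lemma L2r_sumP f g : measurable_fun D f -> measurable_fun D g ->
  (\int[m]_(x in D) (f x ^+ 2 + g x ^+ 2)%:E < +oo)%E <-> L2r f /\ L2r g.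
Proof.
move=> mf mg; have mf2 := measurable_funX 2 mf; have mg2 := measurable_funX 2 mg.
have ef : measurable_fun D (fun x => (f x ^+ 2)%:E) by exact/measurable_EFinP.
have eg : measurable_fun D (fun x => (g x ^+ 2)%:E) by exact/measurable_EFinP.
have -> : (\int[m]_(x in D) (f x ^+ 2 + g x ^+ 2)%:E =
  \int[m]_(x in D) (f x ^+ 2)%:E + \int[m]_(x in D) (g x ^+ 2)%:E)%E.
  by under eq_integral do rewrite EFinD; rewrite ge0_integralD// => x _; rewrite lee_fin sqr_ge0.
have If : (0 <= \int[m]_(x in D) (f x ^+ 2)%:E)%E.
  by apply: integral_ge0 => x _; rewrite lee_fin sqr_ge0.
have Ig : (0 <= \int[m]_(x in D) (g x ^+ 2)%:E)%E.
  by apply: integral_ge0 => x _; rewrite lee_fin sqr_ge0.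
split=> [foo|[[_ ?] [_ ?]]]; last exact: lte_add_pinfty.
split; split => //; apply: le_lt_trans foo; first by rewrite leeDl.
by rewrite leeDr.
Qed.

Lemma L2r_sum_integrable f g : L2r f -> L2r g ->
  m.-integrable D (EFin \o (fun x => f x ^+ 2 + g x ^+ 2)).
Proof. by move=> f2 g2; apply: integrableRD; exact: L2r_integrable_sqr. Qed.

Lemma Rintegral_sqr_lel f g : L2r f -> L2r g ->
  \int[m]_(x in D) (f x ^+ 2) <= \int[m]_(x in D) (f x ^+ 2 + g x ^+ 2).
Proof.
move=> f2 g2; apply: le_Rintegral => //.
- exact: L2r_integrable_sqr.
- exact: L2r_sum_integrable.
- by move=> x _; rewrite lerDl sqr_ge0.
Qed.

Lemma Rintegral_sqr_ler f g : L2r f -> L2r g ->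
  \int[m]_(x in D) (g x ^+ 2) <= \int[m]_(x in D) (f x ^+ 2 + g x ^+ 2).
Proof.
move=> f2 g2; apply: le_Rintegral => //.
- exact: L2r_integrable_sqr.
- exact: L2r_sum_integrable.
- by move=> x _; rewrite lerDr sqr_ge0.
Qed.

Lemma L2rN f : L2r f -> L2r (\- f).
Proof. by move=> /(L2rZ (-1)); under eq_fun do rewrite mulN1r. Qed.

Lemma L2rB f g : L2r f -> L2r g -> L2r (f \- g).
Proof. by move=> f2 g2; apply: L2rD => //; exact: L2rN. Qed.

Lemma L2r_integrable f : L2r f -> m.-integrable D (EFin \o f).
Proof.
move=> f2; have c2 : L2r (cst 1).
  by apply: (@bounded_L2r _ 1) => // x _; rewrite normr1.
have := L2rM_integrable f2 c2.
by rewrite (_ : f \* cst 1 = f)//; apply/funext => x /=; rewrite mulr1.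
Qed.

(* 2|f| <= f^2/e + e *)
Lemma L2r_small f (M e : R) h : L2r f -> 0 < e -> 0 <= M ->
  measurable_fun D h -> (forall x, D x -> `|h x| <= M) ->
  \int[m]_(x in D) f x ^+ 2 < e ^+ 2 ->
  `|\int[m]_(x in D) (f x * h x)| <= M * e * (1 + fine (m D)).
Proof.
move=> f2 e0 M0 mh hM fe; have [mf _] := f2.
have h2 : L2r h by exact: bounded_L2r hM.
have ifh := L2rM_integrable f2 h2.
have if2 := L2r_integrable_sqr f2.
have iMf : m.-integrable D (EFin \o (fun x => M / e * f x ^+ 2)) by exact: integrableRZ.
have ic := integrableR_cst (M * e).
apply: (le_trans (le_normr_Rintegral mD ifh)).
apply: (@le_trans _ _ (\int[m]_(x in D) (M / e * f x ^+ 2 + M * e))).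
  apply: le_Rintegral => //.
  - exact: (integrable_norm ifh).
  - exact: integrableRD.
  move=> x Dx; rewrite normrM.
  have Mx := hM _ Dx.
  apply: (@le_trans _ _ (`|f x| * M)); first by rewrite ler_wpM2l.
  have -> : M / e * f x ^+ 2 + M * e = (f x ^+ 2 / e + e) * M by ring.
  rewrite ler_wpM2r// -(ler_pM2r e0) mulrDl divfK ?gt_eqF//.
  rewrite -[f x ^+ 2]real_normK ?num_real//.
  have := sqr_ge0 (`|f x| - e); have := normr_ge0 (f x); nra.
rewrite RintegralD// RintegralZl// Rintegral_cst//.
have -> : M * e * (1 + fine (m D)) = M / e * e ^+ 2 + M * e * fine (m D).
  by rewrite expr2; field; rewrite gt_eqF.
rewrite lerD2r; apply: ler_wpM2l; last exact: ltW.
by rewrite divr_ge0// ltW.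
Qed.

Lemma cvg_integrable_dominated f (h_ : nat -> T -> R) h (M : R) :
  m.-integrable D (EFin \o f) ->
  (forall k, measurable_fun D (h_ k)) -> (forall k x, D x -> `|h_ k x| <= M) ->
  (forall x, D x -> h_ k x @[k --> \oo] --> h x) ->
  \int[m]_(x in D) (f x * h_ k x) @[k --> \oo] --> \int[m]_(x in D) (f x * h x).
Proof.
move=> if1 mh hM ch.
have mf : measurable_fun D f by apply/measurable_EFinP; exact: measurable_int if1.
have mhl : measurable_fun D h by apply: (measurable_fun_cvg mh).
have ig : m.-integrable D (fun x => (M%:E * (`|f x|)%:E)%E).
  exact: integrableZl (integrable_norm if1).
have [] := @dominated_convergence _ _ _ m D mD
  (fun k x => (f x * h_ k x)%:E) (fun x => (f x * h x)%:E) (fun x => (M%:E * (`|f x|)%:E)%E).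
- by move=> k; apply/measurable_EFinP; exact: measurable_funM.
- by apply/measurable_EFinP; exact: measurable_funM.
- apply: aeW => x Dx; apply: cvg_EFin; first by apply: nearW.
  by apply: cvgM; [exact: cvg_cst|exact: ch].
- exact: ig.
- apply: aeW => x k Dx; rewrite lee_fin normrM mulrC ler_wpM2r//; exact: hM.
move=> ifh _ H.
apply: fine_cvg; rewrite fineK//; exact: integrable_fin_num.
Qed.

Lemma cvg_L2r_dominated f (h_ : nat -> T -> R) h (M : R) : L2r f ->
  (forall k, measurable_fun D (h_ k)) -> (forall k x, D x -> `|h_ k x| <= M) ->
  (forall x, D x -> h_ k x @[k --> \oo] --> h x) ->
  \int[m]_(x in D) (f x * h_ k x) @[k --> \oo] --> \int[m]_(x in D) (f x * h x).
Proof. by move=> f2; apply: cvg_integrable_dominated; exact: L2r_integrable. Qed.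

End L2_real.

(** * Integration by parts on the rectangle *)

Section rectangle_calculus.
Context {R : realType}.
Local Notation mu := (@lebesgue_measure R).
Local Notation R2 := (measurableTypeR R * measurableTypeR R)%type.
Implicit Types (F G : R * R -> R).

Lemma continuous_bounded_box F (a0 a1 b0 b1 : R) : continuous F ->
  exists M, forall z, (`[a0, a1] `*` `[b0, b1]) z -> `|F z| <= M.
Proof.
move=> cF.
have cK : compact (`[a0, a1]%classic `*` `[b0, b1]%classic : set (R * R)).
  by apply: compact_setX; exact: segment_compact.
have : compact (F @` (`[a0, a1]%classic `*` `[b0, b1]%classic)).
  by apply: continuous_compact => //; exact: continuous_subspaceT.
move=> /compact_bounded[M [_ MP]]; exists (M + 1) => z Kz.
by apply: (MP (M + 1)); [rewrite ltrDl|exists z].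
Qed.

Lemma Rintegral_FTC (f F : R -> R) (a b : R) : a < b -> continuous f ->
  (forall x, is_derive x (1 : R) F (f x)) ->
  \int[mu]_(x in `]a, b[) f x = F b - F a.
Proof.
move=> ab cf dF.
have cF : continuous F by apply: derivable_continuous => x; case: (dF x).
have mf : measurable_fun setT f by exact: continuous_measurable_fun.
rewrite /Rintegral.
rewrite integral_itv_bndo_bndc; last exact/measurable_EFinP/measurable_funTS.
rewrite integral_itv_obnd_cbnd; last exact/measurable_EFinP/measurable_funTS.
rewrite (@continuous_FTC2 R f F)//.
- exact: continuous_subspaceT.
- split.
  + by move=> x _; case: (dF x).
  + by apply: cvg_at_right_filter; exact: cF.
  + by apply: cvg_at_left_filter; exact: cF.
- by move=> x _; rewrite derive1E; have [_ ->] := dF x.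
Qed.

Variables (a b : R).
Hypotheses (a0 : 0 < a) (b0 : 0 < b).
Local Notation Q := (rectangle a b).

Lemma rectangleE : Q = `]0, a[%classic `*` `]0, b[%classic.
Proof.
by apply/seteqP; split=> -[x y] [/= ? ?]; split => //=; rewrite in_itv.
Qed.

Lemma measurable_rectangle : measurable (Q : set R2).
Proof. by rewrite rectangleE; apply: measurableX; exact: measurable_itv. Qed.

Lemma plane_measurable_rectangle : measurable (Q : set (plane R)).
Proof. by apply: borel_plane_measurable; exact: measurable_rectangle. Qed.

Lemma leb_itv0 (c : R) : 0 < c -> mu `]0, c[%classic = c%:E.
Proof. by move=> c0; rewrite lebesgue_measure_itv/= lte_fin c0 EFinN oppe0 adde0. Qed.

Lemma leb2_rectangle : leb2 R (Q : set (plane R)) = (a * b)%:E.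
Proof.
rewrite leb2_borelE; last exact: measurable_rectangle.
by rewrite rectangleE borel_leb2_box// !leb_itv0.
Qed.

Lemma leb2_rectangle_lty : (leb2 R (Q : set (plane R)) < +oo)%E.
Proof. by rewrite leb2_rectangle ltry. Qed.

Lemma continuous_bounded_rectangle F : continuous F ->
  exists M, 0 <= M /\ forall z, Q z -> `|F z| <= M.
Proof.
move=> /(continuous_bounded_box 0 a 0 b)[M MP]; exists `|M|; split => // z.
case: z => x y [/= /andP[x0 xa] /andP[y0 yb]].
by apply: le_trans (ler_norm _); apply: MP; split; rewrite /= in_itv/= !ltW.
Qed.

Lemma Rintegral_rectangle1 F : continuous F ->
  \int[leb2 R]_(z in (Q : set (plane R))) F z =
  \int[mu]_(x in `]0, a[) \int[mu]_(y in `]0, b[) F (x, y).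
Proof.
move=> cF; have [M [_ FM]] := continuous_bounded_rectangle cF.
rewrite rectangleE (@Rintegral_fubini1 R _ _ F M)//.
- by rewrite leb_itv0 // ltry.
- by rewrite leb_itv0 // ltry.
- exact: continuous_measurable2.
Qed.

Lemma Rintegral_rectangle2 F : continuous F ->
  \int[leb2 R]_(z in (Q : set (plane R))) F z =
  \int[mu]_(y in `]0, b[) \int[mu]_(x in `]0, a[) F (x, y).
Proof.
move=> cF; have [M [_ FM]] := continuous_bounded_rectangle cF.
rewrite rectangleE (@Rintegral_fubini2 R _ _ F M)//.
- by rewrite leb_itv0 // ltry.
- by rewrite leb_itv0 // ltry.
- exact: continuous_measurable2.
Qed.

(** By Fubini the inner integral is a difference of two boundary values, and F vanishes on the
    boundary because K lies in the open rectangle. *)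
Lemma Rintegral_pd1_eq0 F dF (K : set (R * R)) : continuous dF ->
  (forall z, is_derive z ((1, 0) : R * R) F (dF z)) ->
  K `<=` Q -> (forall z, ~ K z -> F z = 0) ->
  \int[leb2 R]_(z in (Q : set (plane R))) dF z = 0.
Proof.
move=> cdF dFP KQ F0; rewrite Rintegral_rectangle2//.
rewrite (@eq_Rintegral _ _ _ mu _ (cst 0)) ?Rintegral_cst ?mul0r// => y _.
have cy : continuous (fun x => dF (x, y)).
  move=> x; apply: (@continuous_comp _ _ _ (fun x => (x, y)) dF); last exact: cdF.
  exact: (cvg_pair cvg_id (cvg_cst y)).
have dy x : is_derive x (1 : R) (fun x => F (x, y)) (dF (x, y)).
  exact/(is_derive_dir1 F (x, y)).
rewrite (Rintegral_FTC a0 cy dy).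
by rewrite !F0 ?subr0// => /KQ[/= /andP[]]; rewrite ltxx.
Qed.

Lemma Rintegral_pd2_eq0 F dF (K : set (R * R)) : continuous dF ->
  (forall z, is_derive z ((0, 1) : R * R) F (dF z)) ->
  K `<=` Q -> (forall z, ~ K z -> F z = 0) ->
  \int[leb2 R]_(z in (Q : set (plane R))) dF z = 0.
Proof.
move=> cdF dFP KQ F0; rewrite Rintegral_rectangle1//.
rewrite (@eq_Rintegral _ _ _ mu _ (cst 0)) ?Rintegral_cst ?mul0r// => x _.
have cx : continuous (fun y => dF (x, y)).
  move=> y; apply: (@continuous_comp _ _ _ (fun y => (x, y)) dF); last exact: cdF.
  exact: (cvg_pair (cvg_cst x) cvg_id).
have dx y : is_derive y (1 : R) (fun y => F (x, y)) (dF (x, y)).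
  exact/(is_derive_dir2 F (x, y)).
rewrite (Rintegral_FTC b0 cx dx).
by rewrite !F0 ?subr0// => /KQ[/= _ /andP[]]; rewrite ltxx.
Qed.

Lemma is_derive2M F G (z v : R * R) (dF dG : R) : is_derive z v F dF ->
  is_derive z v G dG -> is_derive z v (fun z => F z * G z) (dF * G z + F z * dG).
Proof.
move=> f' g'; have := is_deriveM f' g'.
by rewrite /GRing.scale /= addrC [G z * dF]mulrC.
Qed.

Lemma continuous2_integrable F : continuous F ->
  (leb2 R).-integrable (Q : set (plane R)) (EFin \o F).
Proof.
move=> cF; have [M [_ FM]] := continuous_bounded_rectangle cF.
apply: (bounded_integrable (M := M)) => //.
- exact: plane_measurable_rectangle.
- exact: leb2_rectangle_lty.
apply: borel_plane_measurable_fun; first exact: measurable_rectangle.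
exact: (@measurable_funTS _ _ R2 _ Q F (continuous_measurable2 cF)).
Qed.

Lemma continuous2M F G : continuous F -> continuous G -> continuous (fun z => F z * G z).
Proof. by move=> cF cG z; apply: cvgM; [exact: cF|exact: cG]. Qed.

Lemma Rintegral_by_parts1 F G dF dG (K : set (R * R)) :
  continuous F -> continuous G -> continuous dF -> continuous dG ->
  (forall z, is_derive z ((1, 0) : R * R) F (dF z)) ->
  (forall z, is_derive z ((1, 0) : R * R) G (dG z)) ->
  K `<=` Q -> (forall z, ~ K z -> F z = 0) ->
  \int[leb2 R]_(z in (Q : set (plane R))) (dF z * G z) =
  - \int[leb2 R]_(z in (Q : set (plane R))) (F z * dG z).
Proof.
move=> cF cG cdF cdG dFP dGP KQ F0; apply/eqP; rewrite -addr_eq0; apply/eqP.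
rewrite -RintegralD/=; last 3 first.
- exact: plane_measurable_rectangle.
- exact/continuous2_integrable/continuous2M.
- exact/continuous2_integrable/continuous2M.
apply: (@Rintegral_pd1_eq0 (fun z => F z * G z) (fun z => dF z * G z + F z * dG z) K) => //.
- by move=> z; apply: cvgD; exact: continuous2M.
- by move=> z; exact: is_derive2M.
- by move=> z /F0 ->; rewrite mul0r.
Qed.

Lemma Rintegral_by_parts2 F G dF dG (K : set (R * R)) :
  continuous F -> continuous G -> continuous dF -> continuous dG ->
  (forall z, is_derive z ((0, 1) : R * R) F (dF z)) ->
  (forall z, is_derive z ((0, 1) : R * R) G (dG z)) ->
  K `<=` Q -> (forall z, ~ K z -> F z = 0) ->
  \int[leb2 R]_(z in (Q : set (plane R))) (dF z * G z) =
  - \int[leb2 R]_(z in (Q : set (plane R))) (F z * dG z).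
Proof.
move=> cF cG cdF cdG dFP dGP KQ F0; apply/eqP; rewrite -addr_eq0; apply/eqP.
rewrite -RintegralD/=; last 3 first.
- exact: plane_measurable_rectangle.
- exact/continuous2_integrable/continuous2M.
- exact/continuous2_integrable/continuous2M.
apply: (@Rintegral_pd2_eq0 (fun z => F z * G z) (fun z => dF z * G z + F z * dG z) K) => //.
- by move=> z; apply: cvgD; exact: continuous2M.
- by move=> z; exact: is_derive2M.
- by move=> z /F0 ->; rewrite mul0r.
Qed.

End rectangle_calculus.

(** * Weak Dirichlet eigenfunctions tested against sine modes *)

Lemma lt_sum3 {R : realType} (x y z t : R) : 0 <= x -> 0 <= y -> 0 <= z ->
  x + y + z < t -> [/\ x < t, y < t & z < t].
Proof. by move=> *; split; lra. Qed.

Section dirichlet.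
Local Open Scope complex_scope.
Context {R : realType}.
Local Notation R2 := (measurableTypeR R * measurableTypeR R)%type.
Implicit Types (F G psi : R * R -> R) (u v phi : R * R -> R[i]) (z : R * R).

Lemma smooth_continuous F : smooth F -> continuous F.
Proof. exact: (fun sF => sF 0%N). Qed.

Lemma smooth_is_derive1 F z : smooth F -> is_derive z ((1, 0) : R * R) F (pd1 F z).
Proof. by move=> /(_ 1%N)[dF _ _ _]; exact/derivableP. Qed.

Lemma smooth_is_derive2 F z : smooth F -> is_derive z ((0, 1) : R * R) F (pd2 F z).
Proof. by move=> /(_ 1%N)[_ dF _ _]; exact/derivableP. Qed.

Lemma smooth_pd1 F : smooth F -> smooth (pd1 F).
Proof. by move=> sF n; have [] := sF n.+1. Qed.

Lemma smooth_pd2 F : smooth F -> smooth (pd2 F).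
Proof. by move=> sF n; have [] := sF n.+1. Qed.

Lemma smooth0 : smooth (fun _ : R * R => 0 : R).
Proof.
move=> n; elim: n => [|n IH] /=; first exact: cst_continuous.
split; [by move=> z; exact: derivable_cst|by move=> z; exact: derivable_cst| |].
- by rewrite (_ : pd1 _ = fun=> 0)//; apply/funext => z; rewrite /pd1 derive_cst.
- by rewrite (_ : pd2 _ = fun=> 0)//; apply/funext => z; rewrite /pd2 derive_cst.
Qed.

Definition real_fun F : R * R -> R[i] := fun z => F z +i* 0.

Lemma cpd1_real F z : cpd1 (real_fun F) z = pd1 F z +i* 0.
Proof. by rewrite /cpd1 /=; congr (_ +i* _); rewrite /pd1 derive_cst. Qed.

Lemma cpd2_real F z : cpd2 (real_fun F) z = pd2 F z +i* 0.
Proof. by rewrite /cpd2 /=; congr (_ +i* _); rewrite /pd2 derive_cst. Qed.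

Variables (a b : R).
Hypotheses (a0 : 0 < a) (b0 : 0 < b).
Local Notation Q := (rectangle a b).
Local Notation QL := (Q : set (plane R)).
Local Notation L2 := (L2r (leb2 R) QL).
Local Notation "'I[' F ]" := (Rintegral (leb2 R) QL F) (at level 0, format "'I[' F ]").

Let mQ : measurable QL := plane_measurable_rectangle a b.
Let Qoo := leb2_rectangle_lty a0 b0.

Lemma continuous_measurableQ F : continuous F -> measurable_fun QL F.
Proof.
move=> cF; apply: borel_plane_measurable_fun; first exact: measurable_rectangle.
exact: (@measurable_funTS _ _ R2 _ Q F (continuous_measurable2 cF)).
Qed.

Lemma continuous_L2 F : continuous F -> L2 F.
Proof.
move=> cF; have [M [_ FM]] := continuous_bounded_rectangle a b cF.
apply: (bounded_L2r mQ Qoo _ FM); exact: continuous_measurableQ.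
Qed.

Lemma cabs2_ge0 (x : R[i]) : 0 <= cabs2 x.
Proof. by rewrite /cabs2 addr_ge0// sqr_ge0. Qed.

Lemma inL2P u : inL2 Q u <-> L2 (fun z => complex.Re (u z)) /\ L2 (fun z => complex.Im (u z)).
Proof.
split=> [[mr mi uoo]|[ur ui]]; last first.
  have [mr _] := ur; have [mi _] := ui.
  by split; [exact: mr|exact: mi|exact: ((L2r_sumP (leb2 R) mQ mr mi).2 (conj ur ui))].
exact: ((L2r_sumP (leb2 R) mQ mr mi).1 uoo).
Qed.

Lemma sqr_l2norm u : l2norm Q u ^+ 2 = I[fun z => cabs2 (u z)].
Proof. by rewrite sqr_sqrtr// Rintegral_ge0// => z _; exact: cabs2_ge0. Qed.

Lemma Rintegral_Re_le u : inL2 Q u -> I[fun z => complex.Re (u z) ^+ 2] <= l2norm Q u ^+ 2.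
Proof.
by move=> /inL2P[ur ui]; rewrite sqr_l2norm; exact: (Rintegral_sqr_lel mQ ur ui).
Qed.

Lemma Rintegral_Im_le u : inL2 Q u -> I[fun z => complex.Im (u z) ^+ 2] <= l2norm Q u ^+ 2.
Proof.
by move=> /inL2P[ur ui]; rewrite sqr_l2norm; exact: (Rintegral_sqr_ler mQ ur ui).
Qed.

Lemma l2norm0 : l2norm Q (fun=> 0) = 0.
Proof.
rewrite /l2norm (eq_Rintegral _ (g := cst 0)) ?Rintegral_cst ?mul0r ?sqrtr0//.
by move=> z _; rewrite /cabs2 /= expr0n/= addr0.
Qed.

Local Opaque l2norm inL2 Rintegral leb2 cabs2.

(** Real test functions separate the weak equation into its real and imaginary parts. *)
Definition rtest psi := smooth psi /\
  exists K : set (R * R), [/\ compact K, K `<=` Q & forall z, ~ K z -> psi z = 0].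

Lemma real_test psi : rtest psi -> test_function Q (real_fun psi).
Proof.
move=> [spsi [K [cK KQ K0]]]; split => //; first exact: smooth0.
by exists K; split => // z /K0; rewrite /real_fun => ->.
Qed.

Lemma test_Re phi : test_function Q phi -> rtest (fun z => complex.Re (phi z)).
Proof.
move=> [sr si [K [cK KQ K0]]]; split => //.
by exists K; split => // z /K0 ->.
Qed.

Lemma test_Im phi : test_function Q phi -> rtest (fun z => complex.Im (phi z)).
Proof.
move=> [sr si [K [cK KQ K0]]]; split => //.
by exists K; split => // z /K0 ->.
Qed.

Lemma rtest_parts1 psi F dF : rtest psi -> continuous F -> continuous dF ->
  (forall z, is_derive z ((1, 0) : R * R) F (dF z)) ->
  I[fun z => pd1 psi z * F z] = - I[fun z => psi z * dF z].
Proof.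
move=> [spsi [K [_ KQ K0]]] cF cdF dFP.
apply: (Rintegral_by_parts1 a0 b0 _ cF _ cdF _ dFP KQ) => //.
- exact: smooth_continuous.
- exact/smooth_continuous/smooth_pd1.
- by move=> z; exact: smooth_is_derive1.
Qed.

Lemma rtest_parts2 psi F dF : rtest psi -> continuous F -> continuous dF ->
  (forall z, is_derive z ((0, 1) : R * R) F (dF z)) ->
  I[fun z => pd2 psi z * F z] = - I[fun z => psi z * dF z].
Proof.
move=> [spsi [K [_ KQ K0]]] cF cdF dFP.
apply: (Rintegral_by_parts2 a0 b0 _ cF _ cdF _ dFP KQ) => //.
- exact: smooth_continuous.
- exact/smooth_continuous/smooth_pd2.
- by move=> z; exact: smooth_is_derive2.
Qed.

Lemma l2inner_real_r u psi :
  l2inner Q u (fun z => psi z +i* 0) =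
  I[fun z => complex.Re (u z) * psi z] +i* I[fun z => complex.Im (u z) * psi z].
Proof.
rewrite /l2inner /cintegral; congr (_ +i* _); apply: eq_Rintegral => z _.
  by case: (u z) => r s /=; rewrite oppr0 mulr0 subr0.
by case: (u z) => r s /=; rewrite oppr0 mulr0 add0r.
Qed.

Lemma H10_rtest psi : rtest psi ->
  H10 Q (real_fun psi) (cpd1 (real_fun psi)) (cpd2 (real_fun psi)).
Proof.
move=> tpsi; have [spsi _] := tpsi.
have L2real F : continuous F -> inL2 Q (fun z => F z +i* 0).
  move=> cF; apply/inL2P; split => /=; first exact: continuous_L2.
  by apply: continuous_L2; exact: cst_continuous.
split.
- by apply: L2real; exact: smooth_continuous.
- rewrite (funext (cpd1_real psi)); exact/L2real/smooth_continuous/smooth_pd1.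
- rewrite (funext (cpd2_real psi)); exact/L2real/smooth_continuous/smooth_pd2.
- move=> phi tphi; have tr := test_Re tphi; have ti := test_Im tphi.
  have cpsi := smooth_continuous spsi.
  have cp1 := smooth_continuous (smooth_pd1 spsi).
  have cp2 := smooth_continuous (smooth_pd2 spsi).
  have d1 z := smooth_is_derive1 z spsi; have d2 z := smooth_is_derive2 z spsi.
  have E (X Y : R[i]) : complex.Re X = - complex.Re Y -> complex.Im X = - complex.Im Y -> X = - Y.
    by case: X => ? ?; case: Y => ? ? /= -> ->.
  split; apply: E; rewrite /cintegral /=.
  + transitivity (I[fun z => pd1 (fun w => complex.Re (phi w)) z * psi z]).
      by apply: eq_Rintegral => z _; rewrite mul0r subr0 mulrC.
    rewrite (rtest_parts1 tr cpsi cp1 d1); congr (- _); apply: eq_Rintegral => z _.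
    by rewrite cpd1_real; case: (phi z) => r s /=; rewrite mul0r subr0 mulrC.
  + transitivity (I[fun z => pd1 (fun w => complex.Im (phi w)) z * psi z]).
      by apply: eq_Rintegral => z _; rewrite mul0r addr0 mulrC.
    rewrite (rtest_parts1 ti cpsi cp1 d1); congr (- _); apply: eq_Rintegral => z _.
    by rewrite cpd1_real; case: (phi z) => r s /=; rewrite mul0r addr0 mulrC.
  + transitivity (I[fun z => pd2 (fun w => complex.Re (phi w)) z * psi z]).
      by apply: eq_Rintegral => z _; rewrite mul0r subr0 mulrC.
    rewrite (rtest_parts2 tr cpsi cp2 d2); congr (- _); apply: eq_Rintegral => z _.
    by rewrite cpd2_real; case: (phi z) => r s /=; rewrite mul0r subr0 mulrC.
  + transitivity (I[fun z => pd2 (fun w => complex.Im (phi w)) z * psi z]).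
      by apply: eq_Rintegral => z _; rewrite mul0r addr0 mulrC.
    rewrite (rtest_parts2 ti cpsi cp2 d2); congr (- _); apply: eq_Rintegral => z _.
    by rewrite cpd2_real; case: (phi z) => r s /=; rewrite mul0r addr0 mulrC.
- move=> e e0; exists (real_fun psi); first exact: real_test.
  have E (G : R * R -> R[i]) : (fun z => G z - G z) = (fun=> 0).
    by apply/funext => z; rewrite subrr.
  by rewrite !E l2norm0 expr0n/= !addr0 exprn_gt0.
Qed.

Lemma RintegralBQ F G : (leb2 R).-integrable QL (EFin \o F) ->
  (leb2 R).-integrable QL (EFin \o G) -> I[fun z => F z - G z] = I[F] - I[G].
Proof. by move=> iF iG; rewrite -(RintegralB mQ iF iG). Qed.

Lemma RintegralDQ F G : (leb2 R).-integrable QL (EFin \o F) ->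
  (leb2 R).-integrable QL (EFin \o G) -> I[fun z => F z + G z] = I[F] + I[G].
Proof. by move=> iF iG; rewrite -(RintegralD mQ iF iG). Qed.

Lemma RintegralZQ (c : R) F : (leb2 R).-integrable QL (EFin \o F) ->
  I[fun z => c * F z] = c * I[F].
Proof. by move=> iF; rewrite -(RintegralZl _ mQ iF). Qed.

Lemma integrableRZQ (c : R) F : (leb2 R).-integrable QL (EFin \o F) ->
  (leb2 R).-integrable QL (EFin \o (fun z => c * F z)).
Proof. exact: (integrableRZ mQ). Qed.

(** There are no boundary terms although w may be nonzero on the boundary: the pair (F, g) is a
    limit in L2 of test functions and their derivatives, for which the identity is clear, and both
    sides are continuous in L2. [dir] selects the variable. *)
Lemma approx_parts (dir : bool) F g w dw : L2 F -> L2 g -> continuous w -> continuous dw ->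
  (forall z, is_derive z (if dir then (1, 0) else (0, 1) : R * R) w (dw z)) ->
  (forall e, 0 < e -> exists2 psi, rtest psi &
     I[fun z => (F z - psi z) ^+ 2] < e ^+ 2 /\
     I[fun z => (g z - (if dir then pd1 psi else pd2 psi) z) ^+ 2] < e ^+ 2) ->
  I[fun z => g z * w z] = - I[fun z => F z * dw z].
Proof.
move=> F2 g2 cw cdw dwP approx.
have [M1 [M10 wM]] := continuous_bounded_rectangle a b cw.
have [M2 [M20 dwM]] := continuous_bounded_rectangle a b cdw.
have w2 := continuous_L2 cw; have dw2 := continuous_L2 cdw.
apply/eqP; rewrite -addr_eq0 -normr_le0.
apply/ler_addgt0Pr => e e0; rewrite add0r.
(* With accuracy e / C the two error terms add up to e / C * (C - 1) <= e; the summand 1 keeps C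
   positive. *)
pose C := (M1 + M2) * (1 + fine (leb2 R QL)) + 1.
have C0 : 0 < C.
  by rewrite ltr_pwDr// mulr_ge0 ?addr_ge0// fine_ge0.
have [psi tpsi [Fpsi gpsi]] := approx (e / C) (divr_gt0 e0 C0).
have [spsi _] := tpsi.
pose dpsi := if dir then pd1 psi else pd2 psi.
have cpsi := smooth_continuous spsi.
have cdpsi : continuous dpsi.
  by rewrite /dpsi; case: (dir); apply: smooth_continuous; [exact: smooth_pd1|exact: smooth_pd2].
have psi2 := continuous_L2 cpsi; have dpsi2 := continuous_L2 cdpsi.
have parts : I[fun z => dpsi z * w z] = - I[fun z => psi z * dw z].
  by move: dwP; rewrite /dpsi; case: (dir) => dwP; [exact: rtest_parts1|exact: rtest_parts2].
have E : I[fun z => g z * w z] + I[fun z => F z * dw z] =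
    I[fun z => (g z - dpsi z) * w z] + I[fun z => (F z - psi z) * dw z].
  have iM X Y : L2 X -> L2 Y -> (leb2 R).-integrable QL (EFin \o (fun z => X z * Y z)).
    by move=> X2 Y2; exact: (L2rM_integrable mQ X2 Y2).
  have -> : I[fun z => (g z - dpsi z) * w z] = I[fun z => g z * w z] - I[fun z => dpsi z * w z].
    rewrite -(RintegralBQ (iM _ _ g2 w2) (iM _ _ dpsi2 w2)).
    by apply: eq_Rintegral => z _; rewrite mulrBl.
  have -> : I[fun z => (F z - psi z) * dw z] = I[fun z => F z * dw z] - I[fun z => psi z * dw z].
    rewrite -(RintegralBQ (iM _ _ F2 dw2) (iM _ _ psi2 dw2)).
    by apply: eq_Rintegral => z _; rewrite mulrBl.
  by rewrite parts; ring.
rewrite E; apply: (le_trans (ler_normD _ _)).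
have eC := divr_gt0 e0 C0.
have B1 := L2r_small mQ Qoo (L2rB mQ g2 dpsi2) eC M10 (continuous_measurableQ cw) wM gpsi.
have B2 := L2r_small mQ Qoo (L2rB mQ F2 psi2) eC M20 (continuous_measurableQ cdw) dwM Fpsi.
apply: (le_trans (lerD B1 B2)).
have -> : M1 * (e / C) * (1 + fine (leb2 R QL)) + M2 * (e / C) * (1 + fine (leb2 R QL)) =
   e / C * (C - 1) by rewrite /C; ring.
by rewrite mulrBr mulr1 divfK ?gt_eqF// gerBl ltW.
Qed.

Lemma H10_approx u g1 g2 e : H10 Q u g1 g2 -> 0 < e -> exists phi,
  [/\ test_function Q phi, inL2 Q (fun z => u z - phi z),
    inL2 Q (fun z => g1 z - cpd1 phi z), inL2 Q (fun z => g2 z - cpd2 phi z) &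
    [/\ l2norm Q (fun z => u z - phi z) ^+ 2 < e ^+ 2,
     l2norm Q (fun z => g1 z - cpd1 phi z) ^+ 2 < e ^+ 2 &
     l2norm Q (fun z => g2 z - cpd2 phi z) ^+ 2 < e ^+ 2]].
Proof.
move=> [/inL2P[ur ui] /inL2P[g1r g1i] /inL2P[g2r g2i] _ H] e0.
have [phi tphi Hphi] := H e e0; exists phi.
have [sr _] := test_Re tphi; have [si _] := test_Im tphi.
have ReB (x y : R[i]) : complex.Re (x - y) = complex.Re x - complex.Re y by case: x; case: y.
have ImB (x y : R[i]) : complex.Im (x - y) = complex.Im x - complex.Im y by case: x; case: y.
have c F : smooth F -> L2 F by move=> sF; exact/continuous_L2/smooth_continuous.
split; first exact: tphi.
- apply/inL2P; rewrite (funext (fun z => ReB (u z) (phi z))) (funext (fun z => ImB (u z) (phi z))).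
  by split; [exact: (L2rB mQ ur (c _ sr))|exact: (L2rB mQ ui (c _ si))].
- apply/inL2P; rewrite (funext (fun z => ReB (g1 z) (cpd1 phi z))) (funext (fun z => ImB (g1 z) (cpd1 phi z))).
  by split; [exact: (L2rB mQ g1r (c _ (smooth_pd1 sr)))|exact: (L2rB mQ g1i (c _ (smooth_pd1 si)))].
- apply/inL2P; rewrite (funext (fun z => ReB (g2 z) (cpd2 phi z))) (funext (fun z => ImB (g2 z) (cpd2 phi z))).
  by split; [exact: (L2rB mQ g2r (c _ (smooth_pd2 sr)))|exact: (L2rB mQ g2i (c _ (smooth_pd2 si)))].
have n1 := sqr_ge0 (l2norm Q (fun z => u z - phi z)).
have n2 := sqr_ge0 (l2norm Q (fun z => g1 z - cpd1 phi z)).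
have n3 := sqr_ge0 (l2norm Q (fun z => g2 z - cpd2 phi z)).
exact: (lt_sum3 n1 n2 n3 Hphi).
Qed.

(** Meant for the derivatives of the sine modes: these are cosines in one variable and do not vanish
    on the boundary. *)
Lemma H10_parts u g1 g2 : H10 Q u g1 g2 ->
  (forall w dw, continuous w -> continuous dw ->
    (forall z, is_derive z ((1, 0) : R * R) w (dw z)) ->
    I[fun z => complex.Re (g1 z) * w z] = - I[fun z => complex.Re (u z) * dw z] /\
    I[fun z => complex.Im (g1 z) * w z] = - I[fun z => complex.Im (u z) * dw z]) /\
  (forall w dw, continuous w -> continuous dw ->
    (forall z, is_derive z ((0, 1) : R * R) w (dw z)) ->
    I[fun z => complex.Re (g2 z) * w z] = - I[fun z => complex.Re (u z) * dw z] /\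
    I[fun z => complex.Im (g2 z) * w z] = - I[fun z => complex.Im (u z) * dw z]).
Proof.
move=> Hu; have [/inL2P[ur ui] /inL2P[g1r g1i] /inL2P[g2r g2i] _ _] := Hu.
have ReB (x y : R[i]) : complex.Re (x - y) = complex.Re x - complex.Re y by case: x; case: y.
have ImB (x y : R[i]) : complex.Im (x - y) = complex.Im x - complex.Im y by case: x; case: y.
have sqRe (v w : R * R -> R[i]) e : inL2 Q (fun z => v z - w z) ->
    l2norm Q (fun z => v z - w z) ^+ 2 < e ->
    I[fun z => (complex.Re (v z) - complex.Re (w z)) ^+ 2] < e.
  move=> H; apply: le_lt_trans; apply: le_trans (Rintegral_Re_le H).
  by under [leRHS]eq_Rintegral do rewrite ReB.
have sqIm (v w : R * R -> R[i]) e : inL2 Q (fun z => v z - w z) ->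
    l2norm Q (fun z => v z - w z) ^+ 2 < e ->
    I[fun z => (complex.Im (v z) - complex.Im (w z)) ^+ 2] < e.
  move=> H; apply: le_lt_trans; apply: le_trans (Rintegral_Im_le H).
  by under [leRHS]eq_Rintegral do rewrite ImB.
split=> w dw cw cdw dwP; split.
- apply: (@approx_parts true) => // e e0.
  have [phi [tphi i0 i1 i2 [b00 b1 b2]]] := H10_approx Hu e0.
  exists (fun z => complex.Re (phi z)); first exact: test_Re.
  by split; [exact: (sqRe u phi _ i0 b00)|exact: (sqRe g1 (cpd1 phi) _ i1 b1)].
- apply: (@approx_parts true) => // e e0.
  have [phi [tphi i0 i1 i2 [b00 b1 b2]]] := H10_approx Hu e0.
  exists (fun z => complex.Im (phi z)); first exact: test_Im.
  by split; [exact: (sqIm u phi _ i0 b00)|exact: (sqIm g1 (cpd1 phi) _ i1 b1)].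
- apply: (@approx_parts false) => // e e0.
  have [phi [tphi i0 i1 i2 [b00 b1 b2]]] := H10_approx Hu e0.
  exists (fun z => complex.Re (phi z)); first exact: test_Re.
  by split; [exact: (sqRe u phi _ i0 b00)|exact: (sqRe g2 (cpd2 phi) _ i2 b2)].
- apply: (@approx_parts false) => // e e0.
  have [phi [tphi i0 i1 i2 [b00 b1 b2]]] := H10_approx Hu e0.
  exists (fun z => complex.Im (phi z)); first exact: test_Im.
  by split; [exact: (sqIm u phi _ i0 b00)|exact: (sqIm g2 (cpd2 phi) _ i2 b2)].
Qed.

(** [lambda] is complex a priori, whence the terms that couple the two parts of u. *)
Lemma eigen_test (lambda : R[i]) u : Defs.eigenspace Q lambda u -> exists g1 g2,
  H10 Q u g1 g2 /\ forall psi, rtest psi ->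
  I[fun z => complex.Re (g1 z) * pd1 psi z] + I[fun z => complex.Re (g2 z) * pd2 psi z] =
    complex.Re lambda * I[fun z => complex.Re (u z) * psi z] -
    complex.Im lambda * I[fun z => complex.Im (u z) * psi z] /\
  I[fun z => complex.Im (g1 z) * pd1 psi z] + I[fun z => complex.Im (g2 z) * pd2 psi z] =
    complex.Re lambda * I[fun z => complex.Im (u z) * psi z] +
    complex.Im lambda * I[fun z => complex.Re (u z) * psi z].
Proof.
move=> [_ [g1 [g2 [Hu weak]]]]; exists g1, g2; split => // psi tpsi.
have [/inL2P[ur ui] _ _ _ _] := Hu.
have [spsi _] := tpsi; have psi2 := continuous_L2 (smooth_continuous spsi).
have := weak _ _ _ (H10_rtest tpsi).
rewrite (funext (cpd1_real psi)) (funext (cpd2_real psi)) !l2inner_real_r /=.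
have iM X : L2 X -> (leb2 R).-integrable QL (EFin \o (fun z => X z * psi z)).
  by move=> X2; exact: (L2rM_integrable mQ X2 psi2).
have -> : I[fun z => complex.Re (lambda * u z) * psi z] =
    complex.Re lambda * I[fun z => complex.Re (u z) * psi z] -
    complex.Im lambda * I[fun z => complex.Im (u z) * psi z].
  rewrite -(RintegralZQ _ (iM _ ur)) -(RintegralZQ _ (iM _ ui)).
  rewrite -(RintegralBQ (integrableRZQ _ (iM _ ur)) (integrableRZQ _ (iM _ ui))).
  by apply: eq_Rintegral => z _; case: lambda {weak} => x y; case: (u z) => r s /=; ring.
have -> : I[fun z => complex.Im (lambda * u z) * psi z] =
    complex.Re lambda * I[fun z => complex.Im (u z) * psi z] +
    complex.Im lambda * I[fun z => complex.Re (u z) * psi z].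
  rewrite -(RintegralZQ _ (iM _ ui)) -(RintegralZQ _ (iM _ ur)).
  rewrite -(RintegralDQ (integrableRZQ _ (iM _ ui)) (integrableRZQ _ (iM _ ur))).
  by apply: eq_Rintegral => z _; case: lambda {weak} => x y; case: (u z) => r s /=; ring.
by move=> [-> ->].
Qed.

Section sine_mode.
Variables (w1 w2 : R).
Hypotheses (w10 : 0 <= w1) (w20 : 0 <= w2).
Hypotheses (sw1 : sin (w1 * a) = 0) (sw2 : sin (w2 * b) = 0).

Let S z := sin (w1 * z.1) * sin (w2 * z.2).
(** The shift to [k.+1] makes 1 / (k + 1) a positive margin between the support and the boundary. *)
Let psi (k : nat) z := cutoff a w1 k.+1 z.1 * cutoff b w2 k.+1 z.2.

Lemma rtest_cutoff k : rtest (psi k).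
Proof.
split; first by apply: smooth_tensor; exact: smooth1_cutoff.
pose e := (k.+1%:R : R)^-1.
have k0 : 0 < k.+1%:R :> R by [].
exists (`[e, a - e]%classic `*` `[e, b - e]%classic); split.
- by apply: compact_setX; exact: segment_compact.
- have e0 : 0 < e by rewrite invr_gt0.
  move=> [x y] [/=]; rewrite !in_itv/= => /andP[x1 x2] /andP[y1 y2].
  by split => /=; apply/andP; split; lra.
move=> [x y] Kz; apply/eqP/negPn/negP; rewrite /psi mulf_eq0 negb_or => /andP[].
move=> /cutoff_supp[x1 x2] /cutoff_supp[y1 y2]; apply: Kz => /=.
have H c : 1 < k.+1%:R * c -> e < c by rewrite mulrC -ltr_pdivrMr// mul1r.
move: (H _ x1) (H _ x2) (H _ y1) (H _ y2) => /= {}x1 {}x2 {}y1 {}y2.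
by split; rewrite /= in_itv/=; apply/andP; split; lra.
Qed.

Lemma pd1_cutoff k z : pd1 (psi k) z = derive1 (cutoff a w1 k.+1) z.1 * cutoff b w2 k.+1 z.2.
Proof.
have := is_derive_tensor1 (cutoff b w2 k.+1) (smooth1_is_derive z.1 (@smooth1_cutoff _ a w1 k.+1)).
by case.
Qed.

Lemma pd2_cutoff k z : pd2 (psi k) z = cutoff a w1 k.+1 z.1 * derive1 (cutoff b w2 k.+1) z.2.
Proof.
have := is_derive_tensor2 (cutoff a w1 k.+1) (smooth1_is_derive z.2 (@smooth1_cutoff _ b w2 k.+1)).
by case.
Qed.

Lemma cvg_cutoff_I F : L2 F ->
  I[fun z => F z * psi k z] @[k --> \oo] --> I[fun z => F z * S z].
Proof.
move=> F2; apply: (@cvg_L2r_dominated _ _ _ _ _ mQ Qoo F psi S 1 F2).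
- move=> k; apply: continuous_measurableQ; apply: smooth_continuous.
  by have [] := rtest_cutoff k.
- by move=> k z _; rewrite normrM mulr_ile1// cutoff_le1.
- move=> [x y] [/= x0 y0].
  apply: (@cvgM _ _ _ _ (fun k => cutoff a w1 k.+1 x) (fun k => cutoff b w2 k.+1 y)).
    by rewrite (@cvg_shiftS _ (fun k => cutoff a w1 k x)); exact: cvg_cutoff.
  by rewrite (@cvg_shiftS _ (fun k => cutoff b w2 k y)); exact: cvg_cutoff.
Qed.

Lemma cvg_pd1_cutoff_I F : L2 F ->
  I[fun z => F z * pd1 (psi k) z] @[k --> \oo] -->
  I[fun z => F z * (w1 * cos (w1 * z.1) * sin (w2 * z.2))].
Proof.
move=> F2; apply: (@cvg_L2r_dominated _ _ _ _ _ mQ Qoo F (fun k => pd1 (psi k)) _ (9 * w1) F2).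
- move=> k; apply: continuous_measurableQ; apply: smooth_continuous; apply: smooth_pd1.
  by have [] := rtest_cutoff k.
- move=> k [x y] [/= x0 y0]; rewrite pd1_cutoff normrM -[leRHS]mulr1 ler_pM//.
    exact: derive1_cutoff_le.
  exact: cutoff_le1.
- move=> [x y] [/= x0 y0]; under eq_fun do rewrite pd1_cutoff /=.
  apply: (@cvgM _ _ _ _ (fun k => derive1 (cutoff a w1 k.+1) x) (fun k => cutoff b w2 k.+1 y)).
    by rewrite (@cvg_shiftS _ (fun k => derive1 (cutoff a w1 k) x)); exact: cvg_derive1_cutoff.
  by rewrite (@cvg_shiftS _ (fun k => cutoff b w2 k y)); exact: cvg_cutoff.
Qed.

Lemma cvg_pd2_cutoff_I F : L2 F ->
  I[fun z => F z * pd2 (psi k) z] @[k --> \oo] -->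
  I[fun z => F z * (sin (w1 * z.1) * (w2 * cos (w2 * z.2)))].
Proof.
move=> F2; apply: (@cvg_L2r_dominated _ _ _ _ _ mQ Qoo F (fun k => pd2 (psi k)) _ (9 * w2) F2).
- move=> k; apply: continuous_measurableQ; apply: smooth_continuous; apply: smooth_pd2.
  by have [] := rtest_cutoff k.
- move=> k [x y] [/= x0 y0]; rewrite pd2_cutoff normrM -[leRHS]mul1r ler_pM//.
    exact: cutoff_le1.
  exact: derive1_cutoff_le.
- move=> [x y] [/= x0 y0]; under eq_fun do rewrite pd2_cutoff /=.
  apply: (@cvgM _ _ _ _ (fun k => cutoff a w1 k.+1 x) (fun k => derive1 (cutoff b w2 k.+1) y)).
    by rewrite (@cvg_shiftS _ (fun k => cutoff a w1 k x)); exact: cvg_cutoff.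
  by rewrite (@cvg_shiftS _ (fun k => derive1 (cutoff b w2 k) y)); exact: cvg_derive1_cutoff.
Qed.

Let is_derive_sinM (w x : R) : is_derive x (1 : R) (fun x => sin (w * x)) (w * cos (w * x)).
Proof.
rewrite (_ : (fun _ => _) = fun x => sin (w * x + 0)); last first.
  by apply/funext => y; rewrite addr0.
by apply: is_derive_affine; rewrite addr0; exact: is_derive_sin.
Qed.

Let is_derive_cosM (w x : R) :
  is_derive x (1 : R) (fun x => w * cos (w * x)) (- w ^+ 2 * sin (w * x)).
Proof.
have d : is_derive x (1 : R) (fun x => cos (w * x)) (w * - sin (w * x)).
  rewrite (_ : (fun _ => _) = fun x => cos (w * x + 0)); last first.
    by apply/funext => y; rewrite addr0.
  by apply: is_derive_affine; rewrite addr0; exact: is_derive_cos.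
refine (is_derive_eq (is_deriveMf (is_derive_cst w x 1) d) _).
by rewrite /=; ring.
Qed.

Let c_sinM (w : R) : continuous (fun x : R => sin (w * x)).
Proof. by apply: derivable_continuous => x; case: (is_derive_sinM w x). Qed.

Let c_cosM (w : R) : continuous (fun x : R => w * cos (w * x)).
Proof. by apply: derivable_continuous => x; case: (is_derive_cosM w x). Qed.

Let c_sqM (w : R) : continuous (fun x : R => - w ^+ 2 * sin (w * x)).
Proof. by move=> x; apply: cvgM; [exact: cvg_cst|exact: c_sinM]. Qed.

Let cS : continuous S.
Proof.
have H := @continuous_tensor R (fun x => sin (w1 * x)) (fun y => sin (w2 * y)) (@c_sinM w1) (@c_sinM w2).
by move=> z; exact: H.
Qed.

(** The complex coefficient U of u along the mode satisfies (w1^2 + w2^2) U = lambda U, so it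
    vanishes unless lambda is the eigenvalue of the mode. *)
Lemma eigen_coef (lambda : R[i]) u : Defs.eigenspace Q lambda u ->
  lambda <> (w1 ^+ 2 + w2 ^+ 2) +i* 0 ->
  I[fun z => complex.Re (u z) * S z] = 0 /\ I[fun z => complex.Im (u z) * S z] = 0.
Proof.
move=> /eigen_test[g1 [g2 [Hu weak]]] lamN.
have [/inL2P[ur ui] /inL2P[g1r g1i] /inL2P[g2r g2i] _ _] := Hu.
have [P1 P2] := H10_parts Hu.
set Ur := I[_]; set Ui := I[_].
have S2 F : L2 F -> (leb2 R).-integrable QL (EFin \o (fun z => F z * S z)).
  move=> F2; apply: (L2rM_integrable mQ F2); apply: continuous_L2.
  exact: cS.
have E1 F : L2 F -> - I[fun z => F z * (- w1 ^+ 2 * sin (w1 * z.1) * sin (w2 * z.2))] =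
    w1 ^+ 2 * I[fun z => F z * S z].
  move=> F2; rewrite -(RintegralZQ _ (S2 _ F2)) -mulN1r -RintegralZQ; last first.
    apply: (L2rM_integrable mQ F2); apply: continuous_L2.
    exact: (@continuous_tensor _ _ _ (@c_sqM w1) (@c_sinM w2)).
  by apply: eq_Rintegral => z _; rewrite /S; ring.
have E2 F : L2 F -> - I[fun z => F z * (sin (w1 * z.1) * (- w2 ^+ 2 * sin (w2 * z.2)))] =
    w2 ^+ 2 * I[fun z => F z * S z].
  move=> F2; rewrite -(RintegralZQ _ (S2 _ F2)) -mulN1r -RintegralZQ; last first.
    apply: (L2rM_integrable mQ F2); apply: continuous_L2.
    exact: (@continuous_tensor _ _ _ (@c_sinM w1) (@c_sqM w2)).
  by apply: eq_Rintegral => z _; rewrite /S; ring.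
have [Q1r Q1i] := P1 (fun z => w1 * cos (w1 * z.1) * sin (w2 * z.2))
  (fun z => - w1 ^+ 2 * sin (w1 * z.1) * sin (w2 * z.2))
  (@continuous_tensor _ _ _ (@c_cosM w1) (@c_sinM w2))
  (@continuous_tensor _ _ _ (@c_sqM w1) (@c_sinM w2))
  (fun z => is_derive_tensor1 (fun y => sin (w2 * y)) (is_derive_cosM w1 z.1)).
have [Q2r Q2i] := P2 (fun z => sin (w1 * z.1) * (w2 * cos (w2 * z.2)))
  (fun z => sin (w1 * z.1) * (- w2 ^+ 2 * sin (w2 * z.2)))
  (@continuous_tensor _ _ _ (@c_sinM w1) (@c_cosM w2))
  (@continuous_tensor _ _ _ (@c_sinM w1) (@c_sqM w2))
  (fun z => is_derive_tensor2 (fun x => sin (w1 * x)) (is_derive_cosM w2 z.2)).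
rewrite (E1 _ ur) in Q1r; rewrite (E1 _ ui) in Q1i.
rewrite (E2 _ ur) in Q2r; rewrite (E2 _ ui) in Q2i.
(* The pairing of the gradient of u with that of the cutoff mode has two limits to compare: one by
   dominated convergence and [H10_parts], the other by the weak equation. *)
have Lr : w1 ^+ 2 * Ur + w2 ^+ 2 * Ur = complex.Re lambda * Ur - complex.Im lambda * Ui.
  rewrite -Q1r -Q2r.
  have C2 : I[fun z => complex.Re (g1 z) * pd1 (psi k) z] + I[fun z => complex.Re (g2 z) * pd2 (psi k) z]
      @[k --> \oo] --> complex.Re lambda * Ur - complex.Im lambda * Ui.
    under eq_fun do rewrite (weak _ (rtest_cutoff _)).1.
    by apply: cvgB; apply: cvgM; [exact: cvg_cst|exact: cvg_cutoff_I|exact: cvg_cst|exact: cvg_cutoff_I].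
  exact: (cvg_unique (@Rhausdorff R) (cvgD (cvg_pd1_cutoff_I g1r) (cvg_pd2_cutoff_I g2r)) C2).
have Li : w1 ^+ 2 * Ui + w2 ^+ 2 * Ui = complex.Re lambda * Ui + complex.Im lambda * Ur.
  rewrite -Q1i -Q2i.
  have C2 : I[fun z => complex.Im (g1 z) * pd1 (psi k) z] + I[fun z => complex.Im (g2 z) * pd2 (psi k) z]
      @[k --> \oo] --> complex.Re lambda * Ui + complex.Im lambda * Ur.
    under eq_fun do rewrite (weak _ (rtest_cutoff _)).2.
    by apply: cvgD; apply: cvgM; [exact: cvg_cst|exact: cvg_cutoff_I|exact: cvg_cst|exact: cvg_cutoff_I].
  exact: (cvg_unique (@Rhausdorff R) (cvgD (cvg_pd1_cutoff_I g1i) (cvg_pd2_cutoff_I g2i)) C2).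
case: lambda lamN {weak} Lr Li => x y /= lamN Lr Li.
(* The equation for U is a real 2 by 2 system whose determinant m^2 + y^2 is the squared modulus of
   w1^2 + w2^2 - lambda. *)
pose m := w1 ^+ 2 + w2 ^+ 2 - x.
have nz : m ^+ 2 + y ^+ 2 != 0.
  rewrite paddr_eq0 ?sqr_ge0// !sqrf_eq0; apply/negP => /andP[/eqP m0 /eqP y0].
  by apply: lamN; rewrite y0; congr (_ +i* _); move: m0; rewrite /m; lra.
have e1 : m * Ur + y * Ui = 0 by rewrite /m; lra.
have e2 : m * Ui - y * Ur = 0 by rewrite /m; lra.
have f1 : (m ^+ 2 + y ^+ 2) * Ur = 0.
  have -> : (m ^+ 2 + y ^+ 2) * Ur = m * (m * Ur + y * Ui) - y * (m * Ui - y * Ur) by ring.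
  by rewrite e1 e2; ring.
have f2 : (m ^+ 2 + y ^+ 2) * Ui = 0.
  have -> : (m ^+ 2 + y ^+ 2) * Ui = m * (m * Ui - y * Ur) + y * (m * Ur + y * Ui) by ring.
  by rewrite e1 e2; ring.
by move/eqP: f1; move/eqP: f2; rewrite !mulf_eq0 (negbTE nz)/= => /eqP-> /eqP->.
Qed.

End sine_mode.

End dirichlet.

(** * Completeness of the double sine system *)

Section step_approximation.
Context {R : realType}.
Implicit Types (x s c : R).

Lemma bernoulli x n : -1 <= x -> 1 + n%:R * x <= (1 + x) ^+ n.
Proof.
move=> x1; elim: n => [|n IH]; first by rewrite mul0r addr0 expr0.
rewrite exprS -natr1; apply: (@le_trans _ _ ((1 + x) * (1 + n%:R * x))).
  have := sqr_ge0 x; have : 0 <= n%:R :> R by []; nra.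
by rewrite ler_wpM2l//; lra.
Qed.

(* The exponents are such that 2^(j j - j) s^(j j) = ((2 s)^j / 2)^j, so that the
   transition happens at 1/2 and the limit at 1/2 itself is 1. *)
Lemma cvg_step s : 0 <= s <= 1 ->
  (1 - s ^+ (j * j)) ^+ (2 ^ (j * j - j)) @[j --> \oo] -->
    (if s <= 2^-1 then 1 else 0 : R).
Proof.
move=> /andP[s0 s1].
have s_le1 n : s ^+ n <= 1 by rewrite exprn_ile1.
have s_ge0 n : 0 <= s ^+ n by rewrite exprn_ge0.
have q01 j : 0 <= (1 - s ^+ (j * j)) ^+ (2 ^ (j * j - j)) <= 1.
  by rewrite exprn_ge0 ?exprn_ile1 ?subr_ge0//= gerBl.
have half0 : (2^-1 : R) ^+ j @[j --> \oo] --> 0.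
  by apply: cvg_expr; rewrite ger0_norm//; lra.
have NE j : (2 ^ (j * j - j))%:R * s ^+ (j * j) = ((2 * s) ^+ j / 2) ^+ j.
  have jj : (j <= j * j)%N by case: j => // j; rewrite leq_pmull.
  rewrite expr_div_n -exprM exprMn natrX mulrAC; congr (_ * _).
  by apply/(canRL (mulfK _)); rewrite ?expf_neq0// -exprD subnK.
case: (leP s 2^-1) => sh.
  apply: (@squeeze_cvgr _ _ _ _ (fun j => 1 - (2^-1 : R) ^+ j) (fun=> 1)).
  - near=> j; have /andP[_ ->] := q01 j; rewrite andbT.
    apply: le_trans (@bernoulli (- s ^+ (j * j)) _ _); last by rewrite lerN2.
    rewrite mulrN lerD2l lerN2 NE.
    rewrite lerXn2r ?nnegrE ?divr_ge0 ?exprn_ge0 ?mulr_ge0//.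
    by rewrite ler_pdivrMr// mulVf// exprn_ile1 ?mulr_ge0//; lra.
  - by rewrite -[X in _ --> X]subr0; apply: cvgB => //; exact: cvg_cst.
  - exact: cvg_cst.
apply: (@squeeze_cvgr _ _ _ _ (fun=> 0) (fun j => (2^-1 : R) ^+ j)) => //; last first.
  exact: cvg_cst.
near=> j; have /andP[-> _] /= := q01 j.
(* Once (2 s)^j is at least 4, the product of the outer exponent and x = s^(j j), which is ((2 s)^j
   / 2)^j, is at least 2^j. *)
have big : 4 <= (2 * s) ^+ j.
  have y0 : 0 < 2 * s - 1 by lra.
  have B := @bernoulli (2 * s - 1) j.
  have J : 3 / (2 * s - 1) <= j%:R by near: j; exact: nbhs_infty_ger.
  have -> : 2 * s = 1 + (2 * s - 1) by ring.
  apply: le_trans (B _); last lra.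
  by rewrite ler_pdivrMr// in J; lra.
have x0 := s_ge0 (j * j)%N.
set x := s ^+ (j * j) in x0 *.
have B := @bernoulli x (2 ^ (j * j - j)) (le_trans _ x0).
have {}B : 1 + (2 ^ (j * j - j))%:R * x <= (1 + x) ^+ (2 ^ (j * j - j)) by apply: B; lra.
(* As (1 - x)(1 + x) <= 1, the power of 1 - x is at most the inverse of the same power of 1 + x,
   which Bernoulli makes smaller than 2^(-j). *)
have P : (1 - x) ^+ (2 ^ (j * j - j)) * (1 + x) ^+ (2 ^ (j * j - j)) <= 1.
  rewrite -exprMn exprn_ile1//; have := s_le1 (j * j)%N; rewrite -/x; nra.
have two : 2 ^+ j <= (2 ^ (j * j - j))%:R * x.
  by rewrite NE lerXn2r ?nnegrE//; lra.
have T0 : 0 < (2 : R) ^+ j by rewrite exprn_gt0.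
rewrite exprVn -[leRHS]mul1r ler_pdivlMr//; apply: le_trans P.
by apply: ler_wpM2l; [case/andP: (q01 j)|lra].
Unshelve. all: by end_near. Qed.

End step_approximation.

Section sine_span.
Context d (T : measurableType d) (R : realType) (m : {measure set T -> \bar R}).
Variables (D : set T) (h t : T -> R).
Hypotheses (mD : measurable D) (mt : measurable_fun D t).
Hypothesis ih : m.-integrable D (EFin \o h).
Hypothesis h_sin : forall n : nat, (0 < n)%N ->
  \int[m]_(x in D) (h x * sin (n%:R * t x)) = 0.

(** Bounded multipliers form an algebra, and h times one of them remains integrable. *)
Definition bddf (g : T -> R) := measurable_fun D g /\ exists M, forall x, D x -> `|g x| <= M.

Lemma bddfM g1 g2 : bddf g1 -> bddf g2 -> bddf (fun x => g1 x * g2 x).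
Proof.
move=> [m1 [M1 H1]] [m2 [M2 H2]]; split; first exact: measurable_funM.
exists (M1 * M2) => x Dx; rewrite normrM ler_pM//; [exact: H1|exact: H2].
Qed.

Lemma bddfD g1 g2 : bddf g1 -> bddf g2 -> bddf (fun x => g1 x + g2 x).
Proof.
move=> [m1 [M1 H1]] [m2 [M2 H2]]; split; first exact: measurable_funD.
exists (M1 + M2) => x Dx; apply: (le_trans (ler_normD _ _)).
by apply: lerD; [exact: H1|exact: H2].
Qed.

Lemma bddf_cst c : bddf (fun=> c).
Proof. by split => //; exists `|c|. Qed.

Lemma bddf_comp (f : R -> R) (M : R) : continuous f -> (forall x, `|f x| <= M) ->
  forall g, measurable_fun D g -> bddf (fun x => f (g x)).
Proof.
move=> cf fM g mg; split; last by exists M => x _.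
by apply: measurableT_comp => //; exact: continuous_measurable_fun.
Qed.

Lemma bddf_sin (k : R) : bddf (fun x => sin (k * t x)).
Proof.
apply: (@bddf_comp (@sin R) 1 (@continuous_sin R) (@sin_max R)).
exact: measurable_funM.
Qed.

Lemma bddf_cos : bddf (fun x => cos (t x)).
Proof. exact: (@bddf_comp (@cos R) 1 (@continuous_cos R) (@cos_max R)). Qed.

Lemma bddf_poly (p : {poly R}) : bddf (fun x => p.[cos (t x)]).
Proof.
elim/poly_ind: p => [|p c IH].
  by under eq_fun do rewrite horner0; exact: bddf_cst.
have := bddfD (bddfM IH bddf_cos) (bddf_cst c).
by under eq_fun do rewrite -hornerMXaddC.
Qed.

Lemma integrable_bddf g : bddf g -> m.-integrable D (EFin \o (fun x => h x * g x)).
Proof.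
move=> [mg [M gM]]; apply: (integrableMl mD ih mg).
exists M; split; first exact: num_real.
by move=> x Mx y /= Dy; rewrite (le_trans (gM _ Dy))// ltW.
Qed.

Lemma Rintegral_bddf_lin (c1 c2 : R) g1 g2 : bddf g1 -> bddf g2 ->
  \int[m]_(x in D) (h x * (c1 * g1 x + c2 * g2 x)) =
  c1 * \int[m]_(x in D) (h x * g1 x) + c2 * \int[m]_(x in D) (h x * g2 x).
Proof.
move=> b1 b2; have i1 := integrable_bddf b1; have i2 := integrable_bddf b2.
rewrite -(RintegralZl c1 mD i1) -(RintegralZl c2 mD i2).
rewrite -(RintegralD mD (integrableRZ mD c1 i1) (integrableRZ mD c2 i2)).
by apply: eq_Rintegral => x _ /=; ring.
Qed.

(** Multiplying sin (n t) by cos t gives the half sum of sin ((n + 1) t) and sin ((n - 1) t), so the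
    induction on p must be uniform in n; for n = 0 the integrand is zero. *)
Lemma Rintegral_sin_poly (p : {poly R}) (n : nat) :
  \int[m]_(x in D) (h x * (sin (n%:R * t x) * p.[cos (t x)])) = 0.
Proof.
elim/poly_ind: p n => [|p c IH] n.
  rewrite (eq_Rintegral _ (g := cst 0)) ?Rintegral_cst ?mul0r// => x _.
  by rewrite horner0 !mulr0.
case: n => [|n].
  rewrite (eq_Rintegral _ (g := cst 0)) ?Rintegral_cst ?mul0r// => x _.
  by rewrite mul0r sin0 mul0r mulr0.
have b k := bddfM (bddf_sin k%:R) (bddf_poly p).
have E x : h x * (sin (n.+1%:R * t x) * (p * 'X + c%:P).[cos (t x)]) =
  h x * (2^-1 * (sin (n.+2%:R * t x) * p.[cos (t x)] + sin (n%:R * t x) * p.[cos (t x)])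
   + c * sin (n.+1%:R * t x)).
  rewrite hornerMXaddC.
  have -> : n.+2%:R * t x = n.+1%:R * t x + t x by rewrite -natr1; ring.
  have -> : n%:R * t x = n.+1%:R * t x - t x by rewrite -[n.+1%:R]natr1; ring.
  by rewrite sinD sinB; field.
rewrite (eq_Rintegral _ (fun x _ => E x)).
rewrite Rintegral_bddf_lin; last exact: bddf_sin; last exact: (bddfD (b n.+2) (b n)).
rewrite h_sin// mulr0 addr0.
have -> : \int[m]_(x in D) (h x * (sin (n.+2%:R * t x) * p.[cos (t x)] +
    sin (n%:R * t x) * p.[cos (t x)])) =
  1 * \int[m]_(x in D) (h x * (sin (n.+2%:R * t x) * p.[cos (t x)])) +
  1 * \int[m]_(x in D) (h x * (sin (n%:R * t x) * p.[cos (t x)])).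
  rewrite -(Rintegral_bddf_lin _ _ (b n.+2) (b n)).
  by apply: eq_Rintegral => x _; rewrite !mul1r.
by rewrite !IH; ring.
Qed.

Lemma Rintegral_sin_step (c : R) : -1 <= c <= 1 ->
  \int[m]_(x in D) (h x * (sin (t x) * (if cos (t x) <= c then 1 else 0))) = 0.
Proof.
move=> /andP[c1 c2].
(* The affine map q sends [-1, 1] into [0, 1] and c to 1/2, the threshold of [cvg_step]; thus p j
   converges boundedly to the indicator of y <= c on [-1, 1]. *)
pose q : {poly R} := (2^-1 - c / 4)%:P + 4^-1 *: 'X.
pose p j : {poly R} := (1 - q ^+ (j * j)) ^+ (2 ^ (j * j - j)).
have qE y : q.[y] = 2^-1 + (y - c) / 4 by rewrite /q !hornerE; field.
have pE j y : (p j).[y] = (1 - (2^-1 + (y - c) / 4) ^+ (j * j)) ^+ (2 ^ (j * j - j)).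
  by rewrite /p horner_exp hornerD hornerN horner_exp qE hornerE.
have q01 y : `|y| <= 1 -> 0 <= 2^-1 + (y - c) / 4 <= 1.
  by rewrite ler_norml => /andP[y1 y2]; apply/andP; split; lra.
have C : \int[m]_(x in D) (h x * (sin (t x) * (p j).[cos (t x)])) @[j --> \oo] -->
  \int[m]_(x in D) (h x * (sin (t x) * (if cos (t x) <= c then 1 else 0))).
  apply: (@cvg_integrable_dominated _ _ _ m D mD h
    (fun j x => sin (t x) * (p j).[cos (t x)]) _ 1 ih).
  - move=> j; have [+ _] := bddfM (bddf_sin 1) (bddf_poly (p j)).
    by under eq_fun do rewrite mul1r.
  - move=> j x _; rewrite normrM mulr_ile1 ?sin_max// pE.
    have /andP[s0 s1] := q01 _ (cos_max (t x)).
    by rewrite ger0_norm ?exprn_ge0 ?exprn_ile1 ?subr_ge0 ?exprn_ile1// gerBl exprn_ge0.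
  - move=> x _; apply: cvgM; first exact: cvg_cst.
    under eq_fun do rewrite pE.
    have := cvg_step (q01 _ (cos_max (t x))).
    suff -> : (2^-1 + (cos (t x) - c) / 4 <= 2^-1) = (cos (t x) <= c) by [].
    by apply/idP/idP => H; lra.
have Z j : \int[m]_(x in D) (h x * (sin (t x) * (p j).[cos (t x)])) = 0.
  have := Rintegral_sin_poly (p j) 1.
  by under eq_Rintegral do rewrite mul1r.
apply: (cvg_unique (@Rhausdorff R) C).
by rewrite (funext Z); exact: cvg_cst.
Qed.

End sine_span.

Section dynkin_zero.
Context d (T : measurableType d) (R : realType) (m : {measure set T -> \bar R}).
Variables (D : set T) (g : T -> R).
Hypotheses (mD : measurable D) (ig : m.-integrable D (EFin \o g)).
Context d' (U : measurableType d') (f : T -> U) (C : set (set U)).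
Hypotheses (mf : measurable_fun setT f) (CE : @measurable _ U = <<s C >>).
Hypothesis CI : setI_closed C.
Hypothesis gT : \int[m]_(x in D) g x = 0.
Hypothesis gC : forall A, C A -> \int[m]_(x in D `&` f @^-1` A) g x = 0.

(** The sets over which g integrates to zero form a Dynkin system: complements use that the total
    integral is zero, disjoint unions that g is integrable. *)
Lemma Rintegral_dynkin0 A : measurable A -> \int[m]_(x in D `&` f @^-1` A) g x = 0.
Proof.
have mA B : measurable B -> measurable (D `&` f @^-1` B).
  move=> mB; apply: measurableI => //.
  by rewrite -[X in measurable X]setTI; exact: mf.
have iA B : measurable B -> m.-integrable (D `&` f @^-1` B) (EFin \o g).
  by move=> mB; apply: integrableS ig => //; exact: mA.
have ext B : measurable B -> \int[m]_(x in D `&` f @^-1` B) g x = 0 ->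
    (\int[m]_(x in D `&` f @^-1` B) (g x)%:E = 0)%E.
  by move=> mB H; rewrite -[LHS]fineK ?(integrable_fin_num (mA _ mB) (iA _ mB))//; congr _%:E.
rewrite CE; move: A; apply: (@dynkin_induction _ U C) => //.
- by rewrite preimage_setT setIT.
- move=> S mS S0.
  have mS' := mA _ mS; have mSC := mA _ (measurableC mS).
  have DE : (D `&` f @^-1` S) `|` (D `&` f @^-1` (~` S)) = D.
    by rewrite preimage_setC -setIUr setUCr setIT.
  have := gT; rewrite -[in X in X -> _]DE Rintegral_setU//.
  + by rewrite S0 add0r.
  + by rewrite DE.
  + by apply/disj_setPS => x [[_ ?] [_ /=]].
- move=> F mF tF F0.
  rewrite preimage_bigcup setI_bigcupr /Rintegral integral_bigcup//=.
  + by rewrite eseries0// => k _ _; exact: ext.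
  + apply/trivIsetP => i j _ _ ij; move/trivIsetP : tF => /(_ i j Logic.I Logic.I ij) H.
    rewrite setIACA setIid -preimage_setI H preimage_set0 setI0 //.
  + by move=> k; exact: mA.
  + by rewrite -setI_bigcupr -preimage_bigcup; apply: iA; exact: bigcupT_measurable.
Qed.

End dynkin_zero.

Section quadrants.
Context d (T : measurableType d) (R : realType) (m : {measure set T -> \bar R}).
Local Notation R1 := (measurableTypeR R).
Variables (D : set T) (g : T -> R) (f1 f2 : T -> R1).
Hypotheses (mD : measurable D) (ig : m.-integrable D (EFin \o g)).
Hypotheses (mf1 : measurable_fun setT f1) (mf2 : measurable_fun setT f2).
Hypotheses (f1_gt0 : forall x, D x -> 0 < f1 x) (f2_gt0 : forall x, D x -> 0 < f2 x).
Hypothesis gC : forall x0 y0 : R,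
  \int[m]_(x in D `&` [set x | x0 <= f1 x /\ y0 <= f2 x]) g x = 0.

Let CI : setI_closed (@RGenCInfty.G R).
Proof.
move=> _ _ [x ->] [y ->]; exists (Num.max x y); apply/seteqP; split=> z /=;
  rewrite !in_itv/= !andbT ge_max; first by move=> [-> ->].
by move=> /andP[].
Qed.

Let mpre (f : T -> R1) X : measurable_fun setT f ->
  measurable X -> measurable (f @^-1` X).
Proof. by move=> mf mX; rewrite -[Y in measurable Y]setTI; exact: mf. Qed.

Let Rintegral_quadrant1 y0 (X : set R1) : measurable X ->
  \int[m]_(x in (D `&` [set x | y0 <= f2 x]) `&` f1 @^-1` X) g x = 0.
Proof.
have E : [set x | y0 <= f2 x] = f2 @^-1` `[y0, +oo[%classic.
  by apply/seteqP; split=> z /=; rewrite in_itv/= andbT.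
have mY : measurable (D `&` [set x | y0 <= f2 x]).
  by rewrite E; apply: measurableI => //; apply: mpre => //; exact: measurable_itv.
move=> mX.
have iY : m.-integrable (D `&` [set x | y0 <= f2 x]) (EFin \o g).
  by apply: integrableS ig => //; exact: subIsetl.
have gT : \int[m]_(x in D `&` [set x | y0 <= f2 x]) g x = 0.
  rewrite -[RHS](gC 0 y0); congr Rintegral.
  apply/seteqP; split=> z [Dz] /=; first by move=> ?; split => //; split => //; exact/ltW/f1_gt0.
  by move=> [].
have gC' A : @RGenCInfty.G R A ->
    \int[m]_(x in (D `&` [set x | y0 <= f2 x]) `&` f1 @^-1` A) g x = 0.
  move=> [x0 ->]; rewrite -[RHS](gC x0 y0); congr Rintegral.
  by apply/seteqP; split=> z /=; rewrite in_itv/= andbT; [move=> [[]]|move=> [? []]].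
exact: (Rintegral_dynkin0 mY iY mf1 (@RGenCInfty.measurableE R) CI gT gC' mX).
Qed.

Let Rintegral_quadrant2 (X Y : set R1) : measurable X -> measurable Y ->
  \int[m]_(x in (D `&` f1 @^-1` X) `&` f2 @^-1` Y) g x = 0.
Proof.
move=> mX mY.
have mQX : measurable (D `&` f1 @^-1` X) by apply: measurableI => //; exact: mpre.
have iX : m.-integrable (D `&` f1 @^-1` X) (EFin \o g).
  by apply: integrableS ig => //; exact: subIsetl.
have gT : \int[m]_(x in D `&` f1 @^-1` X) g x = 0.
  rewrite -[RHS](Rintegral_quadrant1 0 mX); congr Rintegral.
  apply/seteqP; split=> z; last by move=> [[]].
  by move=> [Dz Xz]; split => //; split => //=; exact/ltW/f2_gt0.
have gC' A : @RGenCInfty.G R A ->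
    \int[m]_(x in (D `&` f1 @^-1` X) `&` f2 @^-1` A) g x = 0.
  move=> [y0 ->]; rewrite -[RHS](Rintegral_quadrant1 y0 mX); congr Rintegral.
  by apply/seteqP; split=> z /=; rewrite in_itv/= andbT; move=> [[]].
exact: (Rintegral_dynkin0 mQX iX mf2 (@RGenCInfty.measurableE R) CI gT gC' mY).
Qed.

(** Three passes of the pi-lambda argument: half-lines for [f1], half-lines for [f2], then
    rectangles. Positivity of [f1] and [f2] makes D itself a quadrant with corner at 0, which
    supplies the total integrals. *)
Lemma Rintegral_quadrant0 (A : set (R1 * R1)) : measurable A ->
  \int[m]_(x in D `&` [set x | A (f1 x, f2 x)]) g x = 0.
Proof.
move=> mA.
pose C : set (set (R1 * R1)) := [set X `*` Y | X in @measurable _ R1 & Y in @measurable _ R1].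
have mf : measurable_fun setT (fun x => (f1 x, f2 x)) by exact: measurable_fun_pair.
have CI2 : setI_closed C.
  move=> _ _ [X1 mX1 [Y1 mY1 <-]] [X2 mX2 [Y2 mY2 <-]]; rewrite -setXI.
  by exists (X1 `&` X2); [exact: measurableI|exists (Y1 `&` Y2) => //; exact: measurableI].
have gT : \int[m]_(x in D) g x = 0.
  rewrite -[RHS](@Rintegral_quadrant2 setT setT)//; congr Rintegral.
  by rewrite !preimage_setT !setIT.
have gC' B : C B -> \int[m]_(x in D `&` (fun x => (f1 x, f2 x)) @^-1` B) g x = 0.
  move=> [X mX [Y mY <-]]; rewrite -[RHS](Rintegral_quadrant2 mX mY); congr Rintegral.
  by apply/seteqP; split=> z /=; [move=> [? []]|move=> [[]]].
have CE : @measurable _ (R1 * R1)%type = <<s C >> by exact: measurable_prod_measurableType.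
exact: (Rintegral_dynkin0 mD ig mf CE CI2 gT gC' mA).
Qed.

End quadrants.

(** Lets the integral be tested on Borel sets only: a measurable E is replaced by a subset of full
    measure. *)
Lemma Rintegral_inner_regular0_ae d (T : measurableType d) (R : realType)
    (m : {measure set T -> \bar R}) (D : set T) (g : T -> R) : measurable D ->
  m.-integrable D (EFin \o g) ->
  (forall E, E `<=` D -> measurable E -> exists2 B, measurable B &
    [/\ B `<=` E, m (E `\` B) = 0%E & \int[m]_(x in B) g x = 0]) ->
  {ae m, forall x, D x -> g x = 0}.
Proof.
move=> mD ig H.
have : ae_eq m D (EFin \o g) (cst 0%E).
  apply: integral_ae_eq => // E ED mE.
  have [B mB [BE EB0 gB]] := H E ED mE.
  have iE : m.-integrable E (EFin \o g) by exact: integrableS ig.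
  have iB : m.-integrable B (EFin \o g) by apply: integrableS iE.
  rewrite integral0 (negligible_integral (measurableD mE mB) mE iE EB0).
  rewrite setDD setIidr// -[LHS]fineK; first by congr _%:E.
  exact: integrable_fin_num.
by apply: filterS => x h Dx; have [] := h Dx.
Qed.

Section sine_completeness.
Context {R : realType}.
Local Notation R2 := (measurableTypeR R * measurableTypeR R)%type.
Variables (a b : R).
Hypotheses (a0 : 0 < a) (b0 : 0 < b).
Local Notation Q := (rectangle a b).
Local Notation QL := (Q : set (plane R)).
Local Notation "'I[' F ]" := (Rintegral (leb2 R) QL F) (at level 0, format "'I[' F ]").
Variable W : R * R -> R.
Hypothesis W2 : L2r (leb2 R) QL W.
Hypothesis W_orth : forall m n : nat, (0 < m)%N -> (0 < n)%N ->
  I[fun z => W z * (sin (m%:R * (pi / a * z.1)) * sin (n%:R * (pi / b * z.2)))] = 0.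

Let mQ : measurable QL := plane_measurable_rectangle a b.
Let Qoo := leb2_rectangle_lty a0 b0.
Let t1 (z : plane R) := pi / a * z.1.
Let t2 (z : plane R) := pi / b * z.2.
Let step c (y : R) : R := if cos y <= c then 1 else 0.

Local Opaque Rintegral leb2.

Let ct1 : continuous (fun z : R * R => pi / a * z.1).
Proof. by move=> z; apply: cvgM; [exact: cvg_cst|exact: cvg_fst]. Qed.

Let ct2 : continuous (fun z : R * R => pi / b * z.2).
Proof. by move=> z; apply: cvgM; [exact: cvg_cst|exact: cvg_snd]. Qed.

Let mt1 : measurable_fun QL t1. Proof. exact: continuous_measurableQ ct1. Qed.
Let mt2 : measurable_fun QL t2. Proof. exact: continuous_measurableQ ct2. Qed.

Let iW : (leb2 R).-integrable QL (EFin \o W) := L2r_integrable mQ Qoo W2.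

Let bddf_step c (t : plane R -> R) : measurable_fun QL t -> bddf QL (fun z => step c (t z)).
Proof.
move=> mt; split; last by exists 1 => z _; rewrite /step; case: ifP; rewrite ?normr1// normr0.
have ms : measurable_fun setT (step c : measurableTypeR R -> measurableTypeR R).
  rewrite /step; apply: measurable_fun_ifT => //.
  apply: measurable_fun_ler => //.
  by apply: continuous_measurable_fun; exact: continuous_cos.
exact: (measurableT_comp ms mt).
Qed.

Let G z := W z * (sin (t1 z) * sin (t2 z)).

(** One variable at a time: for fixed n the function W sin (n t2) is orthogonal to all sin (k t1),
    which gives the step in t1; the resulting function is orthogonal to all sin (n t2). *)
Let Rintegral_G_step c1 c2 : -1 <= c1 <= 1 -> -1 <= c2 <= 1 ->
  I[fun z => G z * (step c1 (t1 z) * step c2 (t2 z))] = 0.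
Proof.
move=> c1P c2P.
have bs1 := bddf_sin mt1; have bs2 := bddf_sin mt2.
have E1 n : (0 < n)%N ->
    I[fun z => (W z * (sin (t1 z) * step c1 (t1 z))) * sin (n%:R * t2 z)] = 0.
  move=> n0.
  have := @Rintegral_sin_step _ _ _ (leb2 R) QL (fun z => W z * sin (n%:R * t2 z)) t1 mQ mt1
    (integrable_bddf mQ iW (bs2 n%:R)) _ c1 c1P.
  rewrite (_ : (fun z : R * R => _) = (fun z => W z * (sin (t1 z) * step c1 (t1 z)) * sin (n%:R * t2 z))).
    apply => k k0; rewrite -[RHS](W_orth k0 n0); apply: eq_Rintegral => z _.
    by rewrite /t1 /t2; ring.
  by apply/funext => z; rewrite /step; ring.
have b1 : bddf QL (fun z => sin (t1 z) * step c1 (t1 z)).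
  apply: bddfM; last exact: bddf_step.
  by have := bs1 1; under eq_fun do rewrite mul1r.
have := @Rintegral_sin_step _ _ _ (leb2 R) QL (fun z => W z * (sin (t1 z) * step c1 (t1 z))) t2 mQ mt2
    (integrable_bddf mQ iW b1) E1 c2 c2P.
rewrite (_ : (fun z : R * R => _) = (fun z => G z * (step c1 (t1 z) * step c2 (t2 z))))//.
by apply/funext => z; rewrite /step /G; ring.
Qed.

Let bddG : bddf QL (fun z => sin (t1 z) * sin (t2 z)).
Proof.
have := bddfM (bddf_sin mt1 1) (bddf_sin mt2 1).
by under eq_fun do rewrite !mul1r.
Qed.

Let iG : (leb2 R).-integrable QL (EFin \o G).
Proof. exact (integrable_bddf mQ iW bddG). Qed.

Let step_ge (c x0 x : R) : 0 < c -> 0 < x < c -> 0 <= x0 <= c ->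
  (cos (pi / c * x) <= cos (pi / c * x0)) = (x0 <= x).
Proof.
move=> c0 /andP[x1 x2] /andP[x3 x4].
have pc : 0 < pi / c by rewrite divr_gt0 ?pi_gt0.
have H y : 0 <= y -> y <= c -> pi / c * y \in `[0, pi].
  move=> y0 yc; rewrite in_itv/= mulr_ge0 ?(ltW pc)//=.
  by rewrite -mulrA mulrC -ler_pdivlMr ?pi_gt0// divff ?gt_eqF ?pi_gt0// mulrC ler_pdivrMr// mul1r.
rewrite leNgt ltr_cos ?H ?(ltW x1) ?(ltW x2)//.
by rewrite ltr_pM2l// -leNgt.
Qed.

Let quadrant (x0 y0 : R) : set (plane R) := [set z | x0 <= z.1 /\ y0 <= z.2].

Let Rintegral_G_quadrant0 x0 y0 : 0 <= x0 <= a -> 0 <= y0 <= b ->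
  \int[leb2 R]_(z in QL `&` quadrant x0 y0) G z = 0.
Proof.
move=> x0P y0P; rewrite Rintegral_mkcondr.
rewrite -[RHS](@Rintegral_G_step (cos (pi / a * x0)) (cos (pi / b * y0))).
- apply: eq_Rintegral => -[x y]; rewrite inE => -[/= xP yP].
  rewrite patchE /step /t1 /t2 /= (step_ge a0 xP x0P) (step_ge b0 yP y0P).
  case: ifPn => [/[!inE] -[/= -> ->]|/negP]; first by rewrite !mulr1.
  rewrite inE /quadrant /= => /not_andP[] /negP/negbTE ->; first by rewrite mul0r mulr0.
  by rewrite !mulr0.
- by rewrite cos_geN1 cos_le1.
- by rewrite cos_geN1 cos_le1.
Qed.

Let Rintegral_G_quadrant x0 y0 : \int[leb2 R]_(z in QL `&` quadrant x0 y0) G z = 0.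
Proof.
(* Moving the corner of the quadrant into the closed rectangle does not change the trace on the open
   one. *)
pose clamp c x : R := Num.max 0 (Num.min c x).
have clampP c x : 0 < c -> 0 <= clamp c x <= c.
  move=> c0; rewrite /clamp le_max lexx/= ge_max (ltW c0)/=.
  by rewrite ge_min lexx.
have clampE c x y : 0 < y < c -> (clamp c x <= y) = (x <= y).
  move=> /andP[y0' yc]; rewrite /clamp ge_max (ltW y0')/= ge_min.
  by rewrite leNgt yc.
rewrite -[RHS](Rintegral_G_quadrant0 (clampP a x0 a0) (clampP b y0 b0)); congr Rintegral.
apply/seteqP; split=> -[x y] [[/= xP yP] [/= h1 h2]]; split => //; split => /=.
- by rewrite clampE.
- by rewrite clampE.
- by rewrite -(clampE a).
- by rewrite -(clampE b).
Qed.

Let mfst : measurable_fun (setT : set (plane R)) (fst : plane R -> measurableTypeR R).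
Proof. by apply: borel_plane_measurable_fun => //; exact: measurable_fst. Qed.

Let msnd : measurable_fun (setT : set (plane R)) (snd : plane R -> measurableTypeR R).
Proof. by apply: borel_plane_measurable_fun => //; exact: measurable_snd. Qed.

Let Rintegral_G_borel (A : set R2) : measurable A ->
  \int[leb2 R]_(z in (QL `&` (A : set (plane R)))) G z = 0.
Proof.
move=> mA.
have H x0 y0 : \int[leb2 R]_(z in QL `&` [set z | x0 <= fst z /\ y0 <= snd z]) G z = 0.
  exact: Rintegral_G_quadrant.
have P1 (z : plane R) : QL z -> 0 < fst z by case: z => x y [/= /andP[]].
have P2 (z : plane R) : QL z -> 0 < snd z by case: z => x y [/= _ /andP[]].
have := Rintegral_quadrant0 mQ iG mfst msnd P1 P2 H mA.
rewrite (_ : [set x | A (fst x, snd x)] = (A : set (plane R)))//.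
by apply/funext => -[].
Qed.

(** The cosine decreases on [0, pi], so steps in cos t1 and cos t2 are indicators of quadrants;
    hence W sin t1 sin t2 integrates to zero over all Borel sets. Both sines are positive inside the
    rectangle and can be divided out. *)
Lemma sine_complete : {ae leb2 R, forall z : plane R, Q z -> W z = 0}.
Proof.
have : {ae leb2 R, forall z : plane R, QL z -> G z = 0}.
  apply: (@Rintegral_inner_regular0_ae _ (plane R) R (leb2 R) QL G mQ iG) => E EQ mE.
  have Eoo : (leb2 R E < +oo)%E.
    by apply: le_lt_trans Qoo; apply: le_measure => //; rewrite inE.
  have [B mB [BE EB0]] := borel_kernel mE Eoo.
  exists (B : set (plane R)); first exact: borel_plane_measurable.
  split; [exact BE|exact EB0|].
  rewrite -[RHS](Rintegral_G_borel mB); congr Rintegral.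
  by apply/esym/setIidr; exact: subset_trans BE EQ.
apply: filterS => -[x y] h [/= xP yP].
have := h (conj xP yP); rewrite /G /t1 /t2 /= => /eqP; rewrite mulf_eq0 => /orP[/eqP//|].
have S c (c0 : 0 < c) u : 0 < u < c -> 0 < sin (pi / c * u).
  move=> /andP[u0 uc]; apply: sin_gt0_pi; rewrite mulr_gt0 ?divr_gt0 ?pi_gt0//=.
  by rewrite -mulrA gtr_pMr ?pi_gt0// mulrC ltr_pdivrMr// mul1r.
by rewrite mulf_eq0 !gt_eqF//; exact: S.
Qed.

End sine_completeness.

(** * Sine sums and the expansion of eigenfunctions *)

Lemma integrableR_sum d (T : measurableType d) (R : realType) (m : {measure set T -> \bar R})
    (D : set T) (I : Type) (s : seq I) (P : pred I) (F : I -> T -> R) : measurable D ->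
  (forall i, P i -> m.-integrable D (EFin \o F i)) ->
  m.-integrable D (EFin \o (fun x => \sum_(i <- s | P i) F i x)).
Proof.
move=> mD iF.
rewrite (_ : _ \o _ = fun x => (\sum_(i <- s | P i) (F i x)%:E)%E).
  exact: integrable_sum.
by apply/funext => x; rewrite /= sumEFin.
Qed.

Lemma Rintegral_sum d (T : measurableType d) (R : realType) (m : {measure set T -> \bar R})
    (D : set T) (I : Type) (s : seq I) (P : pred I) (F : I -> T -> R) : measurable D ->
  (forall i, P i -> m.-integrable D (EFin \o F i)) ->
  \int[m]_(x in D) (\sum_(i <- s | P i) F i x) = \sum_(i <- s | P i) \int[m]_(x in D) F i x.
Proof.
move=> mD iF; elim: s => [|i s IH].
  by under eq_Rintegral do rewrite big_nil; rewrite Rintegral_cst// mul0r big_nil.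
under eq_Rintegral do rewrite big_cons; rewrite big_cons -IH.
case: ifPn => // Pi; rewrite RintegralD//; first exact: iF.
exact: integrableR_sum.
Qed.

Section sines.
Context {R : realType}.
Local Notation mu := (@lebesgue_measure R).
Implicit Types (F : R * R -> R) (c : nat -> nat -> R).

Lemma sin_natpi (n : nat) : sin (n%:R * pi) = 0 :> R.
Proof.
elim: n => [|n IH]; first by rewrite mul0r sin0.
by rewrite -natr1 mulrDl mul1r sinDpi IH oppr0.
Qed.

Lemma is_derive_sinM (K k x : R) : is_derive x (1 : R) (fun y => K * sin (k * y)) (K * k * cos (k * x)).
Proof.
have Hs : is_derive x (1 : R) (fun y => sin (k * y + 0)) (k * cos (k * x + 0)).
  by apply: is_derive_affine; exact: is_derive_sin.
rewrite (_ : (fun y => _) = (fun y => K * sin (k * y + 0))); last first.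
  by apply/funext => y; rewrite addr0.
refine (is_derive_eq (is_deriveMf (is_derive_cst K x (1 : R)) Hs) _).
by rewrite !addr0 /cst; ring.
Qed.

(** Product-to-sum formulas give a primitive; the case m = n is separate because the difference
    frequency degenerates to a linear term. *)
Lemma Rintegral_sin_sin (l : R) (m n : nat) : 0 < l -> (0 < m)%N -> (0 < n)%N ->
  \int[mu]_(x in `]0, l[) (sin (m%:R * (pi / l * x)) * sin (n%:R * (pi / l * x))) =
  if m == n then l / 2 else 0.
Proof.
move=> l0 m0 n0; have p0 := @pi_gt0 R.
have w0 : pi / l != 0 by rewrite mulf_neq0 ?invr_eq0 ?gt_eqF.
have cf : continuous (fun x => sin (m%:R * (pi / l * x)) * sin (n%:R * (pi / l * x))).
  have cM (k : R) : continuous (fun x => sin (k * (pi / l * x))).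
    move=> x; apply: continuous_comp; last exact: continuous_sin.
    by do 2 (apply: cvgM; first exact: cvg_cst); exact: cvg_id.
  by move=> x; apply: cvgM; exact: cM.
have mn0 : m%:R + n%:R != 0 :> R by rewrite gt_eqF// addr_gt0 ?ltr0n.
have pl : pi / l * l = pi by rewrite divfK ?gt_eqF.
case: eqP => [mn|/eqP mn].
  subst n.
  have dF x : is_derive x (1 : R) (fun x : R => (2^-1 : R) * x +
      (- (2 * ((m%:R + m%:R) * (pi / l)))^-1) * sin ((m%:R + m%:R) * (pi / l) * x))
      (sin (m%:R * (pi / l * x)) * sin (m%:R * (pi / l * x))).
    refine (is_derive_eq (is_deriveDf (is_deriveMf (is_derive_cst _ x (1 : R)) (is_derive_id _ _))
      (is_derive_sinM _ _ _)) _).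
    have -> : (m%:R + m%:R) * (pi / l) * x = m%:R * (pi / l * x) + m%:R * (pi / l * x) by ring.
    have -> : - (2 * ((m%:R + m%:R) * (pi / l)))^-1 * ((m%:R + m%:R) * (pi / l)) = - 2^-1.
      by rewrite mulNr invfM -mulrA mulVf ?mulr1// mulf_neq0.
    have := cos2Dsin2 (m%:R * (pi / l * x)); rewrite cosD /cst /=; set C := cos _; set S := sin _.
    move=> CS; have -> : C * C = 1 - S ^+ 2 by rewrite -expr2 -CS; ring.
    have H (y s : R) : 0 * y + 2^-1 * 1 + - 2^-1 * (1 - s ^+ 2 - s * s) = s * s by field.
    exact: H.
  rewrite (Rintegral_FTC l0 cf dF).
  have -> : (m%:R + m%:R) * (pi / l) * l = m%:R * pi + m%:R * pi by rewrite -mulrA pl mulrDl.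
  by rewrite sinD sin_natpi !(mulr0, mul0r, sin0, addr0, subr0) mulrC.
have mn1 : m%:R - n%:R != 0 :> R by rewrite subr_eq0 eqr_nat.
have dF x : is_derive x (1 : R) (fun x =>
    (2 * ((m%:R - n%:R) * (pi / l)))^-1 * sin ((m%:R - n%:R) * (pi / l) * x) +
    (- (2 * ((m%:R + n%:R) * (pi / l)))^-1) * sin ((m%:R + n%:R) * (pi / l) * x))
    (sin (m%:R * (pi / l * x)) * sin (n%:R * (pi / l * x))).
  refine (is_derive_eq (is_deriveDf (is_derive_sinM _ _ _) (is_derive_sinM _ _ _)) _).
  have -> : (m%:R + n%:R) * (pi / l) * x = m%:R * (pi / l * x) + n%:R * (pi / l * x) by ring.
  have -> : (m%:R - n%:R) * (pi / l) * x = m%:R * (pi / l * x) - n%:R * (pi / l * x) by ring.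
  rewrite cosB cosD.
  have -> : (2 * ((m%:R - n%:R) * (pi / l)))^-1 * ((m%:R - n%:R) * (pi / l)) = 2^-1.
    by rewrite invfM -mulrA mulVf ?mulr1// mulf_neq0.
  have -> : - (2 * ((m%:R + n%:R) * (pi / l)))^-1 * ((m%:R + n%:R) * (pi / l)) = - 2^-1.
    by rewrite mulNr invfM -mulrA mulVf ?mulr1// mulf_neq0.
  by field.
rewrite (Rintegral_FTC l0 cf dF).
have -> : (m%:R - n%:R) * (pi / l) * l = m%:R * pi - n%:R * pi by rewrite -mulrA pl mulrBl.
have -> : (m%:R + n%:R) * (pi / l) * l = m%:R * pi + n%:R * pi by rewrite -mulrA pl mulrDl.
by rewrite sinB sinD !sin_natpi !(mulr0, mul0r, sin0, addr0, subr0).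
Qed.

Lemma continuous_integrable_itv (l M : R) (f : R -> R) : 0 < l -> continuous f ->
  (forall x, `|f x| <= M) -> mu.-integrable `]0, l[%classic (EFin \o f).
Proof.
move=> l0 cf fM.
have loo : (mu `]0%R, l[%classic < +oo)%E by rewrite leb_itv0 // ltry.
apply: (@bounded_integrable _ _ _ mu _ _ M) => //.
apply: measurable_funTS; exact: continuous_measurable_fun.
Qed.

Variables (a b : R).
Hypotheses (a0 : 0 < a) (b0 : 0 < b).
Local Notation Q := (rectangle a b).
Local Notation QL := (Q : set (plane R)).
Local Notation "'I[' F ]" := (Rintegral (leb2 R) QL F) (at level 0, format "'I[' F ]").

Definition sine (m n : nat) (z : R * R) : R :=
  sin (m%:R * (pi / a * z.1)) * sin (n%:R * (pi / b * z.2)).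

Definition freq (m n : nat) : R := (m%:R * (pi / a)) ^+ 2 + (n%:R * (pi / b)) ^+ 2.

Definition sine_sum N c (z : R * R) : R := \sum_(p : 'I_N * 'I_N) c p.1 p.2 * sine p.1 p.2 z.

Lemma continuous_sine m n : continuous (sine m n).
Proof.
apply: (@continuous_tensor R (fun x => sin (m%:R * (pi / a * x))) (fun x => sin (n%:R * (pi / b * x)))).
  move=> x; apply: continuous_comp; last exact: continuous_sin.
  by do 2 (apply: cvgM; first exact: cvg_cst); exact: cvg_id.
move=> x; apply: continuous_comp; last exact: continuous_sin.
by do 2 (apply: cvgM; first exact: cvg_cst); exact: cvg_id.
Qed.

Lemma continuous_sine_sum N c : continuous (sine_sum N c).
Proof.
rewrite /sine_sum; apply: continuous_big => [|p _]; first exact: add_continuous.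
by move=> z; apply: cvgM; [exact: cvg_cst|exact: continuous_sine].
Qed.

Lemma Rintegral_sine_sine i j m n : (0 < i)%N -> (0 < j)%N -> (0 < m)%N -> (0 < n)%N ->
  I[fun z => sine i j z * sine m n z] = if (i == m) && (j == n) then a * b / 4 else 0.
Proof.
move=> i0 j0 m0 n0.
rewrite (Rintegral_rectangle1 a0 b0); last exact: continuous2M (@continuous_sine i j) (@continuous_sine m n).
transitivity (\int[mu]_(x in `]0, a[)
    ((if j == n then b / 2 else 0) * (sin (i%:R * (pi / a * x)) * sin (m%:R * (pi / a * x))))).
  apply: eq_Rintegral => x _.
  have cS : continuous (fun x => sin (j%:R * (pi / b * x)) * sin (n%:R * (pi / b * x))).
    move=> y; apply: cvgM; (apply: continuous_comp; last exact: continuous_sin);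
    by do 2 (apply: cvgM; first exact: cvg_cst); exact: cvg_id.
  rewrite -(Rintegral_sin_sin b0 j0 n0) mulrC -RintegralZl//.
    by apply: eq_Rintegral => y _; rewrite /sine /=; ring.
  by apply: (@continuous_integrable_itv b 1) => // y; rewrite normrM mulr_ile1 ?sin_max.
have cS : continuous (fun x => sin (i%:R * (pi / a * x)) * sin (m%:R * (pi / a * x))).
  move=> y; apply: cvgM; (apply: continuous_comp; last exact: continuous_sin);
  by do 2 (apply: cvgM; first exact: cvg_cst); exact: cvg_id.
rewrite RintegralZl//.
  by rewrite Rintegral_sin_sin//; case: (i == m); case: (j == n) => /=; field.
by apply: (@continuous_integrable_itv a 1) => // y; rewrite normrM mulr_ile1 ?sin_max.
Qed.

Local Opaque Rintegral leb2.

Let mQ : measurable QL := plane_measurable_rectangle a b.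
Let Qoo := leb2_rectangle_lty a0 b0.

Let iM F m n : L2r (leb2 R) QL F -> (leb2 R).-integrable QL (EFin \o (fun z => F z * sine m n z)).
Proof.
by move=> F2; exact: (L2rM_integrable mQ F2 (continuous_L2 a0 b0 (@continuous_sine m n))).
Qed.

Lemma Rintegral_sine_sum_sine N c m n : (0 < m)%N -> (0 < n)%N ->
  (forall i j, c i j != 0 -> (0 < i)%N && (0 < j)%N) ->
  I[fun z => sine_sum N c z * sine m n z] =
  (if (m < N)%N && (n < N)%N then c m n else 0) * (a * b / 4).
Proof.
move=> m0 n0 cP.
under eq_Rintegral do rewrite /sine_sum big_distrl /=.
rewrite Rintegral_sum//; last first.
  move=> p _; apply: (iM _ _ (F := fun z => c p.1 p.2 * sine p.1 p.2 z)).
  by apply: (continuous_L2 a0 b0) => z; apply: cvgM; [exact: cvg_cst|exact: continuous_sine].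
have E (p : 'I_N * 'I_N) : I[fun z => c p.1 p.2 * sine p.1 p.2 z * sine m n z] =
    (if (p.1 == m :> nat) && (p.2 == n :> nat) then c p.1 p.2 else 0) * (a * b / 4).
  under eq_Rintegral do rewrite -mulrA.
  rewrite (RintegralZl _ mQ); last exact: iM (continuous_L2 a0 b0 (@continuous_sine p.1 p.2)).
  have [->|/cP/andP[i0 j0]] := eqVneq (c p.1 p.2) 0; first by rewrite if_same !mul0r.
  by rewrite Rintegral_sine_sine//; case: ifP; rewrite ?mulr0 ?mul0r.
under eq_bigr do rewrite E.
rewrite -big_distrl; congr (_ * _) => /=.
case: ifPn => [/andP[mN nN]|mnN]; last first.
  rewrite big1// => -[i j] _ /=; case: ifPn => // /andP[/eqP im /eqP jn].
  by move: mnN; rewrite -im -jn !ltn_ord.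
rewrite (bigD1 (Ordinal mN, Ordinal nN))//= !eqxx big1 ?addr0// => -[i j] /= ij.
case: ifPn => // /andP[/eqP im /eqP jn]; case/eqP: ij.
by congr pair; exact/val_inj.
Qed.

Lemma Rintegral_sqr_sine_sum N c :
  (forall i j, c i j != 0 -> (0 < i)%N && (0 < j)%N) ->
  I[fun z => sine_sum N c z ^+ 2] = a * b / 4 * \sum_(p : 'I_N * 'I_N) c p.1 p.2 ^+ 2.
Proof.
move=> cP.
have S2 : L2r (leb2 R) QL (sine_sum N c) by exact: (continuous_L2 a0 b0 (@continuous_sine_sum N c)).
have E z : sine_sum N c z ^+ 2 =
    \sum_(p : 'I_N * 'I_N) c p.1 p.2 * (sine_sum N c z * sine p.1 p.2 z).
  rewrite expr2 {2}/sine_sum big_distrr /=.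
  by apply: eq_bigr => p _; rewrite mulrCA.
under eq_Rintegral do rewrite E.
rewrite Rintegral_sum//; last by move=> p _; exact: (integrableRZ mQ _ (iM _ _ S2)).
rewrite big_distrr /=; apply: eq_bigr => -[i j] _ /=.
rewrite (RintegralZl _ mQ); last exact: iM.
have [->|/cP/andP[i0 j0]] := eqVneq (c i j) 0; first by rewrite mul0r expr0n mulr0.
by rewrite Rintegral_sine_sum_sine// !ltn_ord /= expr2; ring.
Qed.

(** With the Fourier coefficients on the finite set [res], the difference F - sum is orthogonal to
    every mode, so completeness makes it zero; no convergence of series is involved. *)
Lemma sine_expansion F (res : nat -> nat -> bool) N : L2r (leb2 R) QL F ->
  (forall m n, res m n -> [&& (0 < m)%N, (0 < n)%N, (m < N)%N & (n < N)%N]) ->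
  (forall m n, (0 < m)%N -> (0 < n)%N -> ~~ res m n -> I[fun z => F z * sine m n z] = 0) ->
  exists2 c, (forall i j, c i j != 0 -> res i j) &
    {ae leb2 R, forall z : plane R, QL z -> F z = sine_sum N c z}.
Proof.
move=> F2 resP Fres.
pose c m n := if res m n then (a * b / 4)^-1 * I[fun z => F z * sine m n z] else 0.
have cres i j : c i j != 0 -> res i j by rewrite /c; case: ifP => //; rewrite eqxx.
exists c => //.
have S2 : L2r (leb2 R) QL (sine_sum N c) by exact: (continuous_L2 a0 b0 (@continuous_sine_sum N c)).
have ab0 : a * b / 4 != 0 by rewrite gt_eqF// divr_gt0// mulr_gt0.
have W2 := L2rB mQ F2 S2.
have orth m n : (0 < m)%N -> (0 < n)%N -> I[fun z => (F \- sine_sum N c) z *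
    (sin (m%:R * (pi / a * z.1)) * sin (n%:R * (pi / b * z.2)))] = 0.
  move=> m0 n0; transitivity (I[fun z => F z * sine m n z - sine_sum N c z * sine m n z]).
    by apply: eq_Rintegral => z _; rewrite /= mulrBl.
  rewrite (RintegralB mQ (iM m n F2) (iM m n S2)) Rintegral_sine_sum_sine//; last first.
    by move=> i j /cres/resP/and4P[-> ->].
  case resmn : (res m n); last first.
    by rewrite Fres ?resmn// /c resmn if_same mul0r subrr.
  have /and4P[_ _ -> ->] /= := resP _ _ resmn.
  by rewrite /c resmn mulrAC mulVf// mul1r subrr.
apply: filterS (sine_complete a0 b0 W2 orth) => z h Qz.
by apply/eqP; rewrite -subr_eq0; apply/eqP; exact: h.
Qed.

Lemma eigenspace_expansion (lambda : R[i]) u : Defs.eigenspace Q lambda u ->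
  exists N cr ci, [/\ forall i j, cr i j != 0 ->
      [&& (0 < i)%N, (0 < j)%N & freq i j == complex.Re lambda],
    forall i j, ci i j != 0 ->
      [&& (0 < i)%N, (0 < j)%N & freq i j == complex.Re lambda],
    {ae leb2 R, forall z : plane R, QL z -> complex.Re (u z) = sine_sum N cr z} &
    {ae leb2 R, forall z : plane R, QL z -> complex.Im (u z) = sine_sum N ci z}].
Proof.
move=> Eu; have [/(inL2P a b)[ur ui] _] : inL2 Q u /\ True.
  by case: Eu => _ [g1 [g2 [[]]]].
pose l := complex.Re lambda.
(* The comparison is with the complex number [lambda]: if it is not real, no mode is resonant and
   the sum is empty. *)
pose res (m n : nat) := [&& (0 < m)%N, (0 < n)%N & lambda == Complex (freq m n) 0].
(* A resonant m satisfies m <= m^2 <= lambda (a / pi)^2, and likewise n with b. *)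
pose N := Num.bound (`|l| * ((a / pi) ^+ 2 + (b / pi) ^+ 2)).
have p0 := @pi_gt0 R.
have Nbnd (e : R) (m : nat) : 0 < e -> (m%:R * (pi / e)) ^+ 2 <= l ->
    (e / pi) ^+ 2 <= (a / pi) ^+ 2 + (b / pi) ^+ 2 -> (m < N)%N.
  move=> e0 ml ee; rewrite -(ltr_nat R).
  apply: le_lt_trans (archi_boundP _); last by rewrite mulr_ge0// addr_ge0// sqr_ge0.
  apply: (@le_trans _ _ (l * (e / pi) ^+ 2)); last first.
    by rewrite ler_pM// ?sqr_ge0 ?ler_norm// (le_trans _ ml)// sqr_ge0.
  apply: (@le_trans _ _ (m%:R ^+ 2)).
    by rewrite -natrX ler_nat expnS expn1; case: m {ml} => // m; rewrite leq_pmull.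
  rewrite -ler_pdivrMr ?exprn_gt0 ?divr_gt0//; apply: le_trans ml.
  rewrite (_ : _ / _ = (m%:R * (pi / e)) ^+ 2)//.
  by rewrite [RHS]exprMn -[pi / e]invf_div [in RHS]exprVn.
have resP m n : res m n -> [&& (0 < m)%N, (0 < n)%N, (m < N)%N & (n < N)%N].
  case/and3P => -> -> /eqP le /=.
  have lE : l = freq m n by rewrite /l le.
  apply/andP; split.
    by apply: (Nbnd a) => //; rewrite ?lE ?lerDl ?sqr_ge0.
  by apply: (Nbnd b) => //; rewrite ?lE ?lerDr ?sqr_ge0.
have resE m n : res m n -> [&& (0 < m)%N, (0 < n)%N & freq m n == complex.Re lambda].
  by case/and3P => -> -> /eqP -> /=.
have coef m n : (0 < m)%N -> (0 < n)%N -> ~~ res m n ->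
    I[fun z => complex.Re (u z) * sine m n z] = 0 /\
    I[fun z => complex.Im (u z) * sine m n z] = 0.
  move=> m0 n0; rewrite /res m0 n0 /= => /eqP resN.
  have w0 (k : nat) (e : R) : (0 < k)%N -> 0 < e -> 0 < k%:R * (pi / e).
    by move=> k0 e0; rewrite mulr_gt0 ?ltr0n// divr_gt0.
  have sw (k : nat) (e : R) : 0 < e -> sin (k%:R * (pi / e) * e) = 0.
    by move=> e0; rewrite -mulrA divfK ?gt_eqF// sin_natpi.
  have [h1 h2] := eigen_coef a0 b0 (ltW (w0 _ _ m0 a0)) (ltW (w0 _ _ n0 b0))
    (sw m a a0) (sw n b b0) Eu resN.
  split; [rewrite -[RHS]h1|rewrite -[RHS]h2]; apply: eq_Rintegral => z _;
  by rewrite /sine !mulrA.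
have [cr crP crE] := sine_expansion ur resP (fun m n m0 n0 h => (coef m n m0 n0 h).1).
have [ci ciP ciE] := sine_expansion ui resP (fun m n m0 n0 h => (coef m n m0 n0 h).2).
exists N, cr, ci; split => //.
- by move=> i j /crP; exact: resE.
- by move=> i j /ciP; exact: resE.
Qed.

End sines.

(** * Distances between points on a circle *)

Section harmonic.
Context {R : realType}.

(** Each new term is at most the increment of the logarithm, by ln (1 + x) <= x at x = - 1 / (n +
    2). *)
Lemma sum_harmonic_le_ln (n : nat) :
  \sum_(1 <= j < n.+2) (j%:R^-1 : R) <= 1 + ln n.+1%:R.
Proof.
elim: n => [|n IH]; first by rewrite big_nat1 invr1 ln1 addr0.
rewrite big_nat_recr //=.
have n1 : 0 < n.+1%:R :> R by [].
have n2 : 0 < n.+2%:R :> R by [].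
suff : n.+2%:R^-1 <= ln n.+2%:R - ln n.+1%:R :> R 
  by move=> H; apply: (le_trans (lerD IH (lexx _))); rewrite -addrA lerD2l -lerBrDl.
have H : ln (n.+1%:R / n.+2%:R : R) <= n.+1%:R / n.+2%:R - 1.
  have := @le_ln1Dx R (n.+1%:R / n.+2%:R - 1); rewrite [1 + _]addrC subrK; apply.
  by rewrite ltrBrDr addNr divr_gt0.
rewrite lnM ?posrE ?invr_gt0// lnV ?posrE// in H.
have E : n.+1%:R / n.+2%:R - 1 = - n.+2%:R^-1 :> R.
  by rewrite -[n.+1%:R](addrK 1) natr1 mulrBl divff ?gt_eqF//; ring.
by move: H; rewrite E -[leLHS]opprB lerN2.
Qed.

End harmonic.

Section circle_points.
Context {R : realType}.
Variables (K : finType) (S : pred K) (x y : K -> R) (s : R).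
Hypothesis s1 : 1 <= s.
Hypothesis on_circle : forall k, S k -> x k ^+ 2 + y k ^+ 2 = (s ^+ 6) ^+ 2.

(** Squared distances keep everything polynomial. For the same reason the radius is written s^6: the
    near threshold r^(1/3) is s^2, hence s^4 for [dist2]. *)
Definition dist2 k l : R := (x k - x l) ^+ 2 + (y k - y l) ^+ 2.

Hypothesis triple : forall i j k, S i -> S j -> S k -> i != j -> j != k -> i != k ->
  4 * (s ^+ 6) ^+ 2 <= dist2 i j * dist2 j k * dist2 i k.

Lemma dist2_ge0 k l : 0 <= dist2 k l.
Proof. by rewrite addr_ge0 ?sqr_ge0. Qed.

Lemma dist2C k l : dist2 k l = dist2 l k.
Proof. by rewrite /dist2; ring. Qed.

(** If both j and k were within s^2 of i, then [dist2 j k] < 4 s^4 and the product of the three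
    squared distances would be below 4 s^12, against [triple]. *)
Lemma near_unique i j k : S i -> S j -> S k -> i != j -> i != k ->
  dist2 i j < s ^+ 4 -> dist2 i k < s ^+ 4 -> j = k.
Proof.
move=> Si Sj Sk ij ik dij dik; apply/eqP/contraT => jk.
have T := triple Si Sj Sk ij jk ik.
have J : dist2 j k <= 2 * (dist2 i j + dist2 i k).
  rewrite -subr_ge0 (_ : _ - _ = (2 * x i - x j - x k) ^+ 2 + (2 * y i - y j - y k) ^+ 2).
    by rewrite addr_ge0 ?sqr_ge0.
  by rewrite /dist2; ring.
have i0 := dist2_ge0 i j; have k0 := dist2_ge0 i k; have jk0 := dist2_ge0 j k.
have e0 : 0 < s ^+ 4 by rewrite exprn_gt0// (lt_le_trans _ s1).
have E : (s ^+ 6) ^+ 2 = (s ^+ 4) ^+ 3 by rewrite -!exprM.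
rewrite E in T; move: i0 k0 jk0 dij dik J T.
set e := s ^+ 4 in e0 *; set u := dist2 i j; set v := dist2 i k; set w := dist2 j k.
move=> u0 v0 w0 ue ve wuv T.
have w4 : w < 4 * e by apply: (le_lt_trans wuv); clear -ue ve; lra.
have uv : u * v <= e * e by apply: ler_pM => //; exact: ltW.
have : u * w * v < 4 * e ^+ 3.
  rewrite mulrAC (_ : 4 * e ^+ 3 = (e * e) * (4 * e)); last by ring.
  apply: (@le_lt_trans _ _ (e * e * w)); first by rewrite ler_wpM2r.
  by rewrite ltr_pM2l// mulr_gt0.
by rewrite ltNge T.
Qed.

(** The circle is cut into arcs according to the dominating coordinate: X is that coordinate and T,
    the other one, parametrises the arc. The bit tells whether X is the abscissa. *)
Let T (b : bool) l := if b then y l else x l.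
Let X (b : bool) l := if b then x l else y l.
Let arc l := `|y l| <= `|x l|.

Let arcP l : `|T (arc l) l| <= `|X (arc l) l|.
Proof. by rewrite /T /X; case E : (arc l) => //; rewrite ltW// ltNge; exact/negbT. Qed.

Let dist2E b k l : dist2 k l = (T b k - T b l) ^+ 2 + (X b k - X b l) ^+ 2.
Proof. by rewrite /dist2 /T /X; case: b => //; exact: addrC. Qed.

Let TX b k : S k -> T b k ^+ 2 + X b k ^+ 2 = (s ^+ 6) ^+ 2.
Proof. by move=> /on_circle <-; rewrite /T /X; case: b => //; exact: addrC. Qed.

(* On an arc where X dominates, X is a 1-Lipschitz function of T. *)
Let arc_lip b k l : S k -> S l -> arc k = b -> arc l = b -> (0 <= X b k) = (0 <= X b l) ->
  dist2 k l <= 2 * (T b k - T b l) ^+ 2.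
Proof.
move=> Sk Sl bk bl sg; rewrite (dist2E b).
have := TX b Sk; have := TX b Sl; have := arcP k; have := arcP l; rewrite bk bl.
set t := T b k; set u := T b l; set p := X b k in sg *; set q := X b l in sg *.
move=> uq tp uq2 tp2.
have r0 : 0 < s ^+ 6 by rewrite exprn_gt0// (lt_le_trans _ s1).
have E : (p - q) * (p + q) = (u - t) * (u + t) by lra.
have pq0 : 0 < `|p + q|.
  rewrite normr_gt0; apply/eqP => pq; move: sg.
  have [p0|p0] := lerP 0 p => /esym.
    move=> q0; have p1 : p = 0 by lra.
    have t1 : t = 0 by move: tp; rewrite p1 normr0 normr_le0 => /eqP.
    by move: tp2; rewrite p1 t1 !expr0n/= addr0 => /esym/eqP; rewrite sqrf_eq0 gt_eqF.
  by move/negbT; rewrite -ltNge; lra.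
have npq : `|u + t| <= `|p + q|.
  apply: (le_trans (ler_normD _ _)); apply: (le_trans (lerD uq tp)).
  move: sg; have [p0|p0] := lerP 0 p => /esym.
    by move=> q0; rewrite !ger0_norm ?addr_ge0//; lra.
  by move/negbT; rewrite -ltNge => q0; rewrite !ltr0_norm//; lra.
have L : `|p - q| <= `|t - u|.
  rewrite -(ler_pM2r pq0) -normrM E normrM distrC.
  by rewrite ler_wpM2l.
have : (p - q) ^+ 2 <= (t - u) ^+ 2 by rewrite -[leLHS]real_normK ?num_real// -[leRHS]real_normK ?num_real// lerXn2r ?nnegrE.
by lra.
Qed.

(* The largest convenient bin width: three points in a bin would violate [triple] as
   8 (w^3 / 4)^2 < 4 (s^6)^2. *)
Let w := 7 / 5 * s ^+ 2.

Let s0 : 0 < s. Proof. exact: lt_le_trans s1. Qed.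
Let w0 : 0 < w. Proof. by rewrite mulr_gt0 ?exprn_gt0. Qed.

(** On one arc and one side a squared distance is at most twice the squared difference in T, and the
    gaps of three numbers in an interval of length w have product at most w^3 / 4 by the
    arithmetic-geometric inequality; this contradicts [triple]. *)
Let bin_three b i j k : S i -> S j -> S k -> i != j -> j != k -> i != k ->
  arc i = b -> arc j = b -> arc k = b ->
  (0 <= X b i) = (0 <= X b j) -> (0 <= X b j) = (0 <= X b k) ->
  `|T b i - T b j| < w -> `|T b j - T b k| < w -> `|T b i - T b k| < w -> False.
Proof.
move=> Si Sj Sk ij jk ik bi bj bk sij sjk.
have H := triple Si Sj Sk ij jk ik.
have := arc_lip Si Sj bi bj sij; have := arc_lip Sj Sk bj bk sjk.
have := arc_lip Si Sk bi bk (etrans sij sjk).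
have := dist2_ge0 i j; have := dist2_ge0 j k; have := dist2_ge0 i k.
move: H; set A := dist2 i j; set B := dist2 j k; set C := dist2 i k.
set t := T b i; set u := T b j; set v := T b k.
move=> H C0 B0 A0 Cb Bb Ab tu uv tv.
have P : A * B * C <= 8 * ((t - u) * (u - v) * (t - v)) ^+ 2.
  apply: (@le_trans _ _ ((2 * (t - u) ^+ 2) * (2 * (u - v) ^+ 2) * (2 * (t - v) ^+ 2))).
    by do 2 (rewrite ler_pM ?mulr_ge0//).
  by rewrite le_eqVlt; apply/orP; left; apply/eqP; ring.
have Q : 16 * ((t - u) * (u - v) * (t - v)) ^+ 2 <= (w ^+ 3) ^+ 2.
  (* Among p, q and p + q, the one of largest modulus is up to sign the sum of the moduli of the
     other two; the cases below reduce to two nonnegative numbers c and d. *)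
  have gen (p q : R) : `|p| < w -> `|q| < w -> `|p + q| < w ->
      16 * (p * q * (p + q)) ^+ 2 <= (w ^+ 3) ^+ 2.
    wlog q0 : p q / 0 <= q.
      move=> W pw qw pqw; have [|/ltW q0] := lerP 0 q; first by move=> q0; exact: W.
      have := W (- p) (- q); rewrite -opprD !normrN oppr_ge0 => /(_ q0 pw qw pqw).
      by apply: le_trans; rewrite le_eqVlt; apply/orP; left; apply/eqP; ring.
    have small (c d : R) : 0 <= c -> 0 <= d -> c + d < w -> 16 * (c * d * (c + d)) ^+ 2 <= (w ^+ 3) ^+ 2.
      move=> c0 d0 cd.
      rewrite (_ : 16 * _ = (4 * (c * d) * (c + d)) ^+ 2); last by ring.
      have wge0 := ltW w0; have cd0 := addr_ge0 c0 d0.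
      suff H4 : 4 * (c * d) * (c + d) <= w ^+ 3.
        by apply: lerXn2r => //; rewrite nnegrE ?exprn_ge0// !mulr_ge0.
      rewrite exprSr; apply: ler_pM => //; [by rewrite !mulr_ge0| |exact: ltW].
      apply: (@le_trans _ _ ((c + d) ^+ 2)); last by apply: lerXn2r; rewrite ?nnegrE//; exact: ltW.
      by rewrite -subr_ge0 (_ : _ - _ = (c - d) ^+ 2) ?sqr_ge0//; ring.
    move=> /ltr_normlP[p1 p2] /ltr_normlP[q1 q2] /ltr_normlP[pq1 pq2].
    have [p0|p0] := lerP 0 p; first exact: small.
    have [pq0|pq0] := lerP 0 (p + q).
      rewrite (_ : p * q * _ = - ((p + q) * - p * (p + q + - p))); last by ring.
      by rewrite sqrrN; apply: small => //; lra.
    rewrite (_ : p * q * _ = q * (- (p + q)) * (q + - (p + q))); last by ring.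
    by apply: small; lra.
  have := gen (t - u) (u - v) tu uv; rewrite (_ : t - u + (u - v) = t - v); last by ring.
  exact.
have r0 : 0 < (s ^+ 6) ^+ 2 by rewrite !exprn_gt0.
have W : (w ^+ 3) ^+ 2 = (7 / 5) ^+ 6 * (s ^+ 6) ^+ 2 by rewrite /w; ring.
have W' : (w ^+ 3) ^+ 2 < 8 * (s ^+ 6) ^+ 2.
  have c2 : (7 / 5 : R) ^+ 2 < 2 by lra.
  have -> : 8 = 2 ^+ 3 :> R by ring.
  by rewrite W ltr_pM2r// (exprM _ 2 3); apply: ltrXn2r; rewrite ?nnegrE ?exprn_ge0.
by lra.
Qed.

(** Points are binned by their offset from k in T. By [bin_three] each bin of each arc holds at most
    two points, and bin j >= 1 is at distance at least j w, so a harmonic sum of length O (s^4)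
    remains, with weight O (s^(-2)); its logarithm is absorbed by ln s <= s - 1. *)
Lemma far_sum k : S k ->
  \sum_(l | S l && (s ^+ 4 <= dist2 k l)) (Num.sqrt (dist2 k l))^-1 <= 46 / s.
Proof.
move=> Sk.
pose J := Num.truncn (2 * s ^+ 6 / w).
pose tt l : R := `|T (arc l) l - T (arc l) k|.
pose bin l : nat := Num.truncn (tt l / w).
have Tr b l : S l -> `|T b l| <= s ^+ 6.
  move=> Sl; rewrite -ler_sqr ?nnegrE ?exprn_ge0 ?(ltW s0)// real_normK ?num_real//.
  by rewrite -(TX b Sl) lerDl sqr_ge0.
have tt0 l : 0 <= tt l / w by rewrite divr_ge0 ?normr_ge0 ?(ltW w0).
have binJ l : S l -> (bin l < J.+1)%N.
  move=> Sl; rewrite ltnS; apply: le_truncn; rewrite ler_pM2r ?invr_gt0//.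
  apply: (le_trans (ler_normB _ _)); rewrite mulr_natl mulr2n.
  by apply: lerD; exact: Tr.
(* [bin] measures an unsigned offset, so a third bit records the side of k; then points with one
   label lie in one interval of length w. *)
pose lab l : bool * bool * bool * 'I_J.+1 :=
  (arc l, 0 <= X (arc l) l, T (arc l) k <= T (arc l) l, inord (bin l)).
(* Bin 0 gives no lower bound through T; there the distance is at least s^2 because only far points
   are summed. *)
pose wt (j : nat) : R := if j is 0 then (s ^+ 2)^-1 else (j%:R * w)^-1.
have wt0 j : 0 <= wt j.
  by case: j => [|j]; rewrite invr_ge0 ?exprn_ge0 ?(ltW s0)// mulr_ge0 ?(ltW w0).
have dwt l : S l -> s ^+ 4 <= dist2 k l -> (Num.sqrt (dist2 k l))^-1 <= wt (bin l).
  move=> Sl dl; have d0 : 0 < dist2 k l by rewrite (lt_le_trans _ dl)// exprn_gt0.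
  rewrite /wt; case E : (bin l) => [|j].
    rewrite lef_pV2 ?posrE ?sqrtr_gt0 ?exprn_gt0//.
    rewrite -[leLHS]ger0_norm ?exprn_ge0 ?(ltW s0)// -sqrtr_sqr ler_wsqrtr//.
    by rewrite -exprM.
  have jw : j.+1%:R * w <= tt l.
    by have /andP[+ _] := truncn_itv (tt0 l); rewrite -/(bin l) E ler_pdivlMr.
  rewrite lef_pV2 ?posrE ?sqrtr_gt0 ?mulr_gt0//; apply: (le_trans jw).
  rewrite /tt -sqrtr_sqr ler_wsqrtr// dist2C (dist2E (arc l)).
  by rewrite lerDl sqr_ge0.
have binw l : tt l < (bin l).+1%:R * w.
  by have /andP[_] := truncn_itv (tt0 l); rewrite ltr_pdivrMr.
have binw' l : (bin l)%:R * w <= tt l.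
  by have /andP[+ _] := truncn_itv (tt0 l); rewrite ler_pdivlMr.
have lab_close l l' : S l -> S l' -> lab l = lab l' ->
    [/\ arc l' = arc l, (0 <= X (arc l) l) = (0 <= X (arc l) l') &
        `|T (arc l) l - T (arc l) l'| < w].
  move=> Sl Sl' [e1 e2 e3 e4].
  have {}e4 : bin l = bin l'.
    by have := congr1 (@nat_of_ord _) e4; rewrite !inordK ?binJ.
  rewrite -e1 in e2 e3; split => //.
  have := binw l; have := binw l'; have := binw' l; have := binw' l'.
  rewrite -e4 /tt -e1 -natr1; move: e3; set A := T _ l; set B := T _ l'; set C := T _ k.
  set n : R := (bin l)%:R.
  case: (lerP C A) => [CA|CA] /esym.
    move=> CB; rewrite (ger0_norm (x := B - C)) ?subr_ge0// => h1 h2 h3 h4.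
    by rewrite ltr_norml; apply/andP; split; lra.
  move/negbT; rewrite -ltNge => CB.
  rewrite (ltr0_norm (x := B - C)) ?subr_lt0// => h1 h2 h3 h4.
  by rewrite ltr_norml; apply/andP; split; lra.
pose far l := S l && (s ^+ 4 <= dist2 k l).
have fiber c : \sum_(l | far l && (lab l == c)) (Num.sqrt (dist2 k l))^-1 <= 2 * wt c.2.
  apply: (@le_trans _ _ (\sum_(l | far l && (lab l == c)) wt c.2)).
    apply: ler_sum => l /andP[/andP[Sl dl] /eqP lc].
    by rewrite -lc /= inordK ?binJ//; exact: dwt.
  rewrite sumr_const -[leLHS]mulr_natl ler_wpM2r// ler_nat leqNgt; apply/card_gt2P.
  move=> [l1 [l2 [l3 [[]]]]]; rewrite !unfold_in.
  move=> /andP[/andP[S1 _] /eqP c1] /andP[/andP[S2 _] /eqP c2] /andP[/andP[S3 _] /eqP c3].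
  move=> [n12 n23 n31].
  have [a12 x12 t12] := lab_close _ _ S1 S2 (etrans c1 (esym c2)).
  have [a13 x13 t13] := lab_close _ _ S1 S3 (etrans c1 (esym c3)).
  have [a23 x23 t23] := lab_close _ _ S2 S3 (etrans c2 (esym c3)).
  rewrite a12 in x23 t23.
  by apply: (@bin_three (arc l1) l1 l2 l3) => //; rewrite eq_sym.
rewrite (partition_big lab xpredT)//=.
apply: (le_trans (ler_sum _ (fun c _ => fiber c))).
(* At most 2 points for each of the 8 combinations of bits. *)
have -> : \sum_(c : bool * bool * bool * 'I_J.+1) 2 * wt c.2 = 16 * \sum_(j < J.+1) wt j.
  rewrite -(pair_big xpredT xpredT (fun (b : bool * bool * bool) (j : 'I_J.+1) => 2 * wt j)) /=.
  rewrite sumr_const !card_prod card_bool -big_distrr /= -mulrnAl.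
  by rewrite -mulr_natr; congr (_ * _); ring.
have HJ : \sum_(j < J.+1) wt j <= (s ^+ 2)^-1 + w^-1 * (1 + ln (2 * s ^+ 6 / w)).
  rewrite big_ord_recl /=; apply: lerD => //.
  have J0 : (0 < J)%N.
    rewrite truncn_gt0 ler_pdivlMr// mul1r /w.
    have s2 : 1 <= s ^+ 2 by rewrite exprn_ege1.
    have s4 : 1 <= s ^+ 4 by rewrite exprn_ege1.
    have -> : s ^+ 6 = s ^+ 4 * s ^+ 2 by rewrite -exprD.
    nra.
  under eq_bigr do rewrite /bump /= invfM mulrC.
  rewrite -big_distrr /= ler_wpM2l ?invr_ge0 ?(ltW w0)//.
  have -> : \sum_(i < J) (1 + i)%:R^-1 = \sum_(1 <= j < J.-1.+2) j%:R^-1 :> R.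
    by rewrite prednK// big_add1 big_mkord; apply: eq_bigr => i _; rewrite add1n.
  apply: (le_trans (sum_harmonic_le_ln _)); rewrite prednK// lerD2l ler_ln ?posrE ?ltr0n//.
    by rewrite truncn_le// divr_ge0 ?(ltW w0)// mulr_ge0// exprn_ge0 ?(ltW s0).
  by rewrite divr_gt0 ?mulr_gt0 ?exprn_gt0.
apply: (@le_trans _ _ (16 * ((s ^+ 2)^-1 + w^-1 * (1 + ln (2 * s ^+ 6 / w))))).
  by rewrite ler_wpM2l.
have -> : 2 * s ^+ 6 / w = 10 / 7 * s ^+ 4.
  by rewrite /w; field; rewrite gt_eqF.
rewrite lnM ?posrE ?exprn_gt0 ?divr_gt0// lnXn//.
have l1 : ln (10 / 7 : R) <= 3 / 7.
  by rewrite (_ : 10 / 7 = 1 + 3 / 7); [apply: le_ln1Dx; lra|field].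
have l2 : ln s <= s - 1.
  by have := @le_ln1Dx R (s - 1); rewrite [1 + _]addrC subrK; apply; rewrite ltrBrDr addNr.
have -> : w^-1 = 5 / 7 * (s ^+ 2)^-1 by rewrite /w; field; rewrite gt_eqF.
have -> : 46 / s = (s ^+ 2)^-1 * (46 * s) by field; rewrite gt_eqF.
(* With w = 7/5 s^2 the coefficient of s is 16 * 5/7 * 4 = 320/7 < 46, and the constant term is
   negative. *)
set i2 := (s ^+ 2)^-1; set L := ln (10 / 7) + _.
rewrite (_ : 16 * _ = i2 * (16 * (1 + 5 / 7 * (1 + L)))); last by ring.
rewrite ler_wpM2l ?invr_ge0 ?exprn_ge0 ?(ltW s0)//.
have : L <= 3 / 7 + (s - 1) * 4 
  by rewrite /L -[ln s *+ 4]mulr_natr; apply: lerD => //; rewrite ler_wpM2r.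
by move: s1; move: L => L; lra.
Qed.

(** Diagonal dominance: the product d k * d l is at most (d k ^+ 2 + d l ^+ 2) / 2 in modulus, and a
    row of the majorant B contains [S1] at most once, by [near_unique], while its far part is
    controlled by [far_sum]. *)
Lemma near_far_form_ge (A : K -> K -> R) (d : K -> R) (D0 S1 P1 : R) : 0 <= S1 -> 0 <= P1 ->
  (forall k, ~~ S k -> d k = 0) -> (forall k, A k k = D0) ->
  (forall k l, S k -> S l -> k != l -> `|A k l| <= S1) ->
  (forall k l, S k -> S l -> k != l -> `|A k l| <= P1 / Num.sqrt (dist2 k l)) ->
  (D0 - S1 - P1 * (46 / s)) * \sum_k d k ^+ 2 <= \sum_k \sum_l d k * d l * A k l.
Proof.
move=> S10 P10 dS AD AS AP.
pose B k l : R := if dist2 k l < s ^+ 4 then S1 else P1 / Num.sqrt (dist2 k l).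
have BC k l : B k l = B l k by rewrite /B dist2C.
have B0 k l : 0 <= B k l by rewrite /B; case: ifP => // _; rewrite divr_ge0.
have row k : S k -> \sum_(l | S l && (l != k)) B k l <= S1 + P1 * (46 / s).
  move=> Sk; rewrite (bigID (fun l => dist2 k l < s ^+ 4)) /=; apply: lerD.
    pose near := [pred l | S l && (l != k) && (dist2 k l < s ^+ 4)].
    rewrite (eq_bigr (fun=> S1)); last by move=> l /andP[_ h]; rewrite /B h.
    rewrite (sumr_const near) -mulr_natl -[leRHS]mul1r ler_wpM2r// (ler_nat _ _ 1).
    apply/card_le1_eqP => i j; rewrite !inE => /andP[/andP[Si ik] di] /andP[/andP[Sj jk] dj].
    by apply: (@near_unique k j i) => //; rewrite eq_sym.
  have := ler_wpM2l P10 (far_sum Sk); apply: le_trans.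
  rewrite big_distrr /=.
  rewrite [leRHS](bigID (fun l => l != k)) /= -[leLHS]addr0; apply: lerD; last first.
    by apply: sumr_ge0 => l _; rewrite mulr_ge0.
  rewrite le_eqVlt; apply/orP; left; apply/eqP; apply: eq_big => l.
    by rewrite -leNgt andbAC.
  by move=> /andP[_ h]; rewrite /B (negbTE h).
pose Od k := \sum_(l | S l && (l != k)) (d k ^+ 2 + d l ^+ 2) / 2 * B k l.
have E1 : \sum_k \sum_l d k * d l * A k l = \sum_(k | S k) \sum_(l | S l) d k * d l * A k l.
  rewrite (bigID S) /= [X in _ + X]big1 ?addr0; last first.
    by move=> k Sk; rewrite big1// => l _; rewrite dS// !mul0r.
  apply: eq_bigr => k _; rewrite (bigID S) /= [X in _ + X]big1 ?addr0//.
  by move=> l Sl; rewrite (dS l)// mulr0 mul0r.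
have E2 : \sum_k d k ^+ 2 = \sum_(k | S k) d k ^+ 2.
  rewrite (bigID S) /= [X in _ + X]big1 ?addr0// => k Sk.
  by rewrite dS// expr0n.
have low k : S k -> d k ^+ 2 * D0 - Od k <= \sum_(l | S l) d k * d l * A k l.
  move=> Sk; rewrite (bigD1 k)//= AD -expr2 lerD2l /Od -sumrN.
  apply: ler_sum => l /andP[Sl lk]; rewrite eq_sym in lk.
  have AB : `|A k l| <= B k l by rewrite /B; case: ifP => _; [exact: AS|exact: AP].
  rewrite lerNl -mulNr; apply: (le_trans (ler_norm _)); rewrite normrM normrN.
  apply: ler_pM => //; rewrite ler_norml.
  have := sqr_ge0 (d k + d l); have := sqr_ge0 (d k - d l).
  by move=> h1 h2; apply/andP; split; lra.
have OdE : \sum_(k | S k) Od k = \sum_(k | S k) d k ^+ 2 * \sum_(l | S l && (l != k)) B k l.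
  have H k : Od k = \sum_(l | S l && (l != k)) d k ^+ 2 / 2 * B k l +
      \sum_(l | S l && (l != k)) d l ^+ 2 / 2 * B k l.
    by rewrite -big_split; apply: eq_bigr => l _ /=; rewrite mulrDl mulrDl.
  under eq_bigr do rewrite H; rewrite big_split /=.
  (* Symmetry of B turns the column sums into row sums. *)
  have -> : \sum_(k | S k) \sum_(l | S l && (l != k)) d l ^+ 2 / 2 * B k l =
      \sum_(k | S k) \sum_(l | S l && (l != k)) d k ^+ 2 / 2 * B k l.
    rewrite (exchange_big_dep S) /=; last by move=> k l _ /andP[].
    apply: eq_bigr => k Sk; apply: eq_big => l; last by rewrite BC.
    by rewrite Sk /= eq_sym.
  rewrite -big_split /=; apply: eq_bigr => k _; rewrite -big_split big_distrr /=.
  by apply: eq_bigr => l _; field.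
rewrite E1 E2; apply: le_trans (ler_sum _ low).
rewrite sumrB OdE -big_distrl /= -subr_ge0.
have -> : forall p q t u v : R, p * q - u - (q - v - t) * p = (v + t) * p - u by move=> *; ring.
rewrite subr_ge0 mulrC big_distrl /=; apply: ler_sum => k Sk.
by rewrite ler_wpM2l ?sqr_ge0//; exact: row.
Qed.

End circle_points.

(** * Triangles in a lattice *)

Section lattice.
Context {R : realType}.

(* The squared form of abc = 4 R Delta for a triangle with circumradius R; twice the area
   of a lattice triangle is a nonzero integer multiple of the covolume, here 1. *)
Lemma lattice_triangle (c1 c2 r2 : R) (p q : 'I_3 -> int) : c1 * c2 = 1 -> r2 != 0 ->
  let d i j := (c1 * (p i)%:~R - c1 * (p j)%:~R) ^+ 2 + (c2 * (q i)%:~R - c2 * (q j)%:~R) ^+ 2 in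
  (forall i, (c1 * (p i)%:~R) ^+ 2 + (c2 * (q i)%:~R) ^+ 2 = r2) ->
  d 0 1 * d 1 2 * d 0 2 != 0 -> 4 * r2 <= d 0 1 * d 1 2 * d 0 2.
Proof.
move=> c12 r20 d circ d0.
pose D : int := (p 1 - p 0) * (q 2 - q 0) - (p 2 - p 0) * (q 1 - q 0).
have gen (x0 y0 x1 y1 x2 y2 : R) : x0 ^+ 2 + y0 ^+ 2 = r2 -> x1 ^+ 2 + y1 ^+ 2 = r2 ->
    x2 ^+ 2 + y2 ^+ 2 = r2 ->
    ((x0 - x1) ^+ 2 + (y0 - y1) ^+ 2) * ((x1 - x2) ^+ 2 + (y1 - y2) ^+ 2) *
      ((x0 - x2) ^+ 2 + (y0 - y2) ^+ 2) =
    4 * r2 * ((x1 - x0) * (y2 - y0) - (x2 - x0) * (y1 - y0)) ^+ 2.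
  move=> h0 h1 h2.
  pose g01 := x0 * x1 + y0 * y1 - r2; pose g12 := x1 * x2 + y1 * y2 - r2.
  pose g02 := x0 * x2 + y0 * y2 - r2.
  have e01 : (x0 - x1) ^+ 2 + (y0 - y1) ^+ 2 = - 2 * g01 by rewrite /g01; lra.
  have e12 : (x1 - x2) ^+ 2 + (y1 - y2) ^+ 2 = - 2 * g12 by rewrite /g12; lra.
  have e02 : (x0 - x2) ^+ 2 + (y0 - y2) ^+ 2 = - 2 * g02 by rewrite /g02; lra.
  pose g00 := x0 * x0 + y0 * y0 - r2; pose g11 := x1 * x1 + y1 * y1 - r2.
  pose g22 := x2 * x2 + y2 * y2 - r2.
  have z0 : g00 = 0 by rewrite /g00; lra.
  have z1 : g11 = 0 by rewrite /g11; lra.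
  have z2 : g22 = 0 by rewrite /g22; lra.
  (* The determinant of the Gram matrix of the vectors (x_i, y_i, r) for the form with signature (+,
     +, -): it is - r^2 times the square of twice the oriented area. On the circle its diagonal
     vanishes and the squared distances are - 2 g_ij. *)
  have det : 2 * g01 * g12 * g02 + g00 * g11 * g22 - g00 * g12 ^+ 2 - g11 * g02 ^+ 2 - g22 * g01 ^+ 2
      = - r2 * ((x1 - x0) * (y2 - y0) - (x2 - x0) * (y1 - y0)) ^+ 2.
    by rewrite /g00 /g11 /g22 /g01 /g12 /g02; ring.
  rewrite e01 e12 e02; move: det; rewrite z0 z1 z2 => det; lra.
have P : d 0 1 * d 1 2 * d 0 2 = 4 * r2 * (D%:~R) ^+ 2.
  rewrite /d (gen _ _ _ _ _ _ (circ 0) (circ 1) (circ 2)) /D; congr (_ * _ ^+ 2).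
  rewrite !(rmorphB, rmorphM) /=.
  by rewrite -[RHS]mul1r -c12; ring.
have r2_gt0 : 0 < r2 by rewrite lt_neqAle eq_sym r20 -(circ 0) addr_ge0 ?sqr_ge0.
rewrite P ler_peMr ?mulr_ge0 ?(ltW r2_gt0)//.
have D0 : D != 0 by apply: contraNN d0 => /eqP D0; rewrite P D0 expr0n mulr0.
rewrite -rmorphXn /= (ler1z R) -gtz0_ge1.
by rewrite lt_neqAle eq_sym sqrf_eq0 D0 sqr_ge0.
Qed.

End lattice.

Lemma le_Rintegral_subset d (X : measurableType d) (R : realType)
    (m : {measure set X -> \bar R}) (A B : set X) (f : X -> R) :
  measurable A -> measurable B -> A `<=` B -> m.-integrable B (EFin \o f) ->
  (forall x, B x -> 0 <= f x) ->
  \int[m]_(x in A) f x <= \int[m]_(x in B) f x.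
Proof.
move=> mA mB AB fB f0; have fA : m.-integrable A (EFin \o f) by exact: integrableS fB.
apply: fine_le; [exact: integrable_fin_num|exact: integrable_fin_num|].
apply: ge0_subset_integral => //; exact: (measurable_int m).
Qed.

(** * Integrals of periodic functions over the torus *)

Section antiderivative.
Context {R : realType}.
Local Notation mu := (@lebesgue_measure R).
Variable g : R -> R.
Hypothesis cg : continuous g.

Let ig (u v : R) : mu.-integrable `[u, v] (EFin \o g).
Proof.
apply: continuous_compact_integrable; first exact: segment_compact.
exact: continuous_subspaceT.
Qed.

Let H (n : nat) (x : R) : R := \int[mu]_(t in `[- n%:R, x]) g t.

Let H_split m n (x : R) : (n <= m)%N -> - n%:R <= x -> H m x - H m (- n%:R) = H n x.
Proof.
move=> nm nx; rewrite /H Rintegral_itvB ?bnd_simp//; last by rewrite lerN2 ler_nat.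
rewrite Rintegral_itv_obnd_cbnd//.
by apply: integrableS (ig (- n%:R) x) => //; apply: subset_itvr; rewrite bnd_simp.
Qed.

(** The base point of the integral must lie to the left of x and so depends on it; subtracting the
    value at 0 makes its choice immaterial. *)
Let G (x : R) : R := H (Num.bound `|x|) x - H (Num.bound `|x|) 0.

Let boundP (x : R) : - (Num.bound `|x|)%:R <= x.
Proof.
rewrite lerNl (le_trans (ler_norm _))// normrN ltW//.
exact: archi_boundP.
Qed.

Let GE n (x : R) : - n%:R <= x -> G x = H n x - H n 0.
Proof.
have n0 (m : nat) : - m%:R <= 0 :> R by rewrite oppr_le0.
have E m l : (l <= m)%N -> - l%:R <= x -> H m x - H m 0 = H l x - H l 0.
  by move=> lm lx; rewrite -(H_split lm lx) -(H_split lm (n0 l)); ring.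
rewrite /G; case: (leqP n (Num.bound `|x|)) => [nb nx|/ltnW bn _]; first exact: E.
by apply/esym/E.
Qed.

Lemma antiderivative : exists F : R -> R, forall x, is_derive x (1 : R) F (g x).
Proof.
exists G => x0.
pose n := Num.bound (`|x0| + 1).
have nx : - n%:R < x0.
  have : `|x0| + 1 < n%:R by apply: archi_boundP; rewrite addr_ge0.
  by have := lerNnormlW (lexx `|x0|); lra.
have x1 : x0 < x0 + 1 by rewrite ltrDl.
have [dH HE] := continuous_FTC1_closed x1 (ig _ _) nx (@cg x0).
have D : is_derive x0 (1 : R) (fun x => H n x - H n 0) (g x0).
  have D1 : is_derive x0 (1 : R) (H n) (g x0).
    exact (DeriveDef dH (etrans (esym (derive1E _ _)) HE)).
  refine (is_derive_eq (is_deriveDf D1 (is_derive_cst (- H n 0) x0 (1 : R))) _).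
  by rewrite addr0.
apply: (near_eq_is_derive _ D); near=> x.
by rewrite (@GE n)//; apply: ltW; near: x; exact: lt_nbhsr.
Unshelve. all: by end_near. Qed.

End antiderivative.

Section periodic_wave.
Context {R : realType}.
Local Notation mu := (@lebesgue_measure R).
Variables (g G : R -> R) (M : R).
Hypotheses (cg : continuous g) (gM : forall x, `|g x| <= M).
Hypothesis dG : forall x, is_derive x (1 : R) G (g x).
Hypothesis per : forall x, g (x + pi *+ 2) = g x.

Definition period_integral := G pi - G (- pi).
Local Notation I := period_integral.

Lemma period_shift x : G (x + pi *+ 2) - G x = I.
Proof.
have D y : is_derive y (1 : R) (fun y => G (1 * y + pi *+ 2) + (-1 : R) * G y) 0.
  have D1 : is_derive y (1 : R) (fun y => G (1 * y + pi *+ 2)) (1 * g (1 * y + pi *+ 2)).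
    exact: is_derive_affine.
  refine (is_derive_eq (is_deriveDf D1 (is_deriveMf (is_derive_cst (-1 : R) y (1 : R)) (dG y))) _).
  by rewrite /cst !mul1r per mul0r add0r mulN1r subrr.
have := is_derive_0_is_cst x (- pi) D; rewrite !mul1r !mulN1r => ->.
by rewrite /I; congr (G _ - _); rewrite mulr2n; ring.
Qed.

Lemma period_shiftn (n : nat) x : G (x + n%:R * (pi *+ 2)) = G x + n%:R * I.
Proof.
elim: n x => [|n IH] x; first by rewrite !mul0r !addr0.
rewrite -natr1 !mulrDl !mul1r addrA -(subrK (G (x + n%:R * (pi *+ 2))) (G _)) period_shift IH.
by ring.
Qed.

Lemma period_shiftz (n : int) x : G (x + n%:~R * (pi *+ 2)) = G x + n%:~R * I.
Proof.
case: (intP n) => [|m|m]; first by rewrite !mul0r !addr0.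
  exact: period_shiftn.
have := period_shiftn m.+1 (x + (- m.+1%:Z)%:~R * (pi *+ 2)).
rewrite -addrA -mulrDl (_ : (- m.+1%:Z)%:~R = - m.+1%:R); last by rewrite mulrNz.
by rewrite addNr mul0r addr0 => ->; ring.
Qed.

(** The interval contains |p| full periods and the substitution divides by p, so the result depends
    neither on p nor on the phase s. *)
Lemma Rintegral_wave1 (l s : R) (p : int) : 0 < l -> p != 0 ->
  \int[mu]_(x in `]- l, l[) g (p%:~R * (pi / l) * x + s) = l / pi * I.
Proof.
move=> l0 p0; have pi0 := @pi_gt0 R; pose k : R := p%:~R * (pi / l).
have k0 : k != 0 by rewrite /k mulf_neq0 ?intr_eq0// mulf_neq0// ?invr_eq0 gt_eqF.
have cf : continuous (fun x => g (k * x + s)).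
  move=> x; apply: continuous_comp; last exact: cg.
  by apply: cvgD; [apply: cvgM; [exact: cvg_cst|exact: cvg_id]|exact: cvg_cst].
have dF x : is_derive x (1 : R) (fun x => k^-1 * G (k * x + s)) (g (k * x + s)).
  have D1 : is_derive x (1 : R) (fun y => G (k * y + s)) (k * g (k * x + s)).
    exact: is_derive_affine.
  refine (is_derive_eq (is_deriveMf (is_derive_cst k^-1 x (1 : R)) D1) _).
  by rewrite /cst mul0r add0r mulrA mulVf// mul1r.
have ll : - l < l by rewrite gtrN.
rewrite (Rintegral_FTC ll cf dF).
have kl : k * l = p%:~R * pi by rewrite /k -mulrA divfK// gt_eqF.
have -> : k * l + s = k * - l + s + p%:~R * (pi *+ 2) by rewrite mulrN kl mulr2n; ring.
rewrite period_shiftz -mulrBr [_ + _ * I]addrC addrK.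
have H (P L Z J : R) : P != 0 -> L != 0 -> Z != 0 -> (Z * (P / L))^-1 * (Z * J) = L / P * J.
  by move=> h1 h2 h3; field; rewrite h1 h2 h3.
have pN : pi != 0 :> R by rewrite gt_eqF.
have lN : l != 0 by rewrite gt_eqF.
have zN : p%:~R != 0 :> R by rewrite intr_eq0.
exact: H pN lN zN.
Qed.

Variables (a b : R).
Hypotheses (a0 : 0 < a) (b0 : 0 < b).

Lemma torus_cellE : torus_cell a b = `]- a, a[%classic `*` `]- b, b[%classic.
Proof. by apply/seteqP; split=> -[x y]; rewrite /torus_cell/= !in_itv/=. Qed.

Lemma leb_itvN (l : R) : 0 < l -> mu `]- l, l[%classic = (2 * l)%:E.
Proof.
move=> l0; rewrite lebesgue_measure_itv /= lte_fin.
rewrite ifT; last by lra.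
rewrite -EFinD.
by congr EFin; ring.
Qed.

(** The inner integration runs over a variable with nonzero frequency; its result is constant in the
    other variable. *)
Lemma Rintegral_torus_wave (s : R) (p q : int) : (p != 0) || (q != 0) ->
  \int[leb2 R]_(z in (torus_cell a b : set (plane R)))
    g (p%:~R * (pi / a) * z.1 + q%:~R * (pi / b) * z.2 + s) = 2 * a * b / pi * I.
Proof.
move=> pq; rewrite torus_cellE.
pose f (z : R * R) := g (p%:~R * (pi / a) * z.1 + q%:~R * (pi / b) * z.2 + s).
have cf : continuous f.
  move=> z; apply: continuous_comp; last exact: cg.
  apply: cvgD; last exact: cvg_cst.
  by apply: cvgD; (apply: cvgM; first exact: cvg_cst); [exact: cvg_fst|exact: cvg_snd].
have mI (l : R) : measurable (`]- l, l[%classic : set (measurableTypeR R)) by [].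
have Ioo (l : R) : 0 < l -> (mu `](- l)%R, l[%classic < +oo)%E by move=> l0; rewrite leb_itvN// ltry.
have fM z : (`]- a, a[%classic `*` `]- b, b[%classic) z -> `|f z| <= M by move=> _; exact: gM.
have [q0|q0] := eqVneq q 0.
  have {}pq : p != 0 by move: pq; rewrite q0 orbF.
  rewrite (Rintegral_fubini2 (mI a) (mI b) (Ioo a a0) (Ioo b b0) (continuous_measurable2 cf) fM).
  transitivity (\int[mu]_(y in `]- b, b[) (a / pi * I)).
    apply: eq_Rintegral => y _; rewrite -(Rintegral_wave1 (q%:~R * (pi / b) * y + s) a0 pq).
    by apply: eq_Rintegral => x _; rewrite /f /= addrA.
  rewrite Rintegral_cst//.
  transitivity (a / pi * I * (2 * b)); last by ring.
  congr (_ * _); exact: (congr1 fine (leb_itvN b0)).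
rewrite (Rintegral_fubini1 (mI a) (mI b) (Ioo a a0) (Ioo b b0) (continuous_measurable2 cf) fM).
transitivity (\int[mu]_(x in `]- a, a[) (b / pi * I)).
  apply: eq_Rintegral => x _; rewrite -(Rintegral_wave1 (p%:~R * (pi / a) * x + s) b0 q0).
  by apply: eq_Rintegral => y _; rewrite /f /=; congr g; ring.
rewrite Rintegral_cst//.
transitivity (b / pi * I * (2 * a)); last by ring.
congr (_ * _); exact: (congr1 fine (leb_itvN a0)).
Qed.

End periodic_wave.

(** * The bathtub principle for the cosine *)

Section bathtub.
Context {R : realType}.
Local Notation mu := (@lebesgue_measure R).
Variable t : R.
Hypothesis t_itv : 0 < t < pi.

(** The Lagrangian form of the bathtub principle: cos is at most cos t plus this positive part, with
    equality on the superlevel set of cos t. *)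
Definition cos_excess (x : R) : R := Num.max (cos x - cos t) 0.

Lemma cos_excess_ge0 x : 0 <= cos_excess x.
Proof. by rewrite /cos_excess le_max lexx orbT. Qed.

Lemma continuous_cos_excess : continuous cos_excess.
Proof.
move=> x; apply: (@continuous_max R R (fun x => cos x - cos t) (fun=> 0)); last exact: cvg_cst.
by apply: cvgB; [exact: continuous_cos|exact: cvg_cst].
Qed.

Lemma cos_excess_le x : `|cos_excess x| <= 2.
Proof.
rewrite ger0_norm ?cos_excess_ge0// /cos_excess ge_max ler0n andbT.
by have := cos_le1 x; have := cos_geN1 t; lra.
Qed.

Lemma cos_excess_periodic x : cos_excess (x + pi *+ 2) = cos_excess x.
Proof. by rewrite /cos_excess cosD2pi. Qed.

(** The period is started at - t: the excess is cos - cos t up to t and zero from t to 2 pi - t. *)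
Lemma period_integral_cos_excess G : (forall x, is_derive x (1 : R) G (cos_excess x)) ->
  period_integral G = 2 * (sin t - cos t * t).
Proof.
move=> dG; have /andP[t0 tpi] := t_itv; have pi0 := @pi_gt0 R.
have cE := continuous_cos_excess.
have cos_ge u : 0 <= u <= pi -> u <= t -> cos t <= cos u.
  by move=> /andP[u0 upi] ut; rewrite leNgt ltr_cos -?leNgt// in_itv/= ?u0 ?upi ?(ltW t0) ?(ltW tpi).
have cos_le u : 0 <= u <= pi -> t <= u -> cos u <= cos t.
  by move=> /andP[u0 upi] ut; rewrite leNgt ltr_cos -?leNgt// in_itv/= ?u0 ?upi ?(ltW t0) ?(ltW tpi).
have E1 : G t - G (- t) = 2 * (sin t - cos t * t).
  have tt : - t < t by lra.
  rewrite -(Rintegral_FTC tt cE dG).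
  have cf : continuous (fun x => cos x - cos t).
    by move=> x; apply: cvgB; [exact: continuous_cos|exact: cvg_cst].
  have dF x : is_derive x (1 : R) (fun x => sin x + (- cos t) * x) (cos x - cos t).
    refine (is_derive_eq (is_deriveDf (is_derive_sin x)
      (is_deriveMf (is_derive_cst (- cos t) x (1 : R)) (is_derive_id _ _))) _).
    by rewrite /cst mul0r add0r mulr1.
  transitivity (\int[mu]_(x in `]- t, t[) (cos x - cos t)); last first.
    by rewrite (Rintegral_FTC tt cf dF) sinN; ring.
  apply: eq_Rintegral => x; rewrite inE/= in_itv/= => /andP[x1 x2].
  apply: max_l; rewrite subr_ge0 -[cos x]cos_norm; apply: cos_ge.
    by rewrite normr_ge0 ler_norml; apply/andP; split; lra.
  by rewrite ler_norml; apply/andP; split; lra.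
have E2 : G (- t + pi *+ 2) - G t = 0.
  have tt : t < - t + pi *+ 2 by rewrite mulr2n; lra.
  rewrite -(Rintegral_FTC tt cE dG).
  transitivity (\int[mu]_(x in `]t, (- t + pi *+ 2)[) (0 : R)); last first.
    by rewrite Rintegral_cst// mul0r.
  apply: eq_Rintegral => x; rewrite inE/= in_itv/= mulr2n => /andP[x1 x2].
  apply: max_r; rewrite subr_le0; have [xpi|xpi] := lerP x pi.
    by apply: cos_le; [apply/andP; split|]; lra.
  have -> : cos x = cos (pi *+ 2 - x).
    by rewrite addrC cosD2pi cosN.
  by apply: cos_le; rewrite mulr2n; [apply/andP; split|]; lra.
rewrite -(period_shift dG cos_excess_periodic (- t)).
by rewrite -(subrK (G t) (G (- t + _))) E2 add0r E1.
Qed.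

End bathtub.

(** * Fourier coefficients of the reflected set *)

Section reflected_wave.
Context {R : realType}.
Variables (a b : R).
Hypotheses (a0 : 0 < a) (b0 : 0 < b).
Local Notation T := (torus_cell a b : set (plane R)).
Variable W : set (plane R).
Hypotheses (mW : measurable W) (WT : W `<=` T).

Definition wave (p q : int) (s : R) (z : R * R) : R :=
  cos (p%:~R * (pi / a) * z.1 + q%:~R * (pi / b) * z.2 + s).

Lemma leb2_torus_cell : leb2 R T = (4 * (a * b))%:E.
Proof.
have mI (l : R) : measurable (`]- l, l[%classic : set (measurableTypeR R)) by [].
rewrite torus_cellE leb2_borelE; last exact: measurableX.
rewrite (borel_leb2_box (mI a) (mI b)).
have E (c : R) : 0 < c -> (@lebesgue_measure R `](- c)%R, c[%classic = (2 * c)%:E)%E.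
  exact: leb_itvN.
rewrite (E _ a0) (E _ b0) -EFinM; congr EFin; ring.
Qed.

Lemma plane_measurable_torus_cell : measurable T.
Proof.
rewrite torus_cellE; apply: borel_plane_measurable.
by apply: measurableX.
Qed.

Local Opaque leb2 Rintegral.

Lemma continuous_phase (k l s : R) : continuous (fun z : R * R => k * z.1 + l * z.2 + s).
Proof.
move=> z; apply: cvgD; last exact: cvg_cst.
by apply: cvgD; (apply: cvgM; first exact: cvg_cst); [exact: cvg_fst|exact: cvg_snd].
Qed.

Lemma continuous_wave p q s : continuous (wave p q s).
Proof.
move=> z; apply: continuous_comp; last exact: continuous_cos.
exact: continuous_phase.
Qed.

Let Woo : (leb2 R W < +oo)%E.
Proof.
apply: le_lt_trans (_ : (leb2 R T < +oo)%E); last by rewrite leb2_torus_cell ltry.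
by apply: le_leb2.
Qed.

Lemma bounded_continuous_integrable (D : set (plane R)) (f : R * R -> R) (M : R) :
  measurable D -> (leb2 R D < +oo)%E -> continuous f -> (forall z, `|f z| <= M) ->
  (leb2 R).-integrable D (EFin \o f).
Proof.
move=> mD Doo cf fM; apply: (bounded_integrable (M := M) mD Doo).
  have mf := borel_plane_measurable_fun measurableT (continuous_measurable2 cf).
  exact (measurable_funS measurableT (@subsetT _ D) mf).
by move=> z _.
Qed.

Lemma integrable_wave p q s : (leb2 R).-integrable W (EFin \o wave p q s).
Proof.
apply: (bounded_continuous_integrable mW Woo (@continuous_wave p q s) (M := 1)) => z.
exact: cos_max.
Qed.

Lemma wave_le_bathtub p q s : (p != 0) || (q != 0) ->
  0 < fine (leb2 R W) < 4 * (a * b) ->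
  \int[leb2 R]_(z in W) wave p q s z <=
    4 * (a * b) * sin (pi * (fine (leb2 R W) / (4 * (a * b)))) / pi.
Proof.
move=> pq /andP[W0 W1]; have pi0 := @pi_gt0 R.
have ab0 : 0 < 4 * (a * b) by rewrite mulr_gt0 ?mulr_gt0.
(* With this threshold the superlevel set has the same measure as W, and the terms with cos t
   cancel. *)
pose t := pi * (fine (leb2 R W) / (4 * (a * b))).
have t_itv : 0 < t < pi.
  by rewrite /t mulr_gt0 ?divr_gt0//= gtr_pMr// ltr_pdivrMr// mul1r.
have [G dG] := antiderivative (@continuous_cos_excess R t).
pose E z := cos_excess t (p%:~R * (pi / a) * z.1 + q%:~R * (pi / b) * z.2 + s).
have cE : continuous E.
  move=> z; have h1 := @continuous_phase (p%:~R * (pi / a)) (q%:~R * (pi / b)) s z.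
  exact (continuous_comp h1 (@continuous_cos_excess R t _)).
have Too : (leb2 R T < +oo)%E by rewrite leb2_torus_cell ltry.
have mT := plane_measurable_torus_cell.
have EM z : `|E z| <= 2 by exact: cos_excess_le.
have iET := bounded_continuous_integrable mT Too cE EM.
have iEW := bounded_continuous_integrable mW Woo cE EM.
have iw := integrable_wave p q s.
have ic := integrableR_cst mW Woo (cos t).
have iC := integrableRB mW iw ic.
have H1 : \int[leb2 R]_(z in W) wave p q s z =
    \int[leb2 R]_(z in W) (wave p q s z - cos t) + cos t * fine (leb2 R W).
  by rewrite (RintegralB mW iw ic) (Rintegral_cst (leb2 R) mW (cos t)) subrK.
have H2 : \int[leb2 R]_(z in W) (wave p q s z - cos t) <= \int[leb2 R]_(z in W) E z.
  apply: (le_Rintegral mW iC iEW) => z _.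
  by rewrite /E /cos_excess le_max lexx.
have H3 : \int[leb2 R]_(z in W) E z <= \int[leb2 R]_(z in T) E z.
  exact (le_Rintegral_subset mW mT WT iET (fun z _ => cos_excess_ge0 t _)).
have H4 := Rintegral_torus_wave (@continuous_cos_excess R t) (@cos_excess_le R t) dG
  (@cos_excess_periodic R t) a0 b0 s pq.
rewrite (period_integral_cos_excess t_itv dG) in H4.
rewrite H1; apply: (le_trans (lerD (le_trans H2 H3) (lexx _))).
rewrite {}H4 -/t.
have -> : fine (leb2 R W) = 4 * (a * b) * t / pi.
  rewrite /t mulrCA [pi * _]mulrC mulfK ?gt_eqF// mulrC divfK// gt_eqF//.
by rewrite -subr_ge0 (_ : _ - _ = 0)//; ring.
Qed.

(** The lower bound is the upper bound for the phase pi, which changes the sign of the wave. *)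
Lemma norm_wave_le_bathtub p q : (p != 0) || (q != 0) ->
  0 < fine (leb2 R W) < 4 * (a * b) ->
  `|\int[leb2 R]_(z in W) wave p q 0 z| <=
    4 * (a * b) * sin (pi * (fine (leb2 R W) / (4 * (a * b)))) / pi.
Proof.
move=> pq W01; rewrite ler_norml; apply/andP; split; last exact: wave_le_bathtub.
have := wave_le_bathtub pi pq W01.
have -> : \int[leb2 R]_(z in W) wave p q pi z = - \int[leb2 R]_(z in W) wave p q 0 z.
  rewrite -mulN1r -(RintegralZl _ mW (integrable_wave p q 0)).
  by apply: eq_Rintegral => z _; rewrite /wave cosDpi addr0 mulN1r.
by rewrite lerNl.
Qed.

Lemma cosD2piz (n : int) (x : R) : cos (x + n%:~R * (pi *+ 2)) = cos x.
Proof.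
have H (m : nat) y : cos (y + m%:R * (pi *+ 2)) = cos y :> R.
  by rewrite mulr_natl periodicn//; exact: cosD2pi.
case: (intP n) => [|m|m]; first by rewrite mul0r addr0.
  exact: H.
rewrite -(H m.+1 (x + _)) -addrA -mulrDl (_ : (- m.+1%:Z)%:~R = - m.+1%:R) ?mulrNz//.
by rewrite addNr mul0r addr0.
Qed.

(** The competitor in the variation is the field along (k, l) / n of amplitude cos (phase - pi / 2),
    where n is the length of (k, l): it has length at most 1, and its divergence is n times the
    wave. The sign e gives the modulus. *)
Lemma norm_wave_le_perimeter p q : (p != 0) || (q != 0) ->
  (torus_perimeter a b W < +oo)%E ->
  Num.sqrt ((p%:~R * (pi / a)) ^+ 2 + (q%:~R * (pi / b)) ^+ 2) *
  `|\int[leb2 R]_(z in W) wave p q 0 z| <= fine (torus_perimeter a b W).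
Proof.
move=> pq Poo; have pi0 := @pi_gt0 R.
set k := p%:~R * (pi / a); set l := q%:~R * (pi / b).
set n := Num.sqrt (k ^+ 2 + l ^+ 2).
have n2 : n ^+ 2 = k ^+ 2 + l ^+ 2 by rewrite sqr_sqrtr// addr_ge0 ?sqr_ge0.
have n0 : 0 < n.
  rewrite sqrtr_gt0 lt_neqAle eq_sym addr_ge0 ?sqr_ge0// andbT paddr_eq0 ?sqr_ge0//.
  rewrite !sqrf_eq0 /k /l negb_and; case/orP: pq => h; apply/orP; [left|right];
  by rewrite mulf_neq0 ?intr_eq0// mulf_neq0 ?invr_eq0 ?gt_eqF.
have iw := integrable_wave p q 0.
have key (e : R) : e ^+ 2 = 1 ->
    ((n * (e * \int[leb2 R]_(z in W) wave p q 0 z))%:E <= torus_perimeter a b W)%E.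
  move=> e2; apply: ereal_sup_ubound => /=.
  pose f (c : R) (z : R * R) := e * c / n * cos (k * z.1 + l * z.2 + - (pi / 2)).
  exists (f k), (f l); split.
  - by split; exact: smooth_cos_wave.
  - have ka : k * (2 * a) = p%:~R * (pi *+ 2).
      rewrite /k mulr2n -[p%:~R * _ * _]mulrA; congr (_ * _).
      by rewrite mulrCA divfK ?gt_eqF//; ring.
    have lb : l * (2 * b) = q%:~R * (pi *+ 2).
      rewrite /l mulr2n -[q%:~R * _ * _]mulrA; congr (_ * _).
      by rewrite mulrCA divfK ?gt_eqF//; ring.
    have P1 c z : f c (z.1 + 2 * a, z.2) = f c z.
      rewrite /f /=; congr (_ * _); rewrite -[in RHS](cosD2piz p) -ka.
      by congr cos; ring.
    have P2 c z : f c (z.1, z.2 + 2 * b) = f c z.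
      rewrite /f /=; congr (_ * _); rewrite -[in RHS](cosD2piz q) -lb.
      by congr cos; ring.
    by split=> z; split; rewrite ?P1 ?P2.
  - move=> z; rewrite /f; set C := cos _.
    have -> : (e * k / n * C) ^+ 2 + (e * l / n * C) ^+ 2 = C ^+ 2.
      have -> : (e * k / n * C) ^+ 2 + (e * l / n * C) ^+ 2 =
          e ^+ 2 * (k ^+ 2 + l ^+ 2) / n ^+ 2 * C ^+ 2.
        have gen (e' k' l' m C' : R) : (e' * k' * m * C') ^+ 2 + (e' * l' * m * C') ^+ 2 =
            e' ^+ 2 * (k' ^+ 2 + l' ^+ 2) * m ^+ 2 * C' ^+ 2 by ring.
        by rewrite gen exprVn.
      by rewrite e2 -n2 mul1r divff ?mul1r// sqrf_eq0 gt_eqF.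
    by rewrite sqrtr_sqr; exact: cos_max.
  - congr EFin; rewrite mulrA -(RintegralZl _ mW iw).
    rewrite -[in LHS](setIidr WT) Rintegral_mkcondr.
    apply: eq_Rintegral => z _; rewrite patchE indicE.
    have D1 : pd1 (f k) z = e * k / n * k * cos (k * z.1 + l * z.2 + (- (pi / 2) + pi / 2)).
      by have [_ <-] := is_derive_cos_wave1 (e * k / n) k l (- (pi / 2)) z.
    have D2 : pd2 (f l) z = e * l / n * l * cos (k * z.1 + l * z.2 + (- (pi / 2) + pi / 2)).
      by have [_ <-] := is_derive_cos_wave2 (e * l / n) k l (- (pi / 2)) z.
    case: ifPn => zW; last by rewrite mul0r.
    rewrite mul1r D1 D2 addNr /wave -/k -/l -mulrDl; congr (_ * _).
    have -> : e * k / n * k + e * l / n * l = e * (k ^+ 2 + l ^+ 2) / n by ring.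
    by rewrite -n2 expr2 mulrA mulfK ?gt_eqF// mulrC.
have Pfin : torus_perimeter a b W \is a fin_num.
  rewrite fin_numE; apply/andP; split; last by rewrite lt_eqF.
  by rewrite gt_eqF// (lt_le_trans _ (key 1 (expr1n _ _)))// ltNyr.
have H e : e ^+ 2 = 1 -> n * (e * \int[leb2 R]_(z in W) wave p q 0 z) <= fine (torus_perimeter a b W).
  by move=> e2; rewrite -lee_fin fineK//; exact: key.
have H1 := H 1 (expr1n _ _); have H2 := H (-1) (sqrr_sign _ 1).
rewrite -(ger0_norm (ltW n0)) -normrM ler_norml lerNl -mulrN.
by apply/andP; split; [rewrite mulN1r in H2|rewrite mul1r in H1].
Qed.

End reflected_wave.

(** * Numerical constants *)

Section constants.
Context {R : realType}.

(** For u = pi / 6 the triple angle formula reads 1 - sin (3 u) = (S + 1) (2 S - 1)^2 with S = sin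
    u, so S = 1/2, and sin u <= u. *)
Lemma pi_ge3 : 3 <= pi :> R.
Proof.
pose u : R := pi / 6; pose S := sin u.
have pi0 := @pi_gt0 R; have pi4 : pi < 4 :> R by have := @pihalf_lt2 R; lra.
have u0 : 0 < u < pi / 2 by apply/andP; split; rewrite /u; lra.
have S0 : 0 < S by exact: sin_gt0_pihalf.
have E : (S + 1) * (2 * S - 1) ^+ 2 = 0.
  have := sin_pihalf R; have -> : pi / 2 = u + (u + u) by rewrite /u; field.
  rewrite sinD sinD cosD -/S; set C := cos u => h.
  have CS : C ^+ 2 + S ^+ 2 = 1 by exact: cos2Dsin2.
  have -> : (S + 1) * (2 * S - 1) ^+ 2 =
      1 - (S * (C * C - S * S) + C * (S * C + C * S)) + 3 * S * (C ^+ 2 + S ^+ 2 - 1) by ring.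
  by rewrite h CS; ring.
have : S = 1 / 2.
  move/eqP: E; rewrite mulf_eq0 sqrf_eq0 => /orP[/eqP h|/eqP h]; first by move: S0; lra.
  by lra.
move=> SE; have := norm_sin_le u; rewrite -/S SE.
have /andP[u0' _] := u0; rewrite !ger0_norm ?(ltW u0')// /u; lra.
Qed.

(** Strictness comes from sin x = 2 sin y cos y with y = x / 2 and cos y < 1; it yields [eta] >
    0. *)
Lemma sin_lt_pos (x : R) : 0 < x < pi -> sin x < x.
Proof.
move=> /andP[x0 xpi]; pose y := x / 2.
have y0 : 0 < y < pi / 2 by apply/andP; split; rewrite /y; lra.
have /andP[y1 y2] := y0.
have Sy := sin_gt0_pihalf y0.
have Cy : cos y < 1.
  by rewrite -(@cos0 R) ltr_cos ?in_itv//= ?lexx ?pi_ge0 ?(ltW y1)//=; have := @pi_gt0 R; lra.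
have Ly : sin y <= y by have := norm_sin_le y; rewrite !ger0_norm ?(ltW y1)// ltW.
have -> : x = y + y by rewrite /y; field.
by rewrite sinD; nra.
Qed.

(** With A = pi 2^(1/3), [C0] is 2 A (1 + 4 A^(1/4)), and A >= 15/4, A^(1/4) >= 4/3 give 47.5. The
    value 46 is the constant of [far_sum]. *)
Lemma C0_ge46 : 46 <= C0 R.
Proof.
have root (n : nat) (u v : R) : 0 <= u -> u ^+ n.+1 <= v -> u <= v `^ (n.+1%:R^-1).
  move=> u0 uv; have v0 : 0 <= v by rewrite (le_trans _ uv)// exprn_ge0.
  have E : u = (u ^+ n.+1) `^ (n.+1%:R^-1).
    by rewrite -powR_mulrn// -powRrM mulfV ?pnatr_eq0// powRr1.
  by rewrite [leLHS]E ge0_ler_powR// nnegrE exprn_ge0.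
have h2 : 5 / 4 <= 2 `^ (3^-1) :> R by apply: (root 2); lra.
have h3 : 15 / 4 <= pi * 2 `^ (3^-1) :> R by have := pi_ge3; nra.
have h4 : 4 / 3 <= (pi * 2 `^ (3^-1)) `^ (4^-1) :> R.
  by apply: (root 3); [lra|apply: le_trans h3; lra].
rewrite /C0 -[2 * pi * _]mulrA; move: h3 h4; set A := pi * _; set B := A `^ _.
by move=> h3 h4; nra.
Qed.

End constants.

(** * High frequencies *)

(** Positivity excludes the coincidence of 0 and - 0, so the signed copies of a mode have distinct
    frequencies. *)
Lemma signed_nat_inj (s t : bool) (i j : nat) : (0 < i)%N -> (0 < j)%N ->
  (-1) ^+ s * i%:Z = (-1) ^+ t * j%:Z -> s = t /\ i = j.
Proof.
case: s; case: t; rewrite ?expr0 ?expr1 ?mul1r ?mulN1r => i0 j0 E.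
- by split => //; apply/eqP; rewrite -eqz_nat -eqr_opp E.
- by move: E i0; case: i => // i; case: j {j0}.
- by move: E j0; case: j => // j; case: i {i0}.
- by split => //; apply/eqP; rewrite -eqz_nat E.
Qed.

Section high_frequency.
Context {R : realType}.
Variables (a b : R) (V : set (R * R)).
Hypotheses (a0 : 0 < a) (b0 : 0 < b) (VQ : V `<=` rectangle a b).
Local Notation Q := (rectangle a b).
Local Notation QL := (Q : set (plane R)).
Local Notation VL := (V : set (plane R)).
Hypotheses (mV : measurable VL) (P_oo : (reflected_perimeter a b V < +oo)%E).
Hypotheses (V_gt0 : 0 < area V) (V_lt : area V < area Q).

Let W : set (plane R) := reflected_extension a b V.
Let WT : W `<=` torus_cell a b. Proof. by move=> z []. Qed.

Let alpha := density a b V.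

Let areaQ : area Q = a * b.
Proof. by rewrite /area leb2_rectangle. Qed.

Let ab0 : 0 < a * b. Proof. exact: mulr_gt0. Qed.

Let areaV : area V = a * b * alpha.
Proof. by rewrite /alpha /density areaQ mulrC divfK// gt_eqF. Qed.

Lemma density_itv : 0 < alpha < 1.
Proof.
by rewrite /alpha /density divr_gt0//= ?areaQ// ltr_pdivrMr// mul1r -areaQ.
Qed.

Lemma eta_gt0 : 0 < Defs.eta alpha.
Proof.
have /andP[al0 al1] := density_itv; have pi0 := @pi_gt0 R.
have pa : 0 < pi * alpha by rewrite mulr_gt0.
have -> : Defs.eta alpha = 1 - sin (pi * alpha) / (pi * alpha) by [].
rewrite subr_gt0 ltr_pdivrMr// mul1r; apply: sin_lt_pos.
by rewrite pa /= gtr_pMr.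
Qed.

Local Opaque leb2 Rintegral.

Let Voo : (leb2 R VL < +oo)%E.
Proof. exact: le_lt_trans (le_leb2 VQ) (leb2_rectangle_lty a0 b0). Qed.

Lemma reflected_measurable : measurable W.
Proof.
have [] := @Rintegral_reflected R a b V (fun=> 1) VQ mV (integrableR_cst mV Voo 1)
  (fun=> erefl) (fun=> erefl); exact.
Qed.

Lemma area_reflected : fine (leb2 R W) = 4 * (a * b) * alpha.
Proof.
have [mW _] := @Rintegral_reflected R a b V (fun=> 1) VQ mV (integrableR_cst mV Voo 1)
  (fun=> erefl) (fun=> erefl).
rewrite (Rintegral_cst (leb2 R) mW 1) (Rintegral_cst (leb2 R) mV 1) !mul1r => ->.
have -> : fine (leb2 R VL) = a * b * alpha by exact: areaV.
by ring.
Qed.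

Variables (N : nat) (c : nat -> nat -> R) (l : R).
Hypothesis cP : forall i j, c i j != 0 -> [&& (0 < i)%N, (0 < j)%N & freq a b i j == l].
Hypothesis l_gt : lambda_star a b V < l.

Local Notation v := (sine_sum a b N c).

(** Each mode (i, j) contributes the four frequencies with signs (+-i, +-j). *)
Let K : finType := (bool * bool * ('I_N * 'I_N))%type.
Let sg (s : bool) : int := (-1) ^+ s.
Let pz (k : K) : int := sg k.1.1 * (k.2.1 : nat)%:Z.
Let qz (k : K) : int := sg k.1.2 * (k.2.2 : nat)%:Z.
(** From sin A sin B = - 1/4 times the sum of e f cos (e A + f B) over the signs e and f. *)
Let d (k : K) : R := - (sg k.1.1 * sg k.1.2)%:~R * c k.2.1 k.2.2 / 4.
Let S : pred K := fun k => c k.2.1 k.2.2 != 0.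

Let sumK (G : K -> R) : \sum_k G k = \sum_(p : 'I_N * 'I_N)
  (G (true, true, p) + G (true, false, p) + (G (false, true, p) + G (false, false, p))).
Proof.
transitivity (\sum_(st : bool * bool) \sum_(p : 'I_N * 'I_N) G (st, p)).
  by rewrite pair_bigA; apply: eq_bigr => -[].
rewrite exchange_big; apply: eq_bigr => p _.
transitivity (\sum_(s : bool) \sum_(t : bool) G (s, t, p)).
  by rewrite pair_bigA; apply: eq_bigr => -[].
by rewrite !big_bool.
Qed.

Let phase (k : K) (z : R * R) : R := (pz k)%:~R * (pi / a) * z.1 + (qz k)%:~R * (pi / b) * z.2.

Let pzE k : (pz k)%:~R = (-1) ^+ k.1.1 * (k.2.1 : nat)%:R :> R.
Proof. by rewrite /pz /sg rmorphM rmorphXn rmorphN1. Qed.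

Let qzE k : (qz k)%:~R = (-1) ^+ k.1.2 * (k.2.2 : nat)%:R :> R.
Proof. by rewrite /qz /sg rmorphM rmorphXn rmorphN1. Qed.

Let dE k : d k = - ((-1) ^+ k.1.1 * (-1) ^+ k.1.2) * c k.2.1 k.2.2 / 4.
Proof. by rewrite /d /sg rmorphM !rmorphXn !rmorphN1. Qed.

Let phaseE k z : phase k z =
  (-1) ^+ k.1.1 * ((k.2.1 : nat)%:R * (pi / a * z.1)) +
  (-1) ^+ k.1.2 * ((k.2.2 : nat)%:R * (pi / b * z.2)).
Proof. by rewrite /phase pzE qzE !mulrA. Qed.

Let v_cos z : v z = \sum_k d k * cos (phase k z).
Proof.
rewrite sumK; apply: eq_bigr => -[i j] _.
rewrite !phaseE !dE /sine /= !expr0 !expr1; set A := _ * (_ * z.1); set B := _ * (_ * z.2).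
by rewrite !mul1r !mulN1r !cosD !cosN !sinN; field.
Qed.

Let v_sin z : \sum_k d k * sin (phase k z) = 0.
Proof.
rewrite sumK big1// => -[i j] _.
rewrite !phaseE !dE /= !expr0 !expr1; set A := _ * (_ * z.1); set B := _ * (_ * z.2).
by rewrite !mul1r !mulN1r !sinD !cosN !sinN; field.
Qed.

Let A k m : R := \int[leb2 R]_(z in W) wave a b (pz k - pz m) (qz k - qz m) 0 z.

(* The sine sum of phases vanishes by symmetry, so the square only sees the differences of
   frequencies. *)
Let sqr_v z : v z ^+ 2 = \sum_k \sum_m d k * d m * wave a b (pz k - pz m) (qz k - qz m) 0 z.
Proof.
transitivity ((\sum_k d k * cos (phase k z)) * (\sum_k d k * cos (phase k z)) +
    (\sum_k d k * sin (phase k z)) * (\sum_k d k * sin (phase k z))).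
  by rewrite v_sin mul0r addr0 v_cos expr2.
rewrite !big_distrlr /= -big_split; apply: eq_bigr => k _.
rewrite -big_split; apply: eq_bigr => m _ /=.
have -> : wave a b (pz k - pz m) (qz k - qz m) 0 z = cos (phase k z - phase m z).
  by rewrite /wave /phase !rmorphB /=; congr cos; ring.
by rewrite cosB; ring.
Qed.

Let Rintegral_W_sqr_v : \int[leb2 R]_(z in W) v z ^+ 2 = \sum_k \sum_m d k * d m * A k m.
Proof.
have mW := reflected_measurable.
have iw k m := integrableRZ mW (d k * d m)
  (integrable_wave a0 b0 mW WT (pz k - pz m) (qz k - qz m) 0).
transitivity (\int[leb2 R]_(z in W)
    \sum_k \sum_m d k * d m * wave a b (pz k - pz m) (qz k - qz m) 0 z).
  by apply: eq_Rintegral => z _; exact: sqr_v.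
rewrite (@Rintegral_sum _ _ R (leb2 R) W _ _ _ _ mW); last by move=> k _; apply: (@integrableR_sum _ _ R (leb2 R) W _ _ _ _ mW) => m _; exact: iw.
apply: eq_bigr => k _; rewrite (@Rintegral_sum _ _ R (leb2 R) W _ _ _ _ mW); last by move=> m _; exact: iw.
apply: eq_bigr => m _; apply: (RintegralZl _ mW).
exact: integrable_wave.
Qed.

Let Rintegral_W_V : \int[leb2 R]_(z in W) v z ^+ 2 = 4 * \int[leb2 R]_(z in VL) v z ^+ 2.
Proof.
have cv : continuous (fun z => v z ^+ 2).
  rewrite (_ : (fun z => v z ^+ 2) = (fun z => v z * v z)).
    exact: continuous2M (@continuous_sine_sum R a b N c) (@continuous_sine_sum R a b N c).
  by apply/funext => z; rewrite expr2.
have mQ := plane_measurable_rectangle a b.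
have iQ := continuous2_integrable a0 b0 cv.
have iV : (leb2 R).-integrable VL (EFin \o (fun z => v z ^+ 2)).
  exact: (integrableS mQ mV VQ iQ).
have s1 (n : nat) (k x : R) : sin (n%:R * (k * - x)) = - sin (n%:R * (k * x)).
  by rewrite !mulrN sinN.
have f1 z : v (flip1 z) ^+ 2 = v z ^+ 2.
  rewrite -[in RHS]sqrrN; congr (_ ^+ 2); rewrite /sine_sum -sumrN; apply: eq_bigr => p _.
  by rewrite /sine /flip1 /= s1; ring.
have f2 z : v (flip2 z) ^+ 2 = v z ^+ 2.
  rewrite -[in RHS]sqrrN; congr (_ ^+ 2); rewrite /sine_sum -sumrN; apply: eq_bigr => p _.
  by rewrite /sine /flip2 /= s1; ring.
by have [] := Rintegral_reflected VQ mV iV f1 f2.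
Qed.

Let sum_sqr_d : \sum_k d k ^+ 2 = 4^-1 * \sum_(p : 'I_N * 'I_N) c p.1 p.2 ^+ 2.
Proof.
rewrite sumK big_distrr; apply: eq_bigr => -[i j] _.
by rewrite !dE /= !expr0 !expr1; field.
Qed.

Let signed_inj (s t : bool) (i j : nat) : (0 < i)%N -> (0 < j)%N ->
  sg s * i%:Z = sg t * j%:Z -> s = t /\ i = j.
Proof. exact: signed_nat_inj. Qed.

Let pq_neq k m : S k -> S m -> k != m -> (pz k - pz m != 0) || (qz k - qz m != 0).
Proof.
move: k m => [[s t] [i j]] [[s' t'] [i' j']] /cP/and3P[/= i0 j0 _] /cP/and3P[/= i0' j0' _].
apply: contraNT; rewrite negb_or !negbK !subr_eq0 => /andP[/eqP p /eqP q].
have [-> ii] := @signed_inj s s' i i' i0 i0' p; have [-> jj] := @signed_inj t t' j j' j0 j0' q.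
by rewrite (val_inj ii) (val_inj jj).
Qed.

Let c1 := Num.sqrt (b / a).
Let c2 := Num.sqrt (a / b).
Let px k : R := c1 * (pz k)%:~R.
Let py k : R := c2 * (qz k)%:~R.

Let c12 : c1 * c2 = 1.
Proof.
rewrite /c1 /c2 -sqrtrM ?divr_ge0 ?ltW//.
have -> : b / a * (a / b) = 1 by rewrite mulrA divfK ?divff ?gt_eqF.
by rewrite sqrtr1.
Qed.

Let c1_sqr : c1 ^+ 2 = b / a. Proof. by rewrite sqr_sqrtr// divr_ge0 ?ltW. Qed.
Let c2_sqr : c2 ^+ 2 = a / b. Proof. by rewrite sqr_sqrtr// divr_ge0 ?ltW. Qed.

(* Up to the factor pi / sqrt (ab), the frequencies (p pi / a, q pi / b) form a lattice of
   covolume 1. *)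
Let freqE (p q : R) : (p * (pi / a)) ^+ 2 + (q * (pi / b)) ^+ 2 =
  pi ^+ 2 / (a * b) * ((c1 * p) ^+ 2 + (c2 * q) ^+ 2).
Proof.
have aN : a != 0 by rewrite gt_eqF.
have bN : b != 0 by rewrite gt_eqF.
rewrite !exprMn c1_sqr c2_sqr; move: (pi : R) => P.
by field; rewrite aN bN.
Qed.

(** The sixth root of the radius of the rescaled frequency circle, as in [far_sum]. *)
Let s := (Num.sqrt (l * (a * b)) / pi) `^ (6%:R^-1).

Let X := C0 R * fine (reflected_perimeter a b V) * Num.sqrt (a * b)
      / (2 * pi * area V * Defs.eta alpha).

Let perimeter_ge0 : 0 <= fine (reflected_perimeter a b V).
Proof.
apply: le_trans (norm_wave_le_perimeter a0 b0 reflected_measurable WT (p := 1) (q := 0) _ P_oo) => //.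
Qed.

Let X_ge0 : 0 <= X.
Proof.
have e0 := eta_gt0; have pi0 := @pi_gt0 R.
have num : 0 <= C0 R * fine (reflected_perimeter a b V) * Num.sqrt (a * b).
  by rewrite mulr_ge0 ?sqrtr_ge0// mulr_ge0// (le_trans _ C0_ge46).
have den : 0 < 2 * pi * area V * Defs.eta alpha by rewrite !mulr_gt0.
exact: divr_ge0 num (ltW den).
Qed.

Let l_gt12 : Num.max 1 (X ^+ 12) < l * (a * b) / pi ^+ 2.
Proof.
have pi0 := @pi_gt0 R.
have E : lambda_star a b V = pi ^+ 2 / (a * b) * Num.max 1 (X ^+ 12) by [].
have := l_gt; rewrite E mulrAC ltr_pdivrMr// mulrC => h.
by rewrite ltr_pdivlMr ?exprn_gt0.
Qed.

Let s12 : (s ^+ 6) ^+ 2 = l * (a * b) / pi ^+ 2.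
Proof.
have l0 : 0 <= l * (a * b).
  have := l_gt12; rewrite gt_max ltr_pdivlMr ?exprn_gt0 ?pi_gt0// => /andP[h _].
  by apply: le_trans (ltW h); rewrite mul1r sqr_ge0.
have r0 : 0 <= Num.sqrt (l * (a * b)) / pi by rewrite divr_ge0 ?sqrtr_ge0 ?pi_ge0.
rewrite /s -(powR_mulrn 6) ?powR_ge0// -powRrM mulVf ?pnatr_eq0// powRr1//.
by rewrite exprMn sqr_sqrtr// exprVn.
Qed.

Let s_ge0 : 0 <= s. Proof. exact: powR_ge0. Qed.

Let s_ge1 : 1 <= s.
Proof.
have := l_gt12; rewrite -s12 gt_max => /andP[h _].
rewrite leNgt; apply/negP => s1; move: h; rewrite ltNge -exprM => /negP; apply.
by rewrite exprn_ile1// ltW.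
Qed.

(** The twelfth power in [lambda_star] is (s^6)^2, the squared radius, so l > [lambda_star] compares
    X^12 with s^12. *)
Let X_lt : X < s.
Proof.
have := l_gt12; rewrite -s12 gt_max -exprM => /andP[_ h].
rewrite ltNge; apply/negP => sX; move: h; rewrite ltNge => /negP; apply.
by apply: (@lerXn2r _ 12 s X).
Qed.

Let on_circle k : S k -> px k ^+ 2 + py k ^+ 2 = (s ^+ 6) ^+ 2.
Proof.
move=> /cP/and3P[_ _ /eqP fl]; have pi0 := @pi_gt0 R.
rewrite s12 -fl /freq freqE /px /py pzE qzE !exprMn !sqrr_sign !mul1r c1_sqr c2_sqr.
have pN : pi != 0 :> R by rewrite gt_eqF.
have aN : a != 0 by rewrite gt_eqF.
have bN : b != 0 by rewrite gt_eqF.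
by move: (pi : R) pN => P pN; field; rewrite aN bN pN.
Qed.

Let dist2E k m : dist2 px py k m =
  (c1 * (pz k - pz m)%:~R) ^+ 2 + (c2 * (qz k - qz m)%:~R) ^+ 2.
Proof. by rewrite /dist2 /px /py !rmorphB /=; ring. Qed.

Let dist2_neq0 k m : S k -> S m -> k != m -> dist2 px py k m != 0.
Proof.
move=> Sk Sm km; rewrite dist2E paddr_eq0 ?sqr_ge0// !sqrf_eq0 negb_and.
have c1N : c1 != 0 by rewrite gt_eqF// sqrtr_gt0 divr_gt0.
have c2N : c2 != 0 by rewrite gt_eqF// sqrtr_gt0 divr_gt0.
rewrite !mulf_eq0 (negbTE c1N) (negbTE c2N) /= !intr_eq0.
exact: pq_neq.
Qed.

Let triple i j k : S i -> S j -> S k -> i != j -> j != k -> i != k ->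
  4 * (s ^+ 6) ^+ 2 <= dist2 px py i j * dist2 px py j k * dist2 px py i k.
Proof.
move=> Si Sj Sk ij jk ik.
pose t (n : 'I_3) := if n == 0 then i else if n == 1 then j else k.
have St n : S (t n) by rewrite /t; case: ifP => // _; case: ifP.
have s0 : (s ^+ 6) ^+ 2 != 0 by rewrite !expf_neq0// gt_eqF// (lt_le_trans _ s_ge1).
have := @lattice_triangle R c1 c2 ((s ^+ 6) ^+ 2) (pz \o t) (qz \o t) c12 s0
  (fun n => on_circle (St n)).
by rewrite /t /=; apply; rewrite !mulf_neq0//; exact: dist2_neq0.
Qed.

Lemma high_frequency_estimate :
  alpha / 2 * Defs.eta alpha * \int[leb2 R]_(z in QL) v z ^+ 2 <= \int[leb2 R]_(z in VL) v z ^+ 2.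
Proof.
have pi0 := @pi_gt0 R; have /andP[al0 al1] := density_itv.
have mW := reflected_measurable; have e0 := eta_gt0.
have s_gt0 : 0 < s by exact: lt_le_trans s_ge1.
pose P := fine (reflected_perimeter a b V).
pose S1 := 4 * (a * b) * sin (pi * alpha) / pi.
pose P1 := P * Num.sqrt (a * b) / pi.
have S1_ge0 : 0 <= S1.
  have sn : 0 <= sin (pi * alpha).
    by apply: sin_ge0_pi; rewrite mulr_ge0 ?(ltW pi0) ?(ltW al0)//= ler_piMr ?(ltW pi0)// ltW.
  by apply: divr_ge0 (ltW pi0); apply: mulr_ge0 => //; apply: mulr_ge0 => //; exact: ltW.
have P1_ge0 : 0 <= P1 by rewrite divr_ge0 ?(ltW pi0)// mulr_ge0 ?sqrtr_ge0.
have dS k : ~~ S k -> d k = 0 by rewrite negbK /d => /eqP ->; rewrite mulr0 mul0r.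
have AD k : A k k = 4 * (a * b) * alpha.
  rewrite /A !subrr -area_reflected -[RHS]mul1r -(Rintegral_cst (leb2 R) mW 1).
  by apply: eq_Rintegral => z _; rewrite /wave !mul0r !addr0 cos0.
have W01 : 0 < fine (leb2 R W) < 4 * (a * b).
  have h4 : 0 < 4 * (a * b) by rewrite mulr_gt0.
  by rewrite area_reflected pmulr_rgt0// al0 gtr_pMr.
have Wal : fine (leb2 R W) / (4 * (a * b)) = alpha.
  by rewrite area_reflected mulrC mulKf// gt_eqF// mulr_gt0.
have AS k m : S k -> S m -> k != m -> `|A k m| <= S1.
  move=> Sk Sm km; have := norm_wave_le_bathtub a0 b0 mW WT (pq_neq Sk Sm km) W01.
  by rewrite Wal.
have AP k m : S k -> S m -> k != m -> `|A k m| <= P1 / Num.sqrt (dist2 px py k m).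
  move=> Sk Sm km; have D0 : 0 < Num.sqrt (dist2 px py k m).
    by rewrite sqrtr_gt0 lt_neqAle eq_sym dist2_neq0//= dist2_ge0.
  have := norm_wave_le_perimeter a0 b0 mW WT (pq_neq Sk Sm km) P_oo.
  rewrite freqE -dist2E sqrtrM; last by rewrite divr_ge0 ?sqr_ge0 ?(ltW ab0).
  have -> : Num.sqrt (pi ^+ 2 / (a * b)) = pi / Num.sqrt (a * b) :> R.
    by rewrite sqrtrM ?sqr_ge0// sqrtr_sqr ger0_norm ?(ltW pi0)// sqrtrV ?(ltW ab0).
  have sab : 0 < Num.sqrt (a * b) by rewrite sqrtr_gt0.
  rewrite ler_pdivlMr// -[torus_perimeter _ _ _]/(reflected_perimeter a b V) -/P -/(A k m).
  move=> h; have -> : P1 = P * (Num.sqrt (a * b) / pi) by rewrite /P1 mulrA.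
  by rewrite -ler_pdivrMr ?divr_gt0// invf_div mulrC [`|_| * _]mulrC mulrA.
have F := near_far_form_ge s_ge1 on_circle triple S1_ge0 P1_ge0 dS AD AS AP.
rewrite -Rintegral_W_sqr_v Rintegral_W_V sum_sqr_d in F.
have cP' i j : c i j != 0 -> (0 < i)%N && (0 < j)%N by move=> /cP/and3P[-> ->].
rewrite (Rintegral_sqr_sine_sum a0 b0 N cP').
set Sc := \sum_p _ in F *.
have Sc0 : 0 <= Sc by apply: sumr_ge0 => p _; rewrite sqr_ge0.
(* The diagonal entry minus the bathtub bound for the one near neighbour; this is the origin of
   [eta]. *)
have etaE : 4 * (a * b) * alpha - S1 = 4 * (a * b) * alpha * Defs.eta alpha.
  rewrite /S1; have -> : Defs.eta alpha = 1 - sin (pi * alpha) / (pi * alpha) by [].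
  have pN : pi != 0 :> R by rewrite gt_eqF.
  have alN : alpha != 0 by rewrite gt_eqF.
  set sn := sin _; move: (pi : R) pN => p pN; field; rewrite pN alN//.
(* The far part uses up at most half of it: this is the inequality X < s, with 46 estimated by
   [C0]. *)
have PB : P1 * (46 / s) <= 2 * (a * b) * alpha * Defs.eta alpha.
  have den : 0 < 2 * pi * area V * Defs.eta alpha by rewrite !mulr_gt0.
  have := X_lt; rewrite /X ltr_pdivrMr// -/P => h.
  have C46 := @C0_ge46 R.
  have Pab : 0 <= P * Num.sqrt (a * b) by rewrite mulr_ge0 ?sqrtr_ge0.
  rewrite /P1 mulf_div ler_pdivrMr; last exact: mulr_gt0.
  apply: (@le_trans _ _ (C0 R * P * Num.sqrt (a * b))).
    by rewrite mulrC -mulrA ler_wpM2r.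
  apply: (le_trans (ltW h)); rewrite areaV.
  by rewrite -subr_ge0 (_ : _ - _ = 0)//; ring.
have G : 2 * (a * b) * alpha * Defs.eta alpha <= 4 * (a * b) * alpha - S1 - P1 * (46 / s).
  by rewrite etaE; move: PB; lra.
have H := le_trans (ler_wpM2r (mulr_ge0 _ Sc0) G) F.
rewrite -(ler_pM2l (_ : 0 < 4 :> R))//; apply: le_trans (H _) => //.
by rewrite -subr_ge0 (_ : _ - _ = 0)//; field.
Qed.

End high_frequency.

(** * Turan-Nazarov for sine polynomials on an interval *)

Section affine.
Context {R : realType}.
Local Notation mu := (@lebesgue_measure R).
Local Notation R1 := (measurableTypeR R).

Lemma measurable_affine (k s : R) : measurable_fun setT (fun t : R1 => k * t + s : R1).
Proof. by apply: measurable_funD => //; exact: measurable_funM. Qed.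

(** k times the image measure agrees with Lebesgue measure on half-open intervals, hence
    everywhere. *)
Lemma lebesgue_measure_affine (k s : R) (A : set R1) : 0 < k -> measurable A ->
  mu [set t | A (k * t + s)] = (k^-1%:E * mu A)%E.
Proof.
move=> k0 mA; pose f := fun t : R1 => k * t + s : R1.
have kn : 0 <= k by exact: ltW.
pose nu' : {measure set R1 -> \bar R} := mscale (NngNum kn) (pushforward mu f).
pose nu := nu' (measurable_affine k s).
have nuE (B : set R1) : nu B = (k%:E * mu (f @^-1` B))%E by [].
suff -> : mu A = nu A by rewrite nuE muleA -EFinM mulVf ?gt_eqF// mul1e.
apply: (@lebesgue_measure_unique R nu) => // _ [[x y]] _ <-; rewrite nuE.
have -> : f @^-1` `]x, y]%classic = `](x - s) / k, (y - s) / k]%classic.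
  apply/seteqP; split=> t; rewrite /f /= !in_itv/= ltr_pdivrMr// ler_pdivlMr//.
    by move=> /andP[h1 h2]; apply/andP; split; lra.
  by move=> /andP[h1 h2]; apply/andP; split; lra.
rewrite !lebesgue_measure_itv /= !lte_fin ltr_pM2r ?invr_gt0// ltrD2r.
case: ifP => xy; last by rewrite mule0.
by rewrite -!EFinD -EFinM; congr EFin; field; rewrite gt_eqF.
Qed.

Variable l : R.
Hypothesis l0 : 0 < l.

(** The tent map from [0, 1] onto [0, l]. It identifies t with 1 - t, which is the reflection of a
    circle of length 2 l under which the square of an odd function is invariant. *)
Definition fold (t : R) : R := l * (1 - `|2 * t - 1|).

Lemma measurable_fold : measurable_fun setT (fold : R1 -> R1).
Proof.
apply: continuous_measurable_fun => t.
apply: cvgM; first exact: cvg_cst.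
apply: cvgB; first exact: cvg_cst.
apply: cvg_norm; apply: cvgB; last exact: cvg_cst.
by apply: cvgM; [exact: cvg_cst|exact: cvg_id].
Qed.

Lemma fold_lo t : t <= 1 / 2 -> fold t = l * 2 * t.
Proof. by move=> t1; rewrite /fold ler0_norm; [ring|lra]. Qed.

Lemma fold_hi t : 1 / 2 <= t -> fold t = l * 2 * (1 - t).
Proof. by move=> t1; rewrite /fold ger0_norm; [ring|lra]. Qed.

Lemma fold_itv t : 0 < fold t -> 0 < t < 1.
Proof.
rewrite /fold pmulr_rgt0// subr_gt0 ltr_norml => /andP[h1 h2].
by apply/andP; split; lra.
Qed.

(* [fold] pushes the Lebesgue measure of the circle to the normalised Lebesgue measure of
   ]0, l[. *)
Lemma lebesgue_measure_fold (A : set R1) : measurable A -> A `<=` `]0, l[%classic ->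
  mu (fold @^-1` A) = (l^-1%:E * mu A)%E.
Proof.
move=> mA Al.
pose A1 : set R1 := [set t | A (l * 2 * t + 0)].
pose B : set R1 := [set t | A (- t)].
pose A2 : set R1 := [set t | B (l * 2 * t + - (l * 2))].
have l2 : 0 < l * 2 by rewrite mulr_gt0.
have mB : measurable B.
  by rewrite -[X in measurable X]setTI; exact: (@oppr_measurable R setT).
have mpre (k s : R) (C : set R1) : measurable C -> measurable [set t : R1 | C (k * t + s)].
  by move=> mC; rewrite -[X in measurable X]setTI; exact: (measurable_affine k s).
have A1P t : A1 t -> 0 < t < 1 / 2.
  by move=> /Al /=; rewrite in_itv/= => /andP[h1 h2]; apply/andP; split; nra.
have A2P t : A2 t -> 1 / 2 < t < 1.
  by move=> /Al /=; rewrite in_itv/= => /andP[h1 h2]; apply/andP; split; nra.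
have -> : fold @^-1` A = A1 `|` A2.
  apply/seteqP; split=> t /=.
    have [t1|t1] := lerP t (1 / 2).
      by rewrite fold_lo// => h; left; rewrite /A1 /= addr0.
    rewrite fold_hi ?(ltW t1)// => h; right; rewrite /A2 /B /=.
    by rewrite (_ : - _ = l * 2 * (1 - t))//; ring.
  case=> h.
    have /andP[_ t1] := A1P _ h; rewrite fold_lo ?(ltW t1)//.
    by move: h; rewrite /A1 /= addr0.
  have /andP[t1 _] := A2P _ h; rewrite fold_hi ?(ltW t1)//.
  by move: h; rewrite /A2 /B /= (_ : - _ = l * 2 * (1 - t))//; ring.
rewrite measureU; [|exact: mpre|exact: mpre|]; last first.
  apply/seteqP; split=> // t [/A1P/andP[_ h1] /A2P/andP[h2 _]].
  by move: (lt_trans h1 h2); rewrite ltxx.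
have E1 : mu A1 = ((l * 2)^-1%:E * mu A)%E by exact: lebesgue_measure_affine.
have E2 : mu A2 = ((l * 2)^-1%:E * mu B)%E by exact: lebesgue_measure_affine.
have EB : mu B = mu A by exact: lebesgue_measureN.
transitivity (mu A1 + mu A2)%E => //; rewrite E1 E2 EB.
rewrite -ge0_muleDl ?lee_fin ?invr_ge0 ?(ltW l2)// -EFinD; congr (_%:E * _)%E.
by field; rewrite gt_eqF.
Qed.

Local Notation lebT := (caratheodory_type (wlength (@idfun R))^*%mu).

Lemma measurable_fold_completed : measurable_fun setT (fold : lebT -> R1).
Proof.
move=> _ Y mY; rewrite setTI; apply: sub_caratheodory.
by rewrite -[X in _ X]setTI; exact: measurable_fold.
Qed.

Lemma ge0_integral_fold (A : set R1) (f : R -> R) : measurable A -> A `<=` `]0, l[%classic ->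
  measurable_fun A (f : R1 -> R1) -> (forall x, 0 <= f x) ->
  (\int[@completed_lebesgue_measure R]_(t in fold @^-1` A) (f (fold t))%:E =
   l^-1%:E * \int[mu]_(x in A) (f x)%:E)%E.
Proof.
move=> mA Al mf f0; have ln : 0 <= l by exact: ltW.
have mfE : measurable_fun A (EFin \o f : R1 -> \bar R) by exact/measurable_EFinP.
rewrite (@ge0_integral_measure_preserving _ _ lebT R1 R fold
  (mscale (NngNum ln) (@completed_lebesgue_measure R)) mu A (EFin \o f) measurable_fold_completed)//.
- rewrite ge0_integral_mscale //.
  + by rewrite muleA -EFinM mulVf ?mul1e// gt_eqF.
  + by rewrite -[X in measurable X]setTI; exact: measurable_fold_completed.
  + apply: (@measurable_comp _ _ _ lebT R1 _ A) => //.
      by move=> _ [t ? <-].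
    apply: measurable_funTS; exact: measurable_fold_completed.
  + by move=> t _; rewrite lee_fin.
- move=> C mC CA; rewrite -[LHS]/(l%:E * mu (fold @^-1` C))%E.
  rewrite lebesgue_measure_fold//; last exact: subset_trans Al.
  by rewrite muleA -EFinM mulfV ?mul1e// gt_eqF.
- by move=> x _; rewrite lee_fin.
Qed.

End affine.

Section turan_nazarov_sine.
Context {R : realType}.
Local Notation mu := (@lebesgue_measure R).
Local Notation R1 := (measurableTypeR R).
Local Open Scope complex_scope.

Lemma complex_sumE (n : nat) (F G : 'I_n -> R) :
  \sum_(i < n) (F i +i* G i) = (\sum_(i < n) F i) +i* (\sum_(i < n) G i).
Proof.
elim: n F G => [|n IH] F G; first by rewrite !big_ord0.
by rewrite !big_ord_recr /= IH.
Qed.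

Lemma sum_centered (M : nat) (F : nat -> R) : \sum_(k < (2 * M).+1) F k =
  F M + \sum_(m < M) (F (M + m.+1)%N + F (M - m.+1)%N).
Proof.
rewrite big_split /= -(big_mkord xpredT F).
rewrite (@big_cat_nat _ _ _ M) //=; last by lia.
rewrite [X in _ + X]big_ltn; last by lia.
rewrite addrCA; congr (_ + _); rewrite addrC; congr (_ + _).
  rewrite -{1}[M.+1]add0n big_addn big_mkord.
  have -> : ((2 * M).+1 - M.+1)%N = M by lia.
  by apply: eq_bigr => i _; congr F; lia.
rewrite big_mkord (reindex_inj rev_ord_inj); apply: eq_bigr => i _; congr F.
Qed.

Local Notation lebT := (caratheodory_type (wlength (@idfun R))^*%mu).
Variables (C l : R) (M : nat) (c : nat -> R).
Hypotheses (C1 : 1 <= C) (TN : turan_nazarov C) (l0 : 0 < l).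

Let p (x : R) : R := \sum_(m < M) c m.+1 * sin (m.+1%:R * (pi / l * x)).

(** Index k stands for the frequency k - M. By sin (m x) = (- i / 2) exp (i m x) + (i / 2) exp (- i
    m x) the coefficients are purely imaginary, with these imaginary parts. *)
Let g (k : nat) : R :=
  if (M < k)%N then - c (k - M) / 2 else if (k < M)%N then c (M - k)%N / 2 else 0.
Let q := trig_poly (fun k : 'I_(2 * M).+1 => 0 +i* g k).

(* [q] is exp (2 i pi M t) times the odd extension of [p] evaluated at 2 l t. *)
Let qE t : q t = (\sum_(k < (2 * M).+1) - g k * sin (2 * pi * k%:R * t)) +i*
  (\sum_(k < (2 * M).+1) g k * cos (2 * pi * k%:R * t)).
Proof.
rewrite -complex_sumE; apply: eq_bigr => k _.
by apply/eqP; rewrite eq_complex /= !mul0r sub0r add0r mulNr !eqxx.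
Qed.

Let P t : R := \sum_(m < M) c m.+1 * sin (m.+1%:R * (2 * pi * t)).

(** The shift of all frequencies by M only multiplies by a number of modulus 1. *)
Let cabs2_q t : cabs2 (q t) = P t ^+ 2.
Proof.
pose th : R := 2 * pi * t.
have gM : g M = 0 by rewrite /g ltnn.
have gp m : g (M + m.+1)%N = - c m.+1 / 2.
  by rewrite /g ifT ?addKn//; lia.
have gm (m : 'I_M) : g (M - m.+1)%N = c m.+1 / 2.
  have mM := ltn_ord m; rewrite /g ifF; last by apply/negbTE; rewrite -leqNgt leq_subr.
  by rewrite ifT ?subKn//; lia.
have ang (k : nat) : 2 * pi * k%:R * t = k%:R * th by rewrite /th; ring.
have Re : \sum_(k < (2 * M).+1) - g k * sin (2 * pi * k%:R * t) = cos (M%:R * th) * P t.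
  rewrite (sum_centered M (fun k => - g k * sin (2 * pi * k%:R * t))) gM oppr0 mul0r add0r.
  rewrite big_distrr; apply: eq_bigr => m _ /=.
  by rewrite gp gm !ang natrD natrB ?ltn_ord// mulrDl mulrBl sinD sinB; field.
have Im : \sum_(k < (2 * M).+1) g k * cos (2 * pi * k%:R * t) = sin (M%:R * th) * P t.
  rewrite (sum_centered M (fun k => g k * cos (2 * pi * k%:R * t))) gM mul0r add0r.
  rewrite big_distrr; apply: eq_bigr => m _ /=.
  by rewrite gp gm !ang natrD natrB ?ltn_ord// mulrDl mulrBl cosD cosB; field.
rewrite qE /cabs2 /= Re Im !exprMn -mulrDl cos2Dsin2 mul1r//.
Qed.

(** On the second half of the circle the sines change sign under the reflection, which the square
    does not see. *)
Let P_fold t : 0 <= t < 1 -> P t ^+ 2 = p (fold l t) ^+ 2.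
Proof.
move=> /andP[t0 t1]; have lN : l != 0 by rewrite gt_eqF.
have [th|th] := lerP t (1 / 2).
  rewrite fold_lo//; congr (_ ^+ 2); apply: eq_bigr => m _; congr (_ * sin (_ * _)).
  by rewrite -[l * 2 * t]mulrA mulrA divfK//; ring.
rewrite fold_hi ?(ltW th)// -[RHS]sqrrN; congr (_ ^+ 2).
rewrite -sumrN; apply: eq_bigr => m _; rewrite -mulrN; congr (_ * _).
have -> : m.+1%:R * (pi / l * (l * 2 * (1 - t))) = - (m.+1%:R * (2 * pi * t)) + m.+1%:R * (pi *+ 2).
  by rewrite -[l * 2 * (1 - t)]mulrA [pi / l * _]mulrA divfK// mulr2n; ring.
by rewrite [_ * (pi *+ 2)]mulr_natl (periodicn (@sinD2pi R)) sinN opprK.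
Qed.

Let cp : continuous p.
Proof.
apply: continuous_big => [|m _]; first exact: add_continuous.
move=> x; apply: cvgM; first exact: cvg_cst.
apply: continuous_comp; last exact: continuous_sin.
by do 2 (apply: cvgM; first exact: cvg_cst); exact: cvg_id.
Qed.

(** The hypothesis is applied to 2 M + 1 terms on the preimage of A under [fold], of measure |A| /
    l. Its exponent 2 M + 1/2 doubles to 4 M + 1 when the norms are squared. *)
Lemma turan_nazarov_sine (A : set R1) : measurable A -> A `<=` `]0, l[%classic ->
  (0 < mu A)%E ->
  (fine (mu A) / (C * l)) ^+ (4 * M).+1 * \int[mu]_(x in `]0, l[) p x ^+ 2
    <= \int[mu]_(x in A) p x ^+ 2.
Proof.
move=> mA Al A0.
have mI : measurable (`]0, l[%classic : set R1) by [].
have loo : (mu `]0%R, l[%classic < +oo)%E by rewrite leb_itv0// ltry.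
have Aoo : (mu A < +oo)%E.
  by apply: le_lt_trans loo; apply: le_measure => //; rewrite inE.
have Afin : mu A \is a fin_num by rewrite ge0_fin_numE.
pose alpha := fine (mu A); have al0 : 0 < alpha by rewrite fine_gt0// A0.
have alE : mu A = alpha%:E by rewrite fineK.
pose E := fold l @^-1` A.
have EA : completed_lebesgue_measure E = (alpha / l)%:E.
  by rewrite -[LHS]/(mu E) lebesgue_measure_fold// alE -EFinM mulrC.
have mE : (wlength (@idfun R))^*%mu.-cara.-measurable E.
  by rewrite -[E]setTI; exact: measurable_fold_completed.
have E01 : E `<=` `[0, 1[.
  move=> t /Al /=; rewrite !in_itv/= => /andP[h _].
  by have /andP[h1 h2] := fold_itv l0 h; rewrite (ltW h1) h2.
have Epos : (0 < completed_lebesgue_measure E)%E by rewrite EA lte_fin divr_gt0.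
have cp2 : continuous (fun x => p x ^+ 2).
  rewrite (_ : (fun x => p x ^+ 2) = (fun x => p x * p x)).
    by move=> x; apply: cvgM; exact: cp.
  by apply/funext => x; rewrite expr2.
have mp (D : set R1) : measurable_fun D (fun x : R1 => p x ^+ 2 : R1).
  by apply: measurable_funTS; exact: continuous_measurable_fun.
have iI : mu.-integrable `]0, l[%classic (EFin \o (fun x => p x ^+ 2)).
  apply: (@integrableS _ _ _ mu `[0, l]%classic) => //.
    by apply: subset_itvScc; rewrite bnd_simp.
  apply: continuous_compact_integrable; first exact: segment_compact.
  exact: continuous_subspaceT.
have IE (D : set R1) : measurable D -> D `<=` `]0, l[%classic ->
    \int[completed_lebesgue_measure]_(t in fold l @^-1` D) cabs2 (q t) =
    l^-1 * \int[mu]_(x in D) p x ^+ 2.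
  move=> mD Dl.
  have H := ge0_integral_fold l0 mD Dl (mp D) (fun x => sqr_ge0 (p x)).
  rewrite /Rintegral.
  have -> : (\int[completed_lebesgue_measure]_(t in fold l @^-1` D) (cabs2 (q t))%:E =
      \int[completed_lebesgue_measure]_(t in fold l @^-1` D) (p (fold l t) ^+ 2)%:E)%E.
    apply: eq_integral => t; rewrite inE => /Dl /=; rewrite in_itv/= => /andP[h _].
    have /andP[h1 h2] := fold_itv l0 h.
    by rewrite cabs2_q P_fold// (ltW h1).
  rewrite H fineM//; apply: integrable_fin_num => //.
  exact: (integrableS mI mD Dl iI).
have cP : continuous (fun t => P t ^+ 2).
  have cP1 : continuous P.
    apply: continuous_big => [|m _]; first exact: add_continuous.
    move=> x; apply: cvgM; first exact: cvg_cst.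
    apply: continuous_comp; last exact: continuous_sin.
    by do 2 (apply: cvgM; first exact: cvg_cst); exact: cvg_id.
  rewrite (_ : (fun x => P x ^+ 2) = (fun x => P x * P x)).
    by move=> x; apply: cvgM; exact: cP1.
  by apply/funext => x; rewrite expr2.
have P_le t : `|P t ^+ 2| <= (\sum_(m < M) `|c m.+1|) ^+ 2.
  rewrite normrX lerXn2r ?nnegrE ?sumr_ge0//.
  apply: (le_trans (ler_norm_sum _ _ _)); apply: ler_sum => m _.
  by rewrite normrM ler_piMr ?sin_max.
pose I01 : set lebT := `[0, 1[%classic.
have m01 : measurable I01 by apply: sub_caratheodory; exact: measurable_itv.
have leb01 : (completed_lebesgue_measure I01 < +oo)%E.
  rewrite -[X in (X < _)%E]/(mu `[0%R, 1%R[%classic) lebesgue_measure_itv/=.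
  by case: ifP => _; rewrite ?ltry.
have iq : (@completed_lebesgue_measure R).-integrable I01 (EFin \o (fun t => cabs2 (q t))).
  rewrite (_ : (fun t => cabs2 (q t)) = (fun t => P t ^+ 2)); last by apply/funext => t; exact: cabs2_q.
  apply: (bounded_integrable m01 leb01 _ (fun t _ => P_le t)).
  move=> _ Y mY; apply: measurableI => //; apply: sub_caratheodory.
  rewrite -[X in _ X]setTI; exact: (@continuous_measurable_fun R _ cP).
have mJ : measurable (fold l @^-1` `]0, l[ : set lebT).
  by rewrite -[X in measurable X]setTI; exact: measurable_fold_completed.
have J01 : fold l @^-1` `]0, l[ `<=` I01.
  move=> t /=; rewrite /I01 /= !in_itv/= => /andP[h _].
  by have /andP[h1 h2] := fold_itv l0 h; rewrite (ltW h1) h2.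
(* The preimage of the open interval is not all of [0, 1[, but only this inequality enters. *)
have := le_Rintegral_subset mJ m01 J01 iq (fun t _ => addr_ge0 (sqr_ge0 _) (sqr_ge0 _)).
rewrite (IE _ mI)// => H1.
have := TN (fun k : 'I_(2 * M).+1 => 0 +i* g k) (ltn0Sn _) mE E01 Epos.
rewrite -/q /circle_l2norm (IE _ mA Al) EA /= -/I01.
set U := Rintegral _ I01 _ in H1 *; set J := \int[mu]_(x in A) _; set I := Rintegral _ _ _ in H1 *.
have J0 : 0 <= J by apply: Rintegral_ge0 => x _; exact: sqr_ge0.
have U0 : 0 <= U by apply: Rintegral_ge0 => x _; rewrite addr_ge0 ?sqr_ge0.
set r := _ - 2^-1; pose X := C * l / alpha.
have C0 : 0 < C by exact: lt_le_trans ltr01 C1.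
have X0 : 0 < X by rewrite /X divr_gt0 ?mulr_gt0.
have -> : C / (alpha / l) = X by rewrite /X; field; rewrite !gt_eqF.
move=> TNE.
have K2 : (X `^ r) ^+ 2 = X ^+ (4 * M).+1.
  rewrite -powR_mulrn ?powR_ge0// -powRrM -powR_mulrn ?(ltW X0)//; congr (_ `^ _).
  by rewrite /r -[(2 * M).+1%:R]natr1 -[(4 * M).+1%:R]natr1 !natrM; field.
have TNE2 : U <= X ^+ (4 * M).+1 * (l^-1 * J).
  rewrite -K2 -[leLHS](sqr_sqrtr U0) -[X in _ <= _ * X]sqr_sqrtr ?mulr_ge0 ?invr_ge0 ?(ltW l0)//.
  by rewrite -exprMn lerXn2r ?nnegrE ?sqrtr_ge0// mulr_ge0 ?powR_ge0 ?sqrtr_ge0.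
have : I <= X ^+ (4 * M).+1 * J.
  rewrite -(ler_pM2l (_ : 0 < l^-1)) ?invr_gt0//; apply: (le_trans H1); apply: (le_trans TNE2).
  by rewrite mulrCA.
have -> : alpha / (C * l) = X^-1 by rewrite /X invf_div.
by move=> IJ; rewrite exprVn mulrC ler_pdivrMr ?exprn_gt0// mulrC.
Qed.

End turan_nazarov_sine.

(** * Low frequencies *)

Lemma Rintegral_lin d (T : measurableType d) (R : realType) (m : {measure set T -> \bar R})
    (D : set T) (f g : T -> R) (k : R) : measurable D ->
  m.-integrable D (EFin \o f) -> m.-integrable D (EFin \o g) ->
  \int[m]_(x in D) (f x + k * g x) = \int[m]_(x in D) f x + k * \int[m]_(x in D) g x.
Proof.
move=> mD fi gi; rewrite -(RintegralZl _ mD gi).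
exact: (RintegralD mD fi (integrableRZ mD k gi)).
Qed.

Section low_frequency.
Context {R : realType}.
Local Notation mu := (@lebesgue_measure R).
Local Notation R1 := (measurableTypeR R).
Local Notation R2 := (measurableTypeR R * measurableTypeR R)%type.

(** Reconciles the cut of a sine sum at N with the degree M used for Turan-Nazarov; both sums equal
    the one up to N + M + 1. *)
Lemma sum_ord_support (N M : nat) (F : nat -> R) : F 0%N = 0 ->
  (forall i, (M < i)%N -> F i = 0) -> (forall i, (N <= i)%N -> F i = 0) ->
  \sum_(i < N) F i = \sum_(m < M) F m.+1.
Proof.
move=> F0 FM FN.
have tail n k : (n <= k)%N -> (forall i, (n <= i)%N -> F i = 0) ->
    \sum_(0 <= i < k) F i = \sum_(0 <= i < n) F i.
  move=> nk Fn; rewrite (big_cat_nat (n := n))//=.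
  have -> : \sum_(n <= i < k) F i = 0.
    by rewrite big_nat_cond big1// => i /andP[/andP[ni _] _]; exact: Fn.
  by rewrite addr0.
rewrite -(big_mkord xpredT F) -(tail N (N + M.+1)%N) ?leq_addr//.
rewrite (tail M.+1) ?leq_addl//.
by rewrite big_mkord big_ord_recl F0 add0r.
Qed.

Variables (a b : R).
Hypotheses (a0 : 0 < a) (b0 : 0 < b).
Local Notation Q := (rectangle a b).
Local Notation QL := (Q : set (plane R)).
Local Notation Ia := (`]0, a[%classic : set R1).
Local Notation Ib := (`]0, b[%classic : set R1).
Local Notation bdd := (bddf (setT : set R2)).
Local Opaque leb2 Rintegral.

Let mQ : measurable QL := plane_measurable_rectangle a b.
Let Qoo := leb2_rectangle_lty a0 b0.
Let mIa : measurable Ia. Proof. by []. Qed.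
Let mIb : measurable Ib. Proof. by []. Qed.
Let Iaoo : (mu Ia < +oo)%E. Proof. by rewrite leb_itv0// ltry. Qed.
Let Iboo : (mu Ib < +oo)%E. Proof. by rewrite leb_itv0// ltry. Qed.

Lemma bddf_integrable f : bdd f -> (leb2 R).-integrable QL (EFin \o f).
Proof.
move=> [mf [M fM]]; apply: (bounded_integrable mQ Qoo (M := M)).
  exact: (measurable_funS measurableT (@subsetT _ QL) (borel_plane_measurable_fun measurableT mf)).
by move=> z _; exact: fM.
Qed.

Lemma bddf_section1 f x : bdd f -> mu.-integrable Ib (EFin \o (fun y => f (x, y))).
Proof.
move=> [mf [M fM]]; apply: (bounded_integrable (M := M)) => //.
  by apply: measurable_funTS; apply: measurableT_comp => //; exact: pair1_measurable.
by move=> y _; exact: fM.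
Qed.

Lemma bddf_section2 f y : bdd f -> mu.-integrable Ia (EFin \o (fun x => f (x, y))).
Proof.
move=> [mf [M fM]]; apply: (bounded_integrable (M := M)) => //.
  by apply: measurable_funTS; apply: measurableT_comp => //; exact: pair2_measurable.
by move=> x _; exact: fM.
Qed.

Lemma bddf_fubini1 f : bdd f ->
  \int[leb2 R]_(z in QL) f z = \int[mu]_(x in Ia) \int[mu]_(y in Ib) f (x, y).
Proof.
move=> [mf [M fM]]; rewrite rectangleE.
by apply: (Rintegral_fubini1 mIa mIb Iaoo Iboo mf (M := M)) => z _; exact: fM.
Qed.

Lemma bddf_fubini2 f : bdd f ->
  \int[leb2 R]_(z in QL) f z = \int[mu]_(y in Ib) \int[mu]_(x in Ia) f (x, y).
Proof.
move=> [mf [M fM]]; rewrite rectangleE.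
by apply: (Rintegral_fubini2 mIa mIb Iaoo Iboo mf (M := M)) => z _; exact: fM.
Qed.

Lemma bddf_indic (B : set R2) : measurable B -> bdd (\1_B : R2 -> R).
Proof.
move=> mB; split; first exact: measurable_indic.
by exists 1 => z _; rewrite indicE; case: (_ \in _); rewrite ?normr1 ?normr0.
Qed.

Lemma bddf_indic_fst (X : set R1) : measurable X -> bdd (fun z => \1_X z.1 : R).
Proof.
move=> mX; split.
  by apply: (measurableT_comp (f := (\1_X : R1 -> R))); [exact: measurable_indic|exact: measurable_fst].
by exists 1 => z _; rewrite indicE; case: (_ \in _); rewrite ?normr1 ?normr0.
Qed.

Lemma Rintegral_indicM d (T : measurableType d) (m : {measure set T -> \bar R})
    (D A : set T) (f : T -> R) : A `<=` D ->
  \int[m]_(x in D) (\1_A x * f x) = \int[m]_(x in A) f x.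
Proof.
move=> AD; rewrite -[in RHS](setIidr AD) Rintegral_mkcondr; apply: eq_Rintegral => x _.
by rewrite patchE indicE; case: (x \in A); rewrite ?mul1r ?mul0r.
Qed.

Variables (V : set (R * R)).
Hypotheses (VQ : V `<=` Q) (mV : measurable (V : set (plane R))).
Hypotheses (V_gt0 : 0 < area V) (V_lt : area V < area Q).
Local Notation VL := (V : set (plane R)).
Let alpha := density a b V.

Variables (C : R) (N Nx Ny : nat) (c : nat -> nat -> R).
Hypotheses (C1 : 1 <= C) (TN : turan_nazarov C).
Hypothesis cP : forall i j, c i j != 0 -> [&& (0 < i)%N, (0 < j)%N, (i <= Nx)%N & (j <= Ny)%N].
Local Notation v := (sine_sum a b N c).

Let bdd_v : bdd (fun z => v z ^+ 2).
Proof.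
have bv : bdd v.
  split; first exact: continuous_measurable2 (@continuous_sine_sum R a b N c).
  exists (\sum_(p : 'I_N * 'I_N) `|c p.1 p.2|) => z _.
  apply: (le_trans (ler_norm_sum _ _ _)); apply: ler_sum => p _.
  by rewrite normrM ler_piMr// /sine normrM mulr_ile1 ?sin_max.
by under eq_fun do rewrite expr2; exact: bddfM.
Qed.

Let v_pair x y : v (x, y) = \sum_(i < N) \sum_(j < N)
  c i j * (sin (i%:R * (pi / a * x)) * sin (j%:R * (pi / b * y))).
Proof. by rewrite /sine_sum pair_bigA. Qed.

(** For fixed x this is a sine polynomial of degree [Ny] in y; the guard accounts for the cut of the
    double sum at N. *)
Let v_section1 x y : v (x, y) = \sum_(m < Ny)
  (\sum_(i < N) (if (m.+1 < N)%N then c i m.+1 else 0) * sin (i%:R * (pi / a * x))) *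
  sin (m.+1%:R * (pi / b * y)).
Proof.
rewrite v_pair exchange_big /=.
pose F (j : nat) := (\sum_(i < N) (if (j < N)%N then c i j else 0) * sin (i%:R * (pi / a * x))) *
  sin (j%:R * (pi / b * y)).
rewrite (eq_bigr (fun j : 'I_N => F j)); last first.
  move=> j _; rewrite /F ltn_ord big_distrl /=; apply: eq_bigr => i _; ring.
apply: (sum_ord_support (F := F)).
- by rewrite /F mul0r sin0 mulr0.
- move=> j jN; rewrite /F big1 ?mul0r// => i _.
  have [cij|/cP/and4P[_ _ _]] := eqVneq (c i j) 0; first by rewrite cij if_same mul0r.
  by rewrite leqNgt jN.
- move=> j jN; rewrite /F big1 ?mul0r// => i _.
  by rewrite ltnNge jN mul0r.
Qed.

Let v_section2 x y : v (x, y) = \sum_(m < Nx)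
  (\sum_(j < N) (if (m.+1 < N)%N then c m.+1 j else 0) * sin (j%:R * (pi / b * y))) *
  sin (m.+1%:R * (pi / a * x)).
Proof.
rewrite v_pair.
pose F (i : nat) := (\sum_(j < N) (if (i < N)%N then c i j else 0) * sin (j%:R * (pi / b * y))) *
  sin (i%:R * (pi / a * x)).
rewrite (eq_bigr (fun i : 'I_N => F i)); last first.
  move=> i _; rewrite /F ltn_ord big_distrl /=; apply: eq_bigr => j _; ring.
apply: (sum_ord_support (F := F)).
- by rewrite /F mul0r sin0 mulr0.
- move=> i iN; rewrite /F big1 ?mul0r// => j _.
  have [cij|/cP/and4P[_ _]] := eqVneq (c i j) 0; first by rewrite cij if_same mul0r.
  by rewrite leqNgt iN.
- move=> i iN; rewrite /F big1 ?mul0r// => j _.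
  by rewrite ltnNge iN mul0r.
Qed.

Let ratio := alpha / (2 * C).

Let al01 : 0 < alpha < 1. Proof. exact: density_itv. Qed.
Let C_gt0 : 0 < C. Proof. exact: lt_le_trans ltr01 C1. Qed.
Let ratio_ge0 : 0 <= ratio.
Proof. by have /andP[h _] := al01; rewrite divr_ge0 ?(ltW h)// mulr_ge0 ?(ltW C_gt0). Qed.

(** The 2 in [ratio] comes from keeping only slices of at least half the average length. *)
Let ratio_le (l m : R) (n : nat) : 0 < l -> alpha * l / 2 <= m -> ratio ^+ n <= (m / (C * l)) ^+ n.
Proof.
move=> l0 lm; have Cl : 0 < C * l by rewrite mulr_gt0.
have rm : ratio <= m / (C * l).
  rewrite ler_pdivlMr//; apply: le_trans lm.
  by rewrite /ratio -subr_ge0 (_ : _ - _ = 0)//; field; rewrite gt_eqF.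
by rewrite lerXn2r ?nnegrE// (le_trans ratio_ge0).
Qed.

Lemma low_frequency_estimate :
  ratio ^+ (4 * Nx).+1 * ratio ^+ (4 * Ny).+1 * \int[leb2 R]_(z in QL) v z ^+ 2
    <= \int[leb2 R]_(z in VL) v z ^+ 2.
Proof.
have /andP[al0 al1] := al01.
have Voo : (leb2 R VL < +oo)%E by exact: le_lt_trans (le_leb2 VQ) Qoo.
(* Sections of a Lebesgue measurable set may fail to be measurable, so the slices are taken in a
   Borel subset of full measure. *)
have [B mB [BV VB0]] := borel_kernel mV Voo.
have BQ : B `<=` Q by exact: subset_trans BV VQ.
have mBL : measurable (B : set (plane R)) by exact: borel_plane_measurable.
pose S (x : R1) : set R1 := xsection B x.
have mS x : measurable (S x) by exact: measurable_xsection.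
have Sb x : S x `<=` Ib.
  by move=> y; rewrite /S /xsection /= inE => /BQ[_ /=]; rewrite in_itv.
pose X : set R1 := Ia `&` [set x | ((alpha * b / 2)%:E <= mu (S x))%E].
have mX : measurable X.
  apply: measurableI => //.
  have mphi := measurable_fun_xsection mu mB.
  have := mphi measurableT _ (emeasurable_itv `[(alpha * b / 2)%:E, +oo[).
  rewrite setTI; congr (measurable _); apply/seteqP; split=> x /=; rewrite in_itv/= andbT//.
have Xa : X `<=` Ia by exact: subIsetl.
have Soo x : (mu (S x) < +oo)%E by apply: le_lt_trans Iboo; apply: le_measure; rewrite ?inE.
have Sfin x : mu (S x) \is a fin_num by rewrite ge0_fin_numE.
have bB := bddf_indic mB; have bX := bddf_indic_fst mX.
have indS x y : \1_B (x, y) = \1_(S x) y :> R.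
  by rewrite !indicE /S mem_xsection.
have ICb (k : R) : \int[mu]_(y in Ib) k = k * b.
  by rewrite Rintegral_cst//; congr (_ * _); exact: (congr1 fine (leb_itv0 b0)).
have indX x : \int[mu]_(y in Ib) (\1_X x : R) = \1_X x * b.
  exact: ICb.
have IS x : \int[mu]_(y in Ib) \1_(S x) y = fine (mu (S x)).
  have := @Rintegral_indicM _ _ mu Ib (S x) (fun=> 1) (Sb x).
  rewrite Rintegral_cst// mul1r => <-.
  by apply: eq_Rintegral => y _; rewrite mulr1.
have XI : mu X \is a fin_num.
  by rewrite ge0_fin_numE//; apply: le_lt_trans Iaoo; apply: le_measure; rewrite ?inE.
(* A slice has length at most b over X and at most alpha b / 2 elsewhere; integrating, alpha a b <=
   b |X| + alpha a b / 2. *)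
have X_large : alpha * a / 2 <= fine (mu X).
  have bc : bdd (fun=> alpha / 2) by exact: bddf_cst.
  have b1 : bdd (fun z => \1_X z.1 + 1 * (alpha / 2)).
    by under eq_fun do rewrite mul1r; exact: bddfD.
  have bf : bdd (fun z => (\1_X z.1 + 1 * (alpha / 2)) + (-1) * \1_B z).
    exact: bddfD b1 (bddfM (bddf_cst _ _) bB).
  have : 0 <= \int[leb2 R]_(z in QL) ((\1_X z.1 + 1 * (alpha / 2)) + (-1) * \1_B z).
    rewrite (bddf_fubini1 bf); apply: Rintegral_ge0 => x xa.
    rewrite (Rintegral_lin (-1) mIb (bddf_section1 x b1) (bddf_section1 x bB)).
    rewrite (Rintegral_lin 1 mIb (bddf_section1 x bX) (bddf_section1 x bc)) /=.
    under [X in _ + _ * X]eq_Rintegral do rewrite indS.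
    rewrite IS indX ICb.
    have [xX|xX] := boolP (x \in X).
      rewrite indicE xX mul1r mul1r mulN1r.
      have : fine (mu (S x)) <= b.
        rewrite -lee_fin fineK// -(leb_itv0 b0); apply: le_measure; rewrite ?inE//.
      have : 0 <= alpha / 2 * b by rewrite mulr_ge0 ?(ltW b0)// divr_ge0 ?(ltW al0).
      by lra.
    rewrite indicE (negbTE xX) mul0r add0r mul1r mulN1r subr_ge0.
    have : (mu (S x) < (alpha * b / 2)%:E)%E.
      rewrite ltNge; apply/negP => h; move/negP: xX; apply; rewrite inE; split => //.
    rewrite -(fineK (Sfin x)) lte_fin => /ltW h; apply: (le_trans h).
    by rewrite -subr_ge0 (_ : _ - _ = 0)//; ring.
  rewrite (Rintegral_lin (-1) mQ (bddf_integrable b1) (bddf_integrable bB)).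
  rewrite (Rintegral_lin 1 mQ (bddf_integrable bX) (bddf_integrable bc)).
  have -> : \int[leb2 R]_(z in QL) \1_X z.1 = fine (mu X) * b.
    rewrite (bddf_fubini1 bX).
    transitivity (\int[mu]_(x in Ia) (\1_X x * b)).
      by apply: eq_Rintegral => x _; exact: indX.
    by rewrite (Rintegral_indicM mu (fun=> b) Xa) Rintegral_cst// mulrC.
  have -> : \int[leb2 R]_(z in QL) (alpha / 2) = alpha / 2 * (a * b).
    by rewrite (Rintegral_cst (leb2 R) mQ) leb2_rectangle.
  have -> : \int[leb2 R]_(z in QL) \1_B z = alpha * (a * b).
    have -> : alpha * (a * b) = fine (leb2 R B).
      have EV : leb2 R VL = leb2 R B.
        rewrite -[in LHS](setDUK BV) measureU//; last 2 first.
        - exact: measurableD.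
        - by rewrite setDE setICA setICr setI0.
        by transitivity (leb2 R B + 0)%E; [congr (_ + _)%E; exact: VB0|exact: adde0].
      rewrite -EV -[fine _]/(area V) /alpha /density /area leb2_rectangle //= divfK//.
      by rewrite gt_eqF// mulr_gt0.
    have := @Rintegral_indicM _ _ (leb2 R) QL B (fun=> 1) BQ.
    rewrite (Rintegral_cst (leb2 R) mBL) mul1r => <-.
    by apply: eq_Rintegral => z _; rewrite mulr1.
  move=> h; rewrite -(ler_pM2r b0) -subr_ge0; apply: (le_trans h).
  by rewrite -subr_ge0 (_ : _ - _ = 0)//; field.
have IB : \int[leb2 R]_(z in QL) (\1_B z * v z ^+ 2) <= \int[leb2 R]_(z in VL) v z ^+ 2.
  rewrite (Rintegral_indicM (leb2 R) (fun z => v z ^+ 2) BQ).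
  apply: (le_Rintegral_subset mBL mV BV) => [|z _]; last exact: sqr_ge0.
  exact: integrableS mQ mV VQ (bddf_integrable bdd_v).
have bBv := bddfM bB bdd_v; have bXv := bddfM bX bdd_v.
pose ky := ratio ^+ (4 * Ny).+1; pose kx := ratio ^+ (4 * Nx).+1.
have kx0 : 0 <= kx by rewrite exprn_ge0.
have ky0 : 0 <= ky by rewrite exprn_ge0.
(* Turan-Nazarov in y on the slice over each x in X; elsewhere the weighted integrand is zero. The
   difference of the two integrands is integrated by Fubini, so only its sign on each slice
   matters. *)
have stepA : ky * \int[leb2 R]_(z in QL) (\1_X z.1 * v z ^+ 2) <=
    \int[leb2 R]_(z in QL) (\1_B z * v z ^+ 2).
  have bf : bdd (fun z => \1_B z * v z ^+ 2 + (- ky) * (\1_X z.1 * v z ^+ 2)).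
    exact: bddfD bBv (bddfM (bddf_cst _ _) bXv).
  have : 0 <= \int[leb2 R]_(z in QL) (\1_B z * v z ^+ 2 + (- ky) * (\1_X z.1 * v z ^+ 2)).
    rewrite (bddf_fubini1 bf); apply: Rintegral_ge0 => x xa.
    rewrite (Rintegral_lin (- ky) mIb (bddf_section1 x bBv) (bddf_section1 x bXv)).
    have -> : \int[mu]_(y in Ib) (\1_B (x, y) * v (x, y) ^+ 2) = \int[mu]_(y in S x) v (x, y) ^+ 2.
      rewrite -(Rintegral_indicM mu (fun y => v (x, y) ^+ 2) (Sb x)).
      by apply: eq_Rintegral => y _; rewrite indS.
    rewrite /= (RintegralZl _ mIb (bddf_section1 x bdd_v)).
    have [xX|xX] := boolP (x \in X); last first.
      rewrite indicE (negbTE xX) mul0r mulr0 addr0.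
      by apply: Rintegral_ge0 => y _; exact: sqr_ge0.
    rewrite indicE xX mul1r mulNr subr_ge0.
    have Sx : alpha * b / 2 <= fine (mu (S x)).
      by rewrite -lee_fin fineK//; move: xX; rewrite inE => -[].
    have Spos : (0 < mu (S x))%E.
      rewrite -(fineK (Sfin x)) lte_fin; apply: lt_le_trans Sx.
      by rewrite divr_gt0// mulr_gt0.
    have := turan_nazarov_sine Ny (fun m =>
      \sum_(i < N) (if (m < N)%N then c i m else 0) * sin (i%:R * (pi / a * x)))
      C1 TN b0 (mS x) (@Sb x) Spos.
    under eq_Rintegral do rewrite -v_section1.
    under [X in _ <= X -> _]eq_Rintegral do rewrite -v_section1.
    apply: le_trans; apply: ler_wpM2r; last exact: ratio_le.
    by apply: Rintegral_ge0 => y _; exact: sqr_ge0.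
  rewrite (Rintegral_lin (- ky) mQ (bddf_integrable bBv) (bddf_integrable bXv)).
  by rewrite mulNr subr_ge0.
(* Turan-Nazarov in x for each y, always on the same set X. *)
have stepB : kx * \int[leb2 R]_(z in QL) v z ^+ 2 <=
    \int[leb2 R]_(z in QL) (\1_X z.1 * v z ^+ 2).
  have bf : bdd (fun z => \1_X z.1 * v z ^+ 2 + (- kx) * v z ^+ 2).
    exact: bddfD bXv (bddfM (bddf_cst _ _) bdd_v).
  have : 0 <= \int[leb2 R]_(z in QL) (\1_X z.1 * v z ^+ 2 + (- kx) * v z ^+ 2).
    rewrite (bddf_fubini2 bf); apply: Rintegral_ge0 => y yb.
    rewrite (Rintegral_lin (- kx) mIa (bddf_section2 y bXv) (bddf_section2 y bdd_v)).
    rewrite (Rintegral_indicM mu (fun x => v (x, y) ^+ 2) Xa).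
    rewrite mulNr subr_ge0.
    have Xpos : (0 < mu X)%E.
      rewrite -(fineK XI) lte_fin; apply: lt_le_trans X_large.
      by rewrite divr_gt0// mulr_gt0.
    have := turan_nazarov_sine Nx (fun m =>
      \sum_(j < N) (if (m < N)%N then c m j else 0) * sin (j%:R * (pi / b * y)))
      C1 TN a0 mX Xa Xpos.
    under eq_Rintegral do rewrite -v_section2.
    under [X in _ <= X -> _]eq_Rintegral do rewrite -v_section2.
    apply: le_trans; apply: ler_wpM2r; last exact: ratio_le.
    by apply: Rintegral_ge0 => x _; exact: sqr_ge0.
  rewrite (Rintegral_lin (- kx) mQ (bddf_integrable bXv) (bddf_integrable bdd_v)).
  by rewrite mulNr subr_ge0.
apply: le_trans IB; apply: le_trans stepA.
by rewrite -/kx -/ky [kx * ky]mulrC -mulrA ler_wpM2l.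
Qed.

End low_frequency.

(** * The estimate for eigenfunctions *)

Lemma Rintegral_ae_eq d (T : measurableType d) (R : realType) (m : {measure set T -> \bar R})
    (D : set T) (f g : T -> R) : measurable D -> measurable_fun D f -> measurable_fun D g ->
  {ae m, forall x, D x -> f x = g x} ->
  \int[m]_(x in D) f x = \int[m]_(x in D) g x.
Proof.
move=> mD mf mg fg; congr fine; apply: ae_eq_integral => //.
- exact/measurable_EFinP.
- exact/measurable_EFinP.
- by apply: filterS fg => x h Dx; rewrite h.
Qed.

Section observability.
Context {R : realType}.
Variables (a b : R) (V : set (R * R)) (CNT : R).
Hypotheses (CNT_ge1 : 1 <= CNT) (TN : turan_nazarov CNT).
Hypotheses (a0 : 0 < a) (b0 : 0 < b) (VQ : V `<=` rectangle a b).
Local Notation Q := (rectangle a b).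
Local Notation QL := (Q : set (plane R)).
Local Notation VL := (V : set (plane R)).
Hypotheses (mV : measurable VL) (P_oo : (reflected_perimeter a b V < +oo)%E).
Hypotheses (V_gt0 : 0 < area V) (V_lt : area V < area Q).
Local Notation alpha := (density a b V).

Let ratio := alpha / (2 * CNT).

Let al01 : 0 < alpha < 1. Proof. exact: density_itv. Qed.
Let pi0 := @pi_gt0 R.

Let ratio_gt0 : 0 < ratio.
Proof.
by have /andP[h _] := al01; rewrite divr_gt0// mulr_gt0// (lt_le_trans ltr01).
Qed.

Let lam_gt0 : 0 < lambda_star a b V.
Proof.
rewrite /lambda_star mulr_gt0 ?divr_gt0 ?exprn_gt0 ?mulr_gt0//.
by rewrite lt_max ltr01.
Qed.

Let Nst (l : R) : nat := `|Nstar l a b V|%N.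

Let NstE l : 0 < l -> Nstar l a b V = (Nst l)%:Z.
Proof.
move=> l0; rewrite /Nst gez0_abs// /Nstar floor_ge_int divr_ge0 ?(ltW pi0)//.
by rewrite mulr_ge0 ?sqrtr_ge0// ltW.
Qed.

Let Nst_ge l (i : nat) : 0 < l -> (i%:R * (pi / l)) ^+ 2 <= lambda_star a b V -> (i <= Nst l)%N.
Proof.
move=> l0 h; rewrite -lez_nat -NstE// /Nstar floor_ge_int.
have pl : 0 <= i%:R * (pi / l) by rewrite mulr_ge0// divr_ge0 ?(ltW pi0)// ltW.
have : i%:R * (pi / l) <= Num.sqrt (lambda_star a b V).
  by rewrite -[leLHS](ger0_norm pl) -sqrtr_sqr ler_wsqrtr.
rewrite ler_pdivlMr// => h1.
by rewrite -ler_pdivrMl// mulrC -mulrA.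
Qed.

Let F_LFE : F_LF CNT a b V = ratio ^+ (2 * Nst a + 2 * Nst b + 1).
Proof. by rewrite /F_LF !NstE. Qed.

Let HF_gt0 : 0 < alpha / 2 * Defs.eta alpha.
Proof.
have /andP[al0 _] := al01.
exact: mulr_gt0 (divr_gt0 al0 (ltr0n _ 2)) (@eta_gt0 R a b V a0 b0 V_gt0 V_lt).
Qed.

Let F_HFE : F_HF alpha ^+ 2 = alpha / 2 * Defs.eta alpha.
Proof.
by rewrite /F_HF sqr_sqrtr// ltW// HF_gt0.
Qed.

Lemma F_R_gt0 : 0 < F_R CNT a b V.
Proof.
rewrite /F_R lt_min F_LFE exprn_gt0//= /F_HF sqrtr_gt0.
exact: HF_gt0.
Qed.

Lemma sine_sum_estimate N c l :
  (forall i j, c i j != 0 -> [&& (0 < i)%N, (0 < j)%N & freq a b i j == l]) ->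
  F_R CNT a b V ^+ 2 * \int[leb2 R]_(z in QL) sine_sum a b N c z ^+ 2 <=
    \int[leb2 R]_(z in VL) sine_sum a b N c z ^+ 2.
Proof.
move=> cP; have FR0 := ltW F_R_gt0.
have I0 : 0 <= \int[leb2 R]_(z in QL) sine_sum a b N c z ^+ 2.
  by apply: Rintegral_ge0 => z _; exact: sqr_ge0.
have [ll|ll] := lerP l (lambda_star a b V); last first.
  have := high_frequency_estimate a0 b0 VQ mV P_oo V_gt0 V_lt N cP ll.
  apply: le_trans; apply: ler_wpM2r => //; rewrite -F_HFE.
  by rewrite lerXn2r ?nnegrE ?sqrtr_ge0// /F_R ge_min lexx orbT.
have cP' i j : c i j != 0 -> [&& (0 < i)%N, (0 < j)%N, (i <= Nst a)%N & (j <= Nst b)%N].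
  case/cP/and3P => -> -> /eqP fl /=; apply/andP; split; apply: Nst_ge => //;
    apply: le_trans ll; rewrite -fl /freq ?lerDl ?lerDr sqr_ge0//.
have := low_frequency_estimate a0 b0 VQ mV V_gt0 V_lt N CNT_ge1 TN cP'.
apply: le_trans; apply: ler_wpM2r => //; rewrite -exprD.
(* The two exponents together are twice that of [F_LF], as they should be for squared norms. *)
have E (m n : nat) : ((4 * m).+1 + (4 * n).+1 = (2 * m + 2 * n + 1) * 2)%N.
  by clear; lia.
rewrite E.
rewrite exprM -F_LFE lerXn2r ?nnegrE// ?F_LFE ?exprn_ge0 ?(ltW ratio_gt0)//.
by rewrite -F_LFE /F_R ge_min lexx.
Qed.

(** The modes are real, so the real and the imaginary part of u are sine sums on one circle, and
    their quadratic estimates add up. *)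
Lemma eigenfunction_estimate (lambda : R[i]) u : eigenfunction Q lambda u ->
  F_R CNT a b V <= l2norm V u / l2norm Q u.
Proof.
move=> [Eu uN0]; have [/(inL2P a b)[ur ui] _] : inL2 Q u /\ True.
  by case: Eu => _ [g1 [g2 [[]]]].
have [N [cr [ci [crP ciP crE ciE]]]] := eigenspace_expansion a0 b0 Eu.
pose w z := sine_sum a b N cr z ^+ 2 + sine_sum a b N ci z ^+ 2.
have mQ := plane_measurable_rectangle a b.
have Qoo := leb2_rectangle_lty a0 b0.
have L2s c := continuous_L2 a0 b0 (@continuous_sine_sum R a b N c).
have is2 c := L2r_integrable_sqr (L2s c).
have mu_ : measurable_fun QL (fun z => cabs2 (u z)).
  by apply: measurable_funD; apply: measurable_funX; [case: ur|case: ui].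
have mw : measurable_fun QL w.
  by apply: measurable_funD; apply: measurable_funX; [case: (L2s cr)|case: (L2s ci)].
have uw : {ae leb2 R, forall z : plane R, QL z -> cabs2 (u z) = w z}.
  apply: filterS2 crE ciE => z h1 h2 Qz.
  by rewrite /cabs2 h1// h2.
have normE (D : set (plane R)) : measurable D -> D `<=` QL ->
    \int[leb2 R]_(z in D) cabs2 (u z) =
    \int[leb2 R]_(z in D) sine_sum a b N cr z ^+ 2 + \int[leb2 R]_(z in D) sine_sum a b N ci z ^+ 2.
  move=> mD DQ.
  rewrite (Rintegral_ae_eq mD (measurable_funS mQ DQ mu_) (measurable_funS mQ DQ mw)).
    exact: (RintegralD mD (integrableS mQ mD DQ (is2 cr)) (integrableS mQ mD DQ (is2 ci))).
  by apply: filterS uw => z h Dz; apply: h; exact: DQ.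
have VE := normE VL mV VQ; have QE := normE QL mQ (@subset_refl _ QL).
have est : F_R CNT a b V ^+ 2 * \int[leb2 R]_(z in QL) cabs2 (u z) <=
    \int[leb2 R]_(z in VL) cabs2 (u z).
  by rewrite VE QE mulrDr; apply: lerD; [exact: sine_sum_estimate crP|exact: sine_sum_estimate ciP].
have Iq0 : 0 <= \int[leb2 R]_(z in QL) cabs2 (u z).
  by apply: Rintegral_ge0 => z _; exact: cabs2_ge0.
(* The quotient needs a nonzero denominator: a zero norm would kill all coefficients by
   orthogonality and make u zero almost everywhere. *)
have IQ : 0 < \int[leb2 R]_(z in QL) cabs2 (u z).
  rewrite lt_neqAle Iq0 andbT eq_sym; apply/eqP => I0; apply: uN0.
  have pos c l (cP : forall i j, c i j != 0 -> [&& (0 < i)%N, (0 < j)%N & freq a b i j == l]) :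
      \int[leb2 R]_(z in QL) sine_sum a b N c z ^+ 2 = 0 -> forall z, sine_sum a b N c z = 0.
    have cP' i j : c i j != 0 -> (0 < i)%N && (0 < j)%N by move=> /cP/and3P[-> ->].
    rewrite (Rintegral_sqr_sine_sum a0 b0 N cP') => /eqP; rewrite mulf_eq0 gt_eqF; last first.
      by rewrite divr_gt0// mulr_gt0.
    rewrite psumr_eq0 => [/allP h z|p _]; last exact: sqr_ge0.
    rewrite /sine_sum big1// => p _.
    by have := h p (mem_index_enum p); rewrite sqrf_eq0 => /eqP ->; rewrite mul0r.
  have r0 : 0 <= \int[leb2 R]_(z in QL) sine_sum a b N cr z ^+ 2.
    by apply: Rintegral_ge0 => z _; exact: sqr_ge0.
  have i0 : 0 <= \int[leb2 R]_(z in QL) sine_sum a b N ci z ^+ 2.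
    by apply: Rintegral_ge0 => z _; exact: sqr_ge0.
  have /andP[/eqP zr /eqP zi] : (\int[leb2 R]_(z in QL) sine_sum a b N cr z ^+ 2 == 0) &&
      (\int[leb2 R]_(z in QL) sine_sum a b N ci z ^+ 2 == 0).
    by rewrite -paddr_eq0// -QE I0.
  apply: filterS2 crE ciE => z h1 h2 Qz; apply/eqP; rewrite eq_complex.
  by rewrite h1// h2// (pos cr _ crP zr) (pos ci _ ciP zi) /= !eqxx.
rewrite /l2norm ler_pdivlMr ?sqrtr_gt0//.
rewrite -[leLHS]ger0_norm ?mulr_ge0 ?sqrtr_ge0 ?(ltW F_R_gt0)// -sqrtr_sqr ler_wsqrtr//.
by rewrite exprMn sqr_sqrtr.
Qed.

End observability.

Theorem theorem3p14 (R : realType) (CNT a b : R) (V : set (R * R))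
  (CNT_ge1 : 1 <= CNT) (CNT_turan_nazarov : turan_nazarov CNT)
  (a_gt0 : 0 < a) (b_gt0 : 0 < b)
  (V_sub : V `<=` rectangle a b)
  (V_measurable : leb2_measurable V)
  (V_finite_perimeter : (reflected_perimeter a b V < +oo)%E)
  (V_gt0 : 0 < area V) (V_lt : area V < area (rectangle a b)) :
  [/\ forall (lambda : R[i]) (u : R * R -> R[i]),
        eigenfunction (rectangle a b) lambda u ->
        F_R CNT a b V <= l2norm V u / l2norm (rectangle a b) u,
      0 < F_R CNT a b V &
      ((F_R CNT a b V)%:E <= C2 V (rectangle a b))%E].
Proof.
have est (lambda : R[i]) u : eigenfunction (rectangle a b) lambda u ->
    F_R CNT a b V <= l2norm V u / l2norm (rectangle a b) u.
  exact: eigenfunction_estimate.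
split => //; first exact: F_R_gt0.
(* A point of the spectrum with trivial eigenspace contributes the infimum of the empty set, +oo, so
   a bound on all eigenfunctions suffices. *)
apply: le_ereal_inf_tmp => _ [lambda _ <-].
apply: le_ereal_inf_tmp => _ [u /= Eu <-].
by rewrite lee_fin; exact: est Eu.
Qed.
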